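(* Let $K$ be a tetrahedron, $k\ge3$, $\ell\ge\max\{k-1,3\}$. The sequence $$0\to \boldsymbol B_{\ell+2}(K;\mathbb R^3)\xrightarrow{\operatorname{dev}\operatorname{grad}} \boldsymbol B_{\ell+1}(\operatorname{sym}\operatorname{curl}, K;\mathbb T) \xrightarrow{\operatorname{sym}\operatorname{curl}} \mathring{\boldsymbol \Sigma}_{\ell,k}(K) \xrightarrow{\operatorname{div}\operatorname{div}} \mathbb P_{k-2}(K)\cap \mathbb P_1^{\perp}(K)\to0$$ is an exact complex. In particular $\operatorname{sym}\operatorname{curl}\boldsymbol B_{\ell+1}(\operatorname{sym}\operatorname{curl},K;\mathbb T)=\mathring{\boldsymbol\Sigma}_{\ell,k}(K)\cap\ker(\operatorname{div}\operatorname{div})$.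
   Context: $\mathbb S,\mathbb T$: real symmetric, resp. trace-free, $3\times3$ matrices; $\mathbb P_m$ polynomials of degree $\le m$. $\operatorname{grad}\boldsymbol u=(\partial_ju_i)_{ij}$, $\operatorname{dev}\boldsymbol A=\boldsymbol A-\frac13\operatorname{tr}(\boldsymbol A)\boldsymbol I$, $\operatorname{curl}$ acts row-wise on matrix fields, $\operatorname{sym}\boldsymbol A=(\boldsymbol A+\boldsymbol A^{\intercal})/2$, $\operatorname{div}\operatorname{div}\boldsymbol\tau=\sum_{i,j}\partial_i\partial_j\tau_{ij}$, $\boldsymbol x$ is the position vector. $\boldsymbol B_{\ell+2}(K;\mathbb R^3)=\{\boldsymbol v\in\mathbb P_{\ell+2}(K;\mathbb R^3):\boldsymbol v|_{\partial K}=\boldsymbol 0\}$. For a vector $\boldsymbol b$ and matrix $\boldsymbol A$: $\boldsymbol A\times\boldsymbol b$ has $i$-th row (row $i$ of $\boldsymbol A$)$\times\boldsymbol b$; $\boldsymbol b\times\boldsymbol A$ has $j$-th column $\boldsymbol b\times$(column $j$ of $\boldsymbol A$); $\boldsymbol b\cdot\boldsymbol A=\boldsymbol b^{\intercal}\boldsymbol A$. With $\boldsymbol n$ the unit outward normal of face $F$: $\boldsymbol B_{\ell+1}(\operatorname{sym}\operatorname{curl},K;\mathbb T)=\{\boldsymbol\tau\in\mathbb P_{\ell+1}(K;\mathbb T):(\boldsymbol n\cdot\boldsymbol\tau\times\boldsymbol n)|_F=\boldsymbol 0,\ (\boldsymbol n\times\operatorname{sym}(\boldsymbol\tau\times\boldsymbol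 n)\times\boldsymbol n)|_F=\boldsymbol 0\ \forall F\}$. $\boldsymbol\Sigma_{\ell,k}(K)=\operatorname{sym}\operatorname{curl}\mathbb P_{\ell+1}(K;\mathbb T)\oplus\boldsymbol x\boldsymbol x^{\intercal}\mathbb P_{k-2}(K)$, and $\mathring{\boldsymbol\Sigma}_{\ell,k}(K)$ is the set of $\boldsymbol\tau\in\boldsymbol\Sigma_{\ell,k}(K)$ with: $\boldsymbol\tau(\delta)=0$ at all vertices; $(\boldsymbol n_i^{\intercal}\boldsymbol\tau\boldsymbol n_j,q)_e=0$ for all $q\in\mathbb P_{\ell-2}(e)$, edges $e$, $i,j=1,2$ ($\boldsymbol n_1,\boldsymbol n_2$ fixed independent unit vectors orthogonal to $e$); $(\boldsymbol n^{\intercal}\boldsymbol\tau\boldsymbol n,q)_F=0$ for $q\in\mathbb P_{\ell-3}(F)$; $(2\operatorname{div}_F(\boldsymbol\tau\boldsymbol n)+\partial_n(\boldsymbol n^{\intercal}\boldsymbol\tau\boldsymbol n),q)_F=0$ for $q\in\mathbb P_{\ell-1}(F)$, all faces $F$, where $\partial_n=\boldsymbol n\cdot\nabla$ and $\operatorname{div}_F$ is the surface divergence of the tangential part. $\mathbb P_1^\perp(K)$ is the $L^2(K)$-orthogonal complement of $\mathbb P_1(K)$. *)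

(* Defs.v *)
From HB Require Import structures.
From mathcomp Require Import all_boot all_order all_algebra.
From mathcomp Require Import mpoly.
Set Implicit Arguments.
Unset Strict Implicit.
Unset Printing Implicit Defensive.
Import Order.TTheory GRing.Theory Num.Theory.
Local Open Scope ring_scope.

Definition nxt (j : 'I_3) : 'I_3 := inZp j.+1.

Definition cross (T : comRingType) (a b : 'rV[T]_3) : 'rV[T]_3 :=
  \row_j (a 0 (nxt j) * b 0 (nxt (nxt j)) - a 0 (nxt (nxt j)) * b 0 (nxt j)).

Definition dotv (T : comRingType) (a b : 'rV[T]_3) : T := (a *m b^T) 0 0.

Definition mxcr (T : comRingType) (A : 'M[T]_3) (b : 'rV[T]_3) : 'M[T]_3 :=
  \matrix_(i, j) cross (row i A) b 0 j.
Definition crmx (T : comRingType) (b : 'rV[T]_3) (A : 'M[T]_3) : 'M[T]_3 :=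
  \matrix_(i, j) cross b (col j A)^T 0 i.
(* b . A = b^T A  is  b *m A  for a row vector b *)

Section PolyFields.
Variable R : rcfType.
Local Notation P := {mpoly R[3]}.

Definition cP (x : R) : P := x%:MP.
Definition cvec (v : 'rV[R]_3) : 'rV[P]_3 := map_mx cP v.

Definition inPm (m : nat) (p : P) : Prop := (msize p <= m.+1)%N.
Definition inPmx (m r c : nat) (A : 'M[P]_(r, c)) : Prop :=
  forall i j, inPm m (A i j).

Definition dpar (i : 'I_3) (p : P) : P := mderiv i p.

Definition xvec : 'rV[P]_3 := \row_i 'X_i.

Definition grad (u : 'rV[P]_3) : 'M[P]_3 := \matrix_(i, j) dpar j (u 0 i).
Definition dev (A : 'M[P]_3) : 'M[P]_3 := A - (cP (3%:R^-1) * \tr A)%:M.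
Definition curl (A : 'M[P]_3) : 'M[P]_3 :=
  \matrix_(i, j) (dpar (nxt j) (A i (nxt (nxt j))) - dpar (nxt (nxt j)) (A i (nxt j))).
Definition symm (A : 'M[P]_3) : 'M[P]_3 := cP (2%:R^-1) *: (A + A^T).
Definition symcurl (A : 'M[P]_3) : 'M[P]_3 := symm (curl A).
Definition devgrad (u : 'rV[P]_3) : 'M[P]_3 := dev (grad u).
Definition divdiv (A : 'M[P]_3) : P := \sum_i \sum_j dpar i (dpar j (A i j)).

Definition evm (r c : nat) (x : 'rV[R]_3) (A : 'M[P]_(r, c)) : 'M[R]_(r, c) :=
  map_mx (fun p : P => p.@[fun i => x 0 i]) A.

Definition tet_nondeg (v : 'I_4 -> 'rV[R]_3) : Prop :=
  \det (\matrix_(i < 3, j < 3) (v (lift ord0 i) 0 j - v ord0 0 j)) != 0.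

Definition in_face (v : 'I_4 -> 'rV[R]_3) (i : 'I_4) (x : 'rV[R]_3) : Prop :=
  exists lam : 'I_4 -> R, [/\ forall j, 0 <= lam j, lam i = 0,
     \sum_j lam j = 1 & x = \sum_j lam j *: v j].

Definition fv (i : 'I_4) (j : 'I_3) : 'I_4 := lift i j.

Definition onormal (v : 'I_4 -> 'rV[R]_3) (i : 'I_4) : 'rV[R]_3 :=
  let a := v (fv i 0) in
  let w0 := cross (v (fv i 1) - a) (v (fv i 2) - a) in
  let w := if dotv w0 (v i - a) < 0 then w0 else - w0 in
  (Num.sqrt (dotv w w))^-1 *: w.

(* integral over the reference d-simplex (variables X_0..X_{d-1}) of a
   polynomial in those variables:  int x^m = m_0! m_1! m_2! / (|m| + d)! *)
Definition simpint (d : nat) (p : P) : R :=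
  \sum_(m <- msupp p) p@_m *
     ((\prod_(i < 3) (m i)`!)%:R / ((mdeg m + d)`!)%:R).

Definition affmap (o : 'rV[R]_3) (e : 'I_3 -> 'rV[R]_3) : 3.-tuple P :=
  [tuple (cP (o 0 i) + \sum_(j < 3) cP (e j 0 i) * 'X_j) | i < 3].

Definition normR (w : 'rV[R]_3) : R := Num.sqrt (dotv w w).

Definition intK (v : 'I_4 -> 'rV[R]_3) (p : P) : R :=
  let e := fun j : 'I_3 => v (lift ord0 j) - v ord0 in
  `|\det (\matrix_(i < 3, j < 3) e i 0 j)| *
    simpint 3 (comp_mpoly (affmap (v ord0) e) p).

Definition intF (v : 'I_4 -> 'rV[R]_3) (i : 'I_4) (p : P) : R :=
  let a := v (fv i 0) in
  let e := fun j : 'I_3 =>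
     if j == 0 then v (fv i 1) - a else if j == 1 then v (fv i 2) - a else 0 in
  normR (cross (e 0) (e 1)) * simpint 2 (comp_mpoly (affmap a e) p).

Definition intE (v : 'I_4 -> 'rV[R]_3) (a b : 'I_4) (p : P) : R :=
  let e := fun j : 'I_3 => if j == 0 then v b - v a else 0 in
  normR (e 0) * simpint 1 (comp_mpoly (affmap (v a) e) p).

Definition Bvec (v : 'I_4 -> 'rV[R]_3) (l : nat) (u : 'rV[P]_3) : Prop :=
  inPmx (l + 2) u /\
  forall i x, in_face v i x -> evm x u = 0.

Definition inPT (m : nat) (t : 'M[P]_3) : Prop := inPmx m t /\ \tr t = 0.

Definition Bsc (v : 'I_4 -> 'rV[R]_3) (l : nat) (t : 'M[P]_3) : Prop :=
  inPT (l + 1) t /\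
  forall i x, in_face v i x ->
    let n := cvec (onormal v i) in
    evm x (n *m mxcr t n) = 0 /\
    evm x (mxcr (crmx n (symm (mxcr t n))) n) = 0.

Definition inSigma (l k : nat) (s : 'M[P]_3) : Prop :=
  exists t, exists q, [/\ inPT (l + 1) t, inPm (k - 2) q &
     s = symcurl t + q *: (xvec^T *m xvec)].

(* surface divergence on the plane with unit normal n of the tangential part *)
Definition divF (n : 'rV[P]_3) (u : 'rV[P]_3) : P :=
  let Pm := 1%:M - n^T *m n in
  let w := u *m Pm in
  \sum_i \sum_j Pm i j * dpar j (w 0 i).

Definition dnorm (n : 'rV[P]_3) (f : P) : P := \sum_j n 0 j * dpar j f.

(* the space  Sigma-ring_{l,k}(K);  en : 'I_2 -> 'I_4 -> 'I_4 -> 'rV_3 gives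
   the two fixed unit vectors n_1, n_2 orthogonal to the edge [v a, v b] *)
Definition Sigma0 (v : 'I_4 -> 'rV[R]_3) (en : 'I_2 -> 'I_4 -> 'I_4 -> 'rV[R]_3)
    (l k : nat) (s : 'M[P]_3) : Prop :=
  [/\ inSigma l k s,
      forall a : 'I_4, evm (v a) s = 0,
      forall (a b : 'I_4), (a < b)%N -> forall (i j : 'I_2) q, inPm (l - 2) q ->
        intE v a b ((cvec (en i a b) *m s *m (cvec (en j a b))^T) 0 0 * q) = 0,
      forall (f : 'I_4) q, inPm (l - 3) q ->
        let n := cvec (onormal v f) in
        intF v f ((n *m s *m n^T) 0 0 * q) = 0
    & forall (f : 'I_4) q, inPm (l - 1) q ->
        let n := cvec (onormal v f) in
        intF v f ((2%:R * divF n (s *m n^T)^T + dnorm n ((n *m s *m n^T) 0 0)) * q) = 0].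

Definition PkP1perp (v : 'I_4 -> 'rV[R]_3) (k : nat) (p : P) : Prop :=
  inPm (k - 2) p /\ forall q, inPm 1 q -> intK v (p * q) = 0.

Definition edge_normals (v : 'I_4 -> 'rV[R]_3) (en : 'I_2 -> 'I_4 -> 'I_4 -> 'rV[R]_3) : Prop :=
  forall a b : 'I_4, (a < b)%N ->
    [/\ forall i, dotv (en i a b) (v b - v a) = 0,
        forall i, dotv (en i a b) (en i a b) = 1
      & \rank (col_mx (en 0 a b) (en 1 a b)) = 2%N].

End PolyFields.

(* Main.v *)
(** All conditions are rewritten as the vanishing of polynomials on planes and lines.
    Let the [lam a] be the barycentric coordinates and [F_f] the face where [lam f = 0].
    A field [t] lies in B(sym curl) iff on each [F_f] it acts on tangent vectors as a scalar
    polynomial [k_f], and [s] lies in Sigma-ring iff [s] is in Sigma and, with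
    [n = grad (lam f)], the traces [n . s n], [2 div (s n) - d_m (n . s n)] (where
    [m = n / |n|^2]) vanish on [F_f], and [grad (lam f) . s grad (lam g)] vanishes on
    [F_f] cap [F_g]: the moments determine these traces, since integration by parts shows
    that a weighted integral over a simplex is nondegenerate on polynomials.

    - If [sym curl t = 0], the polynomial Poincare lemma gives [t = dev grad u]; the scalars
      [k_f] are constants that agree along edges, and subtracting a field [alpha + beta x]
      from [u] makes it vanish on the boundary.
    - If [sym curl t] is in Sigma-ring, integrating twice on a face [F_f] gives a potential
      [w] such that [t - grad w] satisfies the condition of B(sym curl) on [F_f]. Normalised
      to vanish on the edges shared with the faces already treated, [w] lifts to a field
      vanishing on these faces. Treating the four faces in turn replaces [t] by an element
      of B(sym curl) with the same sym curl.
    - Orthogonality of [div div s] to affine functions is Stokes' formula.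
    - For surjectivity, [q xx^T] with [div div (q xx^T) = p] is approximated by a sum of
      bubbles [lam a lam b r sym ((x - v a) (x - v b)^T)], where [q] is the sum of the
      [lam a lam b r]; the error has lower degree, and it is still orthogonal to affine
      functions. In degree at most 1, orthogonality forces [p = 0]. *)

Require Import Defs.
From HB Require Import structures.
From mathcomp Require Import all_boot all_order all_algebra.
From mathcomp Require Import ssrcomplements mpoly.
From mathcomp Require Import zify ring lra.
Set Implicit Arguments.
Unset Strict Implicit.
Unset Printing Implicit Defensive.
Import Order.TTheory GRing.Theory Num.Theory.
Local Open Scope ring_scope.

(** The conditions of Sigma-ring are what makes the two integrations on a face possible. Let
    [s = sym curl t] and [n = grad (lam f)]. Then [n . s n = n . (curl t) n], so the first trace
    says that [(curl t) n] is tangential on [F_f]. The rows of [curl t] are divergence-free, so the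
    transposed half of the symmetrisation drops out of [2 div (s n)], and the second trace is the
    surface divergence of [(curl t) n]. A tangential field without surface divergence is the surface
    curl of a scalar [k]; row by row [t - k I] is then closed along the face, hence a tangential
    gradient there. The edge trace is the compatibility of the scalars of two adjacent faces. The
    minus sign in the second trace comes from [div_F (s n) = div (s n) - d_n (n . s n)] for a unit
    normal.

    The summand [q x x^T] does no harm to the degree count: [n . x] is constant on a face, so its
    traces there have only the degree of [q].

    Integrals are linear functionals prescribed on monomials, so Stokes' formula rests on identities
    between factorials. *)

(** * Polynomials in three variables: degree bounds, evaluation, derivatives, affine substitution *)

Section Polynomials.
Variable R : rcfType.
Local Notation P := {mpoly R[3]}.
Implicit Types (p q : P) (n m : nat).

Lemma inPmP n p : inPm n p <-> (forall m : 'X_{1..3}, (n < mdeg m)%N -> p@_m = 0).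
Proof.
split=> [h m hm|h]; first by apply/memN_msupp_eq0/msize_mdeg_ge/(leq_trans h).
rewrite /inPm msizeE big_tnth; apply/bigmax_leqP => i _.
rewrite ltnS leqNgt; apply/negP => /h /eqP.
by rewrite mcoeff_eq0 mem_tnth.
Qed.

Lemma inPm0 n : inPm n (0 : P).
Proof. by apply/inPmP=> m _; rewrite mcoeff0. Qed.

Lemma inPmD n p q : inPm n p -> inPm n q -> inPm n (p + q).
Proof.
move=> /inPmP hp /inPmP hq; apply/inPmP=> m hm.
by rewrite mcoeffD hp // hq // addr0.
Qed.

Lemma inPmN n p : inPm n p -> inPm n (- p).
Proof. by rewrite /inPm msizeN. Qed.

Lemma inPmB n p q : inPm n p -> inPm n q -> inPm n (p - q).
Proof. by move=> hp hq; apply/inPmD/inPmN. Qed.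

Lemma inPm_sum (I : Type) (r : seq I) (Q : pred I) (F : I -> P) n :
  (forall i, Q i -> inPm n (F i)) -> inPm n (\sum_(i <- r | Q i) F i).
Proof. by move=> h; elim/big_ind: _ => //; [apply: inPm0 | apply: inPmD]. Qed.

Lemma inPmW m n p : (m <= n)%N -> inPm m p -> inPm n p.
Proof. by move=> h hp; apply: leq_trans hp _. Qed.

Lemma inPmM m n p q : inPm m p -> inPm n q -> inPm (m + n) (p * q).
Proof.
move=> hp hq; have [->|p0] := eqVneq p 0; first by rewrite mul0r; apply: inPm0.
have [->|q0] := eqVneq q 0; first by rewrite mulr0; apply: inPm0.
rewrite /inPm msizeM //; have := leq_add hp hq; rewrite addSn addnS.
by case: (_ + _)%N => // k; rewrite ltnS => /leq_trans; apply.
Qed.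

Lemma inPmC n c : inPm n (c%:MP : P).
Proof. by rewrite /inPm msizeC; case: eqP. Qed.

Lemma inPmX i : inPm 1 ('X_i : P).
Proof. by rewrite /inPm msizeX mdeg1. Qed.

Lemma inPmMC n c p : inPm n p -> inPm n (c%:MP * p).
Proof. by move=> h; rewrite -[n]add0n; apply: inPmM => //; apply: inPmC. Qed.

Lemma inPmZ n c p : inPm n p -> inPm n (c *: p).
Proof. by rewrite -mul_mpolyC; apply: inPmMC. Qed.

Lemma inPmXn m n p : inPm m p -> inPm (m * n) (p ^+ n).
Proof.
move=> h; elim: n => [|n ih]; first by rewrite muln0 expr0; apply: inPmC.
by rewrite exprS mulnS; apply: inPmM.
Qed.

Lemma inPm_deriv n i p : inPm n.+1 p -> inPm n (p^`M(i)).
Proof.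
move=> /inPmP h; apply/inPmP => m hm; rewrite mcoeff_deriv h ?mul0rn //.
by rewrite mdegD mdeg1 addn1.
Qed.

Lemma inPm_derivW n i p : inPm n p -> inPm n (p^`M(i)).
Proof. by move=> h; apply: inPm_deriv; apply: inPmW h. Qed.

Lemma inPm0_const p : inPm 0 p -> p = (p@_0%MM)%:MP.
Proof.
move=> /inPmP h; apply/mpolyP => m; rewrite mcoeffC.
have [->|m0] := eqVneq m 0%MM; first by rewrite mulr1.
by rewrite h ?mulr0 // lt0n mdeg_eq0.
Qed.

(** Constants and variables generate the algebra; statements that respect sums and products, such as
    the chain rule, then need only these two cases. *)
Lemma mpoly_alg_ind (Q : P -> Prop) :
  (forall c, Q c%:MP) -> (forall i, Q 'X_i) ->
  (forall p q, Q p -> Q q -> Q (p + q)) ->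
  (forall p q, Q p -> Q q -> Q (p * q)) -> forall p, Q p.
Proof.
move=> hC hX hD hM p; have Q1 : Q 1 by exact: hC.
elim/mpolyind: p => [|c m p _ _ hp]; first by rewrite -(mpolyC0 3).
apply: hD => //; rewrite -mul_mpolyC; apply: (hM _ _) => //.
rewrite mpolyXE_id; apply: (big_ind Q) => // i _.
by elim: (m i) => [|k ih]; rewrite ?expr0 // exprS; apply: hM.
Qed.

Lemma deriv0_const p : (forall i, p^`M(i) = 0) -> p = (p@_0%MM)%:MP.
Proof.
move=> h; apply/inPm0_const/inPmP => m hm.
have [i hi] : exists i, m i != 0%N.
  have [/existsP //|/existsPn h0] := boolP [exists i, m i != 0%N].
  move: hm; rewrite lt0n mdeg_eq0 => /eqP; case; apply/mnmP => i.
  by rewrite mnm0E; apply/eqP; rewrite -[_ == _]negbK h0.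
have := congr1 (mcoeff (m - U_(i))%MM) (h i).
rewrite mcoeff_deriv mcoeff0 submK ?lep1mP // => /eqP.
by rewrite mulrn_eq0 /= => /eqP.
Qed.

Definition ev (x : 'rV[R]_3) (p : P) : R := p.@[fun i => x 0 i].

Lemma evD x p q : ev x (p + q) = ev x p + ev x q. Proof. exact: mevalD. Qed.
Lemma evN x p : ev x (- p) = - ev x p. Proof. exact: mevalN. Qed.
Lemma evB x p q : ev x (p - q) = ev x p - ev x q. Proof. exact: mevalB. Qed.
Lemma evM x p q : ev x (p * q) = ev x p * ev x q. Proof. exact: mevalM. Qed.
Lemma evC x c : ev x c%:MP = c. Proof. exact: mevalC. Qed.
Lemma evZ x c p : ev x (c *: p) = c * ev x p. Proof. exact: mevalZ. Qed.
Lemma ev0 x : ev x 0 = 0. Proof. exact: meval0. Qed.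
Lemma ev1 x : ev x 1 = 1. Proof. exact: meval1. Qed.
Lemma evX x i : ev x 'X_i = x 0 i. Proof. exact: mevalXU. Qed.
Lemma evcP x c : ev x (cP c) = c. Proof. exact: mevalC. Qed.
Lemma ev_sum x (I : Type) (r : seq I) (Q : pred I) (F : I -> P) :
  ev x (\sum_(i <- r | Q i) F i) = \sum_(i <- r | Q i) ev x (F i).
Proof. exact: raddf_sum. Qed.

Lemma digits_inj (N a b a' b' : nat) : (a < N)%N -> (a' < N)%N ->
  (a + N * b = a' + N * b')%N -> a = a' /\ b = b'.
Proof.
move=> ha ha' e.
have ea : a = a' by rewrite -(modn_small ha) -(modn_small ha') -(modnMDl b) -(modnMDl b' a') mulnC addnC e mulnC addnC.
split=> //; move: e; rewrite ea => /addnI /eqP; rewrite eqn_mul2l.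
by case/orP => /eqP // N0; move: ha; rewrite N0.
Qed.

(* Kronecker substitution: on the curve (s, s^N, s^(N^2)) distinct monomials
   become distinct powers of s. *)
Lemma mpoly_box0 p :
  (forall x : 'rV[R]_3, (forall i, 0 <= x 0 i <= 2%:R^-1) -> ev x p = 0) -> p = 0.
Proof.
move=> h; apply/eqP/negPn/negP => p0.
pose N := msize p; pose e (m : 'X_{1..3}) := (m 0%R + N * (m 1%R + N * m 2%:R%R))%N.
pose Q : {poly R} := \sum_(m <- msupp p) p@_m *: 'X^(e m).
have N1 : (0 < N)%N by rewrite lt0n msize_poly_eq0.
have Q0 : Q != 0.
  have hm := mlead_supp p0; set m0 := mlead p in hm.
  apply/eqP => /(congr1 (fun Z : {poly R} => Z`_(e m0))) /eqP.
  rewrite coef0 coef_sum (bigD1_seq m0) ?msupp_uniq //= coefZ coefXn eqxx mulr1.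
  rewrite big_seq_cond big1 ?addr0 => [|m /andP[hm' ne]].
    by apply/negP; rewrite -mcoeff_msupp.
  rewrite coefZ coefXn; case: eqP => [|_]; last by rewrite mulr0.
  have mN (k : 'X_{1..3}) i : k \in msupp p -> (k i < N)%N.
    move=> /msize_mdeg_lt; apply: leq_trans; rewrite ltnS mdegE.
    by rewrite (bigD1 i) //= leq_addr.
  move=> /digits_inj [||e0 /digits_inj []]; rewrite ?mN // => e1 e2.
  case/eqP: ne; apply/mnmP => i; case: i => -[|[|[|//]]] hi.
  + by rewrite (_ : Ordinal hi = 0) //; apply: val_inj.
  + by rewrite (_ : Ordinal hi = 1) //; apply: val_inj.
  + by rewrite (_ : Ordinal hi = 2%:R) //; apply: val_inj.
(* A nonzero [Q] has fewer than [size Q] roots, so this many distinct parameters suffice; the values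
   [1/(k+2)] keep every positive power inside [[0, 1/2]]. *)
pose rs := [seq ((k.+2)%:R^-1 : R) | k <- iota 0 (size Q)].
have := @max_poly_roots _ Q rs Q0.
rewrite size_map size_iota ltnn => H.
have : false; last by [].
apply: H.
  apply/allP => s /mapP [k _ ->]; set s0 : R := _^-1.
  have s0b : 0 <= s0 <= 2%:R^-1.
    by rewrite invr_ge0 ler0n lef_pV2 ?posrE ?ltr0n // ler_nat.
  have sb n : (0 < n)%N -> 0 <= s0 ^+ n <= 2%:R^-1.
    case/andP: s0b => s1 s2; case: n => // n _; rewrite exprn_ge0 //= exprS.
    rewrite -[leRHS]mulr1 ler_pM ?exprn_ge0 // exprn_ile1 //.
    by apply: le_trans s2 _; rewrite invf_le1 ?ltr0n // ler1n.
  pose x : 'rV[R]_3 := \row_i s0 ^+ (N ^ i).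
  have /h : forall i, 0 <= x 0 i <= 2%:R^-1.
    by move=> i; rewrite mxE; apply: sb; rewrite expn_gt0 N1.
  rewrite /root /ev mevalE => <-; apply/eqP.
  rewrite horner_sum; apply: eq_bigr => m _.
  rewrite hornerZ hornerXn; congr (_ * _).
  rewrite !big_ord_recl big_ord0 !mxE /= mulr1 -!exprM -!exprD /bump /=.
  congr (_ ^+ _); rewrite expn0 mul1n /e mulnDr mulnA addnA.
  have -> : lift ord0 (lift ord0 (ord0 : 'I_1)) = 2%:R :> 'I_3 by apply: val_inj.
  have -> : lift ord0 (ord0 : 'I_2) = 1 :> 'I_3 by apply: val_inj.
  have -> : ord0 = 0 :> 'I_3 by apply: val_inj.
  by rewrite !addn0 expnD expn1 addnA.
rewrite map_inj_uniq ?iota_uniq // => k k' /invr_inj /eqP.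
by rewrite eqr_nat => /eqP [].
Qed.

Lemma mpoly_ev0 p : (forall x, ev x p = 0) -> p = 0.
Proof. by move=> h; apply: mpoly_box0. Qed.

Lemma mpoly_evP p q : (forall x, ev x p = ev x q) -> p = q.
Proof.
by move=> h; apply/eqP; rewrite -subr_eq0; apply/eqP/mpoly_ev0 => x; rewrite evB h subrr.
Qed.

Definition dird (a : 'rV[R]_3) (p : P) : P := \sum_j cP (a 0 j) * dpar j p.

Lemma dirdD a p q : dird a (p + q) = dird a p + dird a q.
Proof. by rewrite /dird -big_split /=; apply: eq_bigr => j _; rewrite /dpar mderivD mulrDr. Qed.
Lemma dirdN a p : dird a (- p) = - dird a p.
Proof. by rewrite /dird -sumrN; apply: eq_bigr => j _; rewrite /dpar mderivN mulrN. Qed.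
Lemma dirdB a p q : dird a (p - q) = dird a p - dird a q.
Proof. by rewrite dirdD dirdN. Qed.
Lemma dirdC a c : dird a c%:MP = 0.
Proof. by rewrite /dird big1 // => j _; rewrite /dpar mderivC mulr0. Qed.
Lemma dird0 a : dird a 0 = 0.
Proof. exact: (dirdC a 0). Qed.
Lemma dirdM a p q : dird a (p * q) = dird a p * q + p * dird a q.
Proof.
rewrite /dird mulr_suml mulr_sumr -big_split /=; apply: eq_bigr => j _.
by rewrite /dpar mderivM; ring.
Qed.
Lemma dirdMC a c p : dird a (cP c * p) = cP c * dird a p.
Proof. by rewrite dirdM dirdC mul0r add0r. Qed.
Lemma dirdX a i : dird a 'X_i = cP (a 0 i).
Proof.
rewrite /dird (bigD1 i) //= big1 ?addr0 => [|j ji].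
  rewrite /dpar mderivX mnm1E eqxx scale1r (_ : (_ - _)%MM = 0%MM) ?mpolyX0 ?mulr1 //.
  by apply/mnmP => k; rewrite mnmBE subnn mnm0E.
by rewrite /dpar mderivX mnm1E eq_sym (negPf ji) scale0r mulr0.
Qed.
Lemma dird_sum a (I : Type) (r : seq I) (Q : pred I) (F : I -> P) :
  dird a (\sum_(i <- r | Q i) F i) = \sum_(i <- r | Q i) dird a (F i).
Proof. by apply: (big_morph (dird a)); [apply: dirdD | apply: dird0]. Qed.
Lemma dird_addl a b p : dird (a + b) p = dird a p + dird b p.
Proof.
rewrite /dird -big_split /=; apply: eq_bigr => j _.
by rewrite mxE /cP mpolyCD mulrDl.
Qed.
Lemma dird_scalel c a p : dird (c *: a) p = cP c * dird a p.
Proof.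
rewrite /dird mulr_sumr; apply: eq_bigr => j _.
by rewrite mxE /cP mpolyCM mulrA.
Qed.
Lemma dird0l p : dird 0 p = 0.
Proof. by rewrite -(scale0r 0) dird_scalel /cP mpolyC0 mul0r. Qed.
Lemma dird_oppl a p : dird (- a) p = - dird a p.
Proof. by rewrite -scaleN1r dird_scalel /cP mpolyCN mulN1r. Qed.
Lemma dird_subl a b p : dird (a - b) p = dird a p - dird b p.
Proof. by rewrite dird_addl dird_oppl. Qed.

Lemma dpar_dird i b p : dpar i (dird b p) = dird b (dpar i p).
Proof.
rewrite /dpar /dird raddf_sum /=; apply: eq_bigr => j _.
by rewrite mderiv_mulC mderiv_comm.
Qed.

Lemma dirdCA a b p : dird a (dird b p) = dird b (dird a p).
Proof.
rewrite {1}/dird [in RHS]/(dird a) dird_sum; apply: eq_bigr => j _.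
by rewrite dirdMC dpar_dird.
Qed.

Lemma inPm_dird n a p : inPm n.+1 p -> inPm n (dird a p).
Proof. by move=> h; apply: inPm_sum => j _; apply: inPmMC; apply: inPm_deriv. Qed.
Lemma inPm_dirdW n a p : inPm n p -> inPm n (dird a p).
Proof. by move=> h; apply: inPm_sum => j _; apply: inPmMC; apply: inPm_derivW. Qed.

(** Pullback by the affine map [y |-> o + sum_j y_j e_j], where the [e_j] may be dependent or zero:
    lines, projections, charts and restrictions to coordinate flats are all instances. *)
Definition sub (o : 'rV[R]_3) (e : 'I_3 -> 'rV[R]_3) (p : P) : P :=
  comp_mpoly (affmap o e) p.

Lemma ev_sub o e x p : ev x (sub o e p) = ev (o + \sum_j x 0 j *: e j) p.
Proof.
rewrite /ev /sub comp_mpoly_meval; apply: meval_eq => i.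
rewrite tnth_mktuple mevalD mevalC !mxE summxE raddf_sum /=; congr (_ + _).
by apply: eq_bigr => j _; rewrite mevalM mevalC mevalXU !mxE mulrC.
Qed.

Lemma subD o e p q : sub o e (p + q) = sub o e p + sub o e q. Proof. exact: raddfD. Qed.
Lemma subN o e p : sub o e (- p) = - sub o e p. Proof. exact: raddfN. Qed.
Lemma subB o e p q : sub o e (p - q) = sub o e p - sub o e q. Proof. exact: raddfB. Qed.
Lemma subM o e p q : sub o e (p * q) = sub o e p * sub o e q. Proof. exact: rmorphM. Qed.
Lemma subC o e c : sub o e c%:MP = c%:MP. Proof. exact: comp_mpolyC. Qed.
Lemma subX o e i : sub o e 'X_i = cP (o 0 i) + \sum_(j < 3) cP (e j 0 i) * 'X_j.
Proof. by rewrite /sub comp_mpolyXU (nth_map 0) ?size_enum_ord // nth_ord_enum. Qed.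
Lemma sub_sum o e (I : Type) (r : seq I) (Q : pred I) (F : I -> P) :
  sub o e (\sum_(i <- r | Q i) F i) = \sum_(i <- r | Q i) sub o e (F i).
Proof. exact: raddf_sum. Qed.

Lemma inPm_sub n o e p : inPm n p -> inPm n (sub o e p).
Proof.
move=> /inPmP h; rewrite /sub comp_mpolyE; rewrite big_seq.
apply: inPm_sum => m hm; apply: inPmZ.
have hn : (mdeg m <= n)%N.
  by rewrite leqNgt; apply/negP => /h /eqP; rewrite mcoeff_eq0 hm.
apply: inPmW hn _; rewrite mdegE.
elim/big_ind2: _ => [||i _]; [exact: (inPmC 0 1)|by move=> *; apply: inPmM|].
rewrite -[X in inPm X _]mul1n; apply: inPmXn; rewrite tnth_mktuple.
apply: inPmD; first exact: inPmC.
by apply: inPm_sum => j _; apply: inPmMC; apply: inPmX.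
Qed.

Lemma deriv_sub o e j p : dpar j (sub o e p) = sub o e (dird (e j) p).
Proof.
elim/mpoly_alg_ind: p => [c|i|p q hp hq|p q hp hq].
- by rewrite dirdC subC /dpar mderivC /sub raddf0.
- rewrite subX dirdX subC /dpar mderivD mderivC add0r raddf_sum /= (bigD1 j) //=.
  rewrite big1 ?addr0 => [|k kj]; rewrite mderiv_mulC mderivX mnm1E.
    rewrite eqxx scale1r (_ : (_ - _)%MM = 0%MM) ?mpolyX0 ?mulr1 //.
    by apply/mnmP => k; rewrite mnmBE subnn mnm0E.
  by rewrite (negPf kj) scale0r mulr0.
- by rewrite dirdD !subD -hp -hq /dpar mderivD.
- by rewrite dirdM subD !subM -hp -hq /dpar mderivM.
Qed.

End Polynomials.

(** * Poincare lemmas for grad, curl, dev grad and sym curl; div div of [q x x^T] *)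

Section Poincare.
Variable R : rcfType.
Local Notation P := {mpoly R[3]}.
Implicit Types (p q : P) (n : nat).

Lemma ord3P (Q : 'I_3 -> Prop) : Q 0 -> Q 1 -> Q 2%:R -> forall i, Q i.
Proof.
move=> h0 h1 h2 [[|[|[|//]]] hi].
- by rewrite (_ : Ordinal hi = 0) //; apply: val_inj.
- by rewrite (_ : Ordinal hi = 1) //; apply: val_inj.
- by rewrite (_ : Ordinal hi = 2%:R) //; apply: val_inj.
Qed.

Lemma sum3 (V : nmodType) (F : 'I_3 -> V) : \sum_i F i = F 0 + F 1 + F 2%:R.
Proof.
rewrite !big_ord_recl big_ord0 addr0 addrA.
by congr (F _ + F _ + F _); apply: val_inj.
Qed.

Lemma nxt0 : nxt 0 = 1. Proof. exact: val_inj. Qed.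
Lemma nxt1 : nxt 1 = 2%:R. Proof. exact: val_inj. Qed.
Lemma nxt2 : nxt 2%:R = 0. Proof. exact: val_inj. Qed.
Definition nxtE := (nxt0, nxt1, nxt2).

Lemma dparD i p q : dpar i (p + q) = dpar i p + dpar i q. Proof. exact: mderivD. Qed.
Lemma dparN i p : dpar i (- p) = - dpar i p. Proof. exact: mderivN. Qed.
Lemma dparB i p q : dpar i (p - q) = dpar i p - dpar i q. Proof. exact: mderivB. Qed.
Lemma dparM i p q : dpar i (p * q) = dpar i p * q + p * dpar i q. Proof. exact: mderivM. Qed.
Lemma dparC i c : dpar i (c%:MP : P) = 0. Proof. exact: mderivC. Qed.
Lemma dparcP i (c : R) : dpar i (cP c) = 0. Proof. exact: mderivC. Qed.
Lemma dpar0 i : dpar i (0 : P) = 0. Proof. exact: mderiv0. Qed.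
Lemma dparX i j : dpar i ('X_j : P) = (j == i)%:R.
Proof.
rewrite /dpar mderivX mnm1E; have [->|_] := eqVneq; last by rewrite scale0r.
rewrite scale1r (_ : (_ - _)%MM = 0%MM) ?mpolyX0 //.
by apply/mnmP => k; rewrite mnmBE subnn mnm0E.
Qed.
Lemma dparCA i j p : dpar i (dpar j p) = dpar j (dpar i p).
Proof. exact: mderiv_comm. Qed.
Lemma dpar_sum i (I : Type) (r : seq I) (Q : pred I) (F : I -> P) :
  dpar i (\sum_(k <- r | Q k) F k) = \sum_(k <- r | Q k) dpar i (F k).
Proof. exact: raddf_sum. Qed.
Lemma dparMC i c p : dpar i (cP c * p) = cP c * dpar i p.
Proof. exact: mderiv_mulC. Qed.

Definition euler p : P := \sum_i 'X_i * dpar i p.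

Lemma mcoeffXM i p m : ('X_i * p)@_m = p@_(m - U_(i))%MM *+ (m i != 0%N).
Proof.
rewrite mulrC; have [mi|mi] := boolP (m i != 0%N).
  by rewrite -{1}(@submK _ U_(i)%MM m) ?lep1mP // addmC mcoeffMX mulr1n.
apply/memN_msupp_eq0; rewrite (perm_mem (msuppMX _ _)).
apply/negP => /mapP [m' _ e]; move: mi; rewrite e mnmDE mnm1E eqxx //.
Qed.

Lemma mcoeff_euler p m : (euler p)@_m = (mdeg m)%:R * p@_m.
Proof.
rewrite raddf_sum /= mdegE natr_sum mulr_suml; apply: eq_bigr => i _.
rewrite mcoeffXM /dpar mcoeff_deriv mnmBE mnm1E eqxx mulr_natl.
have [->|mi] := eqVneq; first by rewrite mulr0n.
by rewrite mulr1n submK ?lep1mP // subn1 prednK // lt0n.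
Qed.

(* Inverse of s + euler; the coefficient of 1 is dropped when s = 0, as x / 0 = 0. *)
Definition einv (s : nat) p : P := \sum_(m <- msupp p) (p@_m / (mdeg m + s)%:R) *: 'X_[m].

Lemma mcoeff_einv s p m : (einv s p)@_m = p@_m / (mdeg m + s)%:R.
Proof.
rewrite raddf_sum /=; have [mp|mp] := boolP (m \in msupp p).
  rewrite (bigD1_seq m) ?msupp_uniq //= big1 ?addr0 => [|k kp].
    by rewrite mcoeffZ mcoeffX eqxx mulr1.
  by rewrite mcoeffZ mcoeffX (negPf kp) mulr0.
rewrite (memN_msupp_eq0 mp) mul0r big_seq big1 // => k kp.
rewrite mcoeffZ mcoeffX; case: eqP => [e|_]; last by rewrite mulr0.
by rewrite e (negPf mp) in kp.
Qed.

Lemma einvE (s : nat) p : (0 < s)%N -> euler (einv s p) + s%:R *: einv s p = p.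
Proof.
move=> s0; apply/mpolyP => m; rewrite mcoeffD mcoeffZ mcoeff_euler mcoeff_einv.
rewrite -mulrDl -natrD mulrC divfK //.
by rewrite pnatr_eq0 -lt0n addn_gt0 s0 orbT.
Qed.

(** For [s > 0], [einv s p] is the integral of [t^(s-1) p(t x)] over [0 <= t <= 1]; differentiating
    under it brings out one more factor [t]. *)
Lemma dpar_einv s i p : dpar i (einv s p) = einv s.+1 (dpar i p).
Proof.
apply/mpolyP => m; rewrite mcoeff_deriv !mcoeff_einv mcoeff_deriv mdegD mdeg1.
by rewrite addn1 addSnnS mulrnAl.
Qed.

Lemma einvD s p q : einv s (p + q) = einv s p + einv s q.
Proof. by apply/mpolyP => m; rewrite mcoeffD !mcoeff_einv mcoeffD mulrDl. Qed.

Lemma einv0 s : einv s 0 = 0.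
Proof. by apply/mpolyP => m; rewrite mcoeff_einv !mcoeff0 mul0r. Qed.

Lemma inPm_einv n s p : inPm n p -> inPm n (einv s p).
Proof. by move=> /inPmP h; apply/inPmP => m hm; rewrite mcoeff_einv h ?mul0r. Qed.

(** The potential is the line integral of [w] from the origin to [x]. Closedness turns its [i]-th
    derivative into [euler + 1] applied to [einv 1 (w i)]. *)
Lemma poincare_grad n (w : 'I_3 -> P) :
  (forall i j, dpar i (w j) = dpar j (w i)) -> (forall i, inPm n (w i)) ->
  exists2 p, inPm n.+1 p & forall i, dpar i p = w i.
Proof.
move=> hw dw; exists (\sum_i 'X_i * einv 1 (w i)).
  rewrite -add1n; apply: inPm_sum => i _.
  by apply: inPmM (inPmX _ i) _; apply: inPm_einv.
move=> i; rewrite dpar_sum -[RHS](@einvE 1) // scale1r addrC /euler.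
rewrite (eq_bigr (fun j => (j == i)%:R * einv 1 (w j) + 'X_j * dpar j (einv 1 (w i)))).
  rewrite big_split /=; congr (_ + _); rewrite (bigD1 i) //= eqxx mul1r big1 ?addr0 //.
  by move=> j /negPf ->; rewrite mul0r.
by move=> j _; rewrite dparM dparX !dpar_einv hw.
Qed.

(** The potential is the vector product of [y = einv 2 v] with the position [x], whose curl is
    [euler y + 2 y - x div y]; and [div y] is [einv 3] of [div v], hence zero. *)
Lemma poincare_curl n (v : 'I_3 -> P) :
  \sum_i dpar i (v i) = 0 -> (forall i, inPm n (v i)) ->
  exists2 w : 'I_3 -> P, forall i, inPm n.+1 (w i) &
    forall i, v i = dpar (nxt i) (w (nxt (nxt i))) - dpar (nxt (nxt i)) (w (nxt i)).
Proof.
move=> hv dv; pose y i := einv 2 (v i).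
exists (fun i => y (nxt i) * 'X_(nxt (nxt i)) - y (nxt (nxt i)) * 'X_(nxt i)).
  move=> i; rewrite -[n.+1]addn1.
  by apply: inPmB; apply: inPmM (inPmX _ _); apply: inPm_einv.
have hy : \sum_i dpar i (y i) = 0.
  rewrite (eq_bigr (fun i => einv 3 (dpar i (v i)))) => [|i _]; last by rewrite dpar_einv.
  by rewrite -(big_morph _ (einvD 3) (einv0 3)) hv einv0.
have key i : v i = euler (y i) + 2%:R * y i.
  by rewrite mulr_natl -scaler_nat /y einvE.
move: hy; rewrite sum3 -addrA => /eqP; rewrite addr_eq0 => /eqP hy.
by apply: ord3P; rewrite key !nxtE /euler sum3 !dparB !dparM !dparX /= hy; ring.
Qed.

Lemma mxBE (r c : nat) (A B : 'M[P]_(r, c)) i j : (A - B) i j = A i j - B i j.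
Proof. by rewrite !mxE. Qed.

Lemma symmE (A : 'M[P]_3) i j : symm A i j = cP (2%:R^-1) * (A i j + A j i).
Proof. by rewrite !mxE. Qed.

Lemma symcurlE (A : 'M[P]_3) i j :
  symcurl A i j = cP (2%:R^-1) * (curl A i j + curl A j i).
Proof. exact: symmE. Qed.

Lemma curlE (A : 'M[P]_3) i j : curl A i j =
  dpar (nxt j) (A i (nxt (nxt j))) - dpar (nxt (nxt j)) (A i (nxt j)).
Proof. by rewrite mxE. Qed.

Lemma cPnatV (k : nat) : (0 < k)%N -> cP (k%:R^-1) * k%:R = 1 :> P.
Proof.
move=> k0; rewrite /cP -[X in _ * X](_ : (k%:R)%:MP = _) -?mpolyCM; last by rewrite rmorph_nat.
by rewrite mulVf // pnatr_eq0 -lt0n.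
Qed.

Lemma cP2 : cP (2%:R^-1) * 2%:R = 1 :> P. Proof. exact: cPnatV. Qed.
Lemma cP3 : cP (3%:R^-1) * 3%:R = 1 :> P. Proof. exact: cPnatV. Qed.

Lemma halfDK p : cP (2%:R^-1) * (p + p) = p.
Proof. by transitivity (cP (2%:R^-1) * 2%:R * p); [ring | rewrite cP2 mul1r]. Qed.

Lemma half_eq0 p : cP (2%:R^-1) * p = 0 -> p = 0.
Proof. by move=> h; rewrite -[p]mul1r -cP2 mulrAC h mul0r. Qed.

Lemma trE (A : 'M[P]_3) : \tr A = A 0 0 + A 1 1 + A 2%:R 2%:R.
Proof. by rewrite /mxtrace sum3. Qed.

Lemma devE (A : 'M[P]_3) i j : dev A i j = A i j - (cP (3%:R^-1) * \tr A) *+ (i == j).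
Proof. by rewrite !mxE. Qed.

Lemma tr_dev (A : 'M[P]_3) : \tr (dev A) = 0.
Proof.
rewrite [LHS]trE !devE /= !mulr1n.
transitivity (A 0 0 + A 1 1 + A 2%:R 2%:R - cP 3%:R^-1 * 3%:R * \tr A); first by ring.
by rewrite -trE cP3 mul1r subrr.
Qed.

Lemma inPT_dev n (A : 'M[P]_3) : inPmx n A -> inPT n (dev A).
Proof.
move=> h; split; last exact: tr_dev.
move=> i j; rewrite devE; apply: inPmB => //; case: (i == j); last exact: inPm0.
by apply: inPmMC; rewrite trE; apply: inPmD => //; apply: inPmD.
Qed.

Lemma inPmx_grad n (u : 'rV[P]_3) : inPmx n.+1 u -> inPmx n (grad u).
Proof. by move=> h i j; rewrite mxE; apply: inPm_deriv. Qed.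

Lemma inPT_devgrad n (u : 'rV[P]_3) : inPmx n.+1 u -> inPT n (devgrad u).
Proof. by move=> h; apply/inPT_dev/inPmx_grad. Qed.

Lemma inPmx_symcurl n (t : 'M[P]_3) : inPmx n.+1 t -> inPmx n (symcurl t).
Proof.
move=> h i j; rewrite symcurlE; apply: inPmMC.
by apply: inPmD; rewrite curlE; apply: inPmB; apply: inPm_deriv.
Qed.

Lemma symcurl_tr (t : 'M[P]_3) : (symcurl t)^T = symcurl t.
Proof. by apply/matrixP => i j; rewrite mxE !symcurlE addrC. Qed.

Lemma symcurlD (s t : 'M[P]_3) : symcurl (s + t) = symcurl s + symcurl t.
Proof.
apply/matrixP => i j; by rewrite [RHS]mxE !symcurlE !curlE ![(s + t) _ _]mxE !dparD; ring.
Qed.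

Lemma symcurlN (t : 'M[P]_3) : symcurl (- t) = - symcurl t.
Proof.
apply/matrixP => i j; by rewrite [RHS]mxE !symcurlE !curlE ![(- t) _ _]mxE !dparN; ring.
Qed.

Lemma symcurlB (s t : 'M[P]_3) : symcurl (s - t) = symcurl s - symcurl t.
Proof. by rewrite symcurlD symcurlN. Qed.

(** The curl of a scalar multiple of the identity is skew. *)
Lemma symcurl_dev (t : 'M[P]_3) : symcurl (dev t) = symcurl t.
Proof.
apply/matrixP => i j; rewrite !symcurlE !curlE !devE.
move: i j; apply: ord3P; apply: ord3P; rewrite !nxtE /= ?mulr1n ?mulr0n !dparB ?dpar0; ring.
Qed.

Lemma symcurl_grad (u : 'rV[P]_3) : symcurl (grad u) = 0.
Proof.
apply/matrixP => i j; rewrite !symcurlE !curlE !mxE.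
rewrite (dparCA (nxt j)) (dparCA (nxt i)) !subrr addr0 mulr0 //.
Qed.

Lemma symcurl_devgrad (u : 'rV[P]_3) : symcurl (devgrad u) = 0.
Proof. by rewrite symcurl_dev symcurl_grad. Qed.

Lemma div_curl (t : 'M[P]_3) i : \sum_j dpar j (curl t i j) = 0.
Proof.
by rewrite sum3 !curlE !nxtE !dparB (dparCA 1 0) (dparCA 2%:R 0) (dparCA 2%:R 1); ring.
Qed.

Lemma divdiv_symcurl (t : 'M[P]_3) : divdiv (symcurl t) = 0.
Proof.
have h1 : \sum_i \sum_j dpar i (dpar j (curl t i j)) = 0.
  by rewrite big1 // => i _; rewrite -dpar_sum div_curl dpar0.
have h2 : \sum_i \sum_j dpar i (dpar j (curl t j i)) = 0.
  rewrite exchange_big -[RHS]h1; apply: eq_bigr => i _; apply: eq_bigr => j _.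
  exact: dparCA.
rewrite /divdiv (eq_bigr (fun i => cP 2%:R^-1 * (\sum_j dpar i (dpar j (curl t i j)) +
   \sum_j dpar i (dpar j (curl t j i))))) => [|i _].
  by rewrite -mulr_sumr big_split /= h1 h2 addr0 mulr0.
rewrite -big_split mulr_sumr; apply: eq_bigr => j _.
by rewrite symcurlE !dparMC !dparD.
Qed.

Lemma div_rows_curl n (A : 'M[P]_3) : (forall i, \sum_j dpar j (A i j) = 0) ->
  inPmx n A -> exists2 t, inPmx n.+1 t & A = curl t.
Proof.
move=> hA dA.
have h i : exists w : 'I_3 -> P, (forall j, inPm n.+1 (w j)) /\ forall j, A i j =
    dpar (nxt j) (w (nxt (nxt j))) - dpar (nxt (nxt j)) (w (nxt j)).
  by have [w] := poincare_curl (hA i) (dA i); exists w.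
have [w0 [d0 e0]] := h 0; have [w1 [d1 e1]] := h 1; have [w2 [d2 e2]] := h 2%:R.
exists (\matrix_(i, j) (if i == 0 then w0 j else if i == 1 then w1 j else w2 j)).
  by apply: ord3P => j; rewrite mxE /=.
by apply/matrixP; apply: ord3P => j; rewrite curlE !mxE /=.
Qed.

Lemma curl_rows_grad n (A : 'M[P]_3) : curl A = 0 -> inPmx n A ->
  exists2 u, inPmx n.+1 u & A = grad u.
Proof.
move=> hA dA.
have hc i j k : dpar j (A i k) = dpar k (A i j).
  have e j' : dpar (nxt j') (A i (nxt (nxt j'))) = dpar (nxt (nxt j')) (A i (nxt j')).
    by apply/eqP; rewrite -subr_eq0 -curlE hA mxE.
  move: (e 0) (e 1) (e 2%:R); rewrite !nxtE => e0 e1 e2.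
  by move: j k; apply: ord3P; apply: ord3P; rewrite ?e0 ?e1 ?e2.
have h i : exists u : P, inPm n.+1 u /\ forall j, dpar j u = A i j.
  by have [u] := poincare_grad (hc i) (dA i); exists u.
have [u0 [d0 e0]] := h 0; have [u1 [d1 e1]] := h 1; have [u2 [d2 e2]] := h 2%:R.
exists (\row_i (if i == 0 then u0 else if i == 1 then u1 else u2)).
  by move=> i; apply: ord3P; rewrite mxE /=.
by apply/matrixP; apply: ord3P => j; rewrite !mxE /=.
Qed.

(** [curl t] is skew with divergence-free rows, so its axial vector is a gradient, say of [p], and
    [curl t = curl (p I)]. Thus [t - p I] is a gradient; taking trace-free parts removes [p]. *)
Lemma symcurl0_devgrad n (t : 'M[P]_3) : inPT n.+1 t -> symcurl t = 0 ->
  exists2 u, inPmx n.+2 u & t = devgrad u.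
Proof.
case=> dt trt ht.
have hc i j : curl t i j = - curl t j i.
  apply/eqP; rewrite -addr_eq0; apply/eqP/half_eq0.
  by rewrite -symcurlE ht mxE.
have hii i : curl t i i = 0.
  by rewrite -[LHS]halfDK -symcurlE ht mxE.
have dC i j : inPm n (curl t i j).
  by rewrite curlE; apply: inPmB; apply: inPm_deriv.
pose w i := curl t (nxt i) (nxt (nxt i)).
have hw i j : dpar i (w j) = dpar j (w i).
  have hd := div_curl t; move: (hd 0) (hd 1) (hd 2%:R); rewrite !sum3.
  rewrite !hii !dpar0 (hc 0 2%:R) (hc 1 0) (hc 2%:R 1) !dparN !add0r !addr0 => h0 h1 h2.
  have {}h0 : dpar 1 (curl t 0 1) = dpar 2%:R (curl t 2%:R 0) by apply/eqP; rewrite -subr_eq0; apply/eqP.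
  have {}h1 : dpar 2%:R (curl t 1 2%:R) = dpar 0 (curl t 0 1).
    by apply/eqP; rewrite -subr_eq0 addrC; apply/eqP.
  have {}h2 : dpar 0 (curl t 2%:R 0) = dpar 1 (curl t 1 2%:R) by apply/eqP; rewrite -subr_eq0; apply/eqP.
  by move: i j; rewrite /w; apply: ord3P; apply: ord3P; rewrite !nxtE ?h0 ?h1 ?h2.
have [p dp hp] := poincare_grad hw (fun i => dC _ _).
have cp i j : curl (p%:M : 'M[P]_3) i j = curl t i j.
  rewrite curlE ![p%:M _ _]mxE; move: i j; apply: ord3P; apply: ord3P;
  rewrite ?hii !nxtE /= ?mulr1n ?mulr0n ?dpar0 ?hp /w ?nxtE ?subrr ?subr0 ?sub0r //.
have tc : curl (t - p%:M) = 0.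
  apply/matrixP => i j; rewrite [RHS]mxE -(subrr (curl t i j)) -{2}cp !curlE.
  by rewrite !mxBE !dparB; ring.
have [|u du eu] := @curl_rows_grad n.+1 _ tc.
  move=> i j; rewrite !mxBE mxE.
  by apply: inPmB => //; case: (i == j); [exact: dp | exact: inPm0].
exists u => //; rewrite /devgrad -eu.
apply/matrixP => i j; rewrite devE trE !mxBE ![p%:M _ _]mxE /= !mulr1n.
have -> : cP 3%:R^-1 * (t 0 0 - p + (t 1 1 - p) + (t 2%:R 2%:R - p)) = - p.
  transitivity (cP 3%:R^-1 * \tr t - cP 3%:R^-1 * 3%:R * p); first by rewrite trE; ring.
  by rewrite trt mulr0 cP3 mul1r add0r.
by rewrite mulNrn opprK subrK.
Qed.

(** The vector [div s] is divergence-free, hence the curl of some [w], which is also the row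
    divergence of the skew matrix [K] built from [w]. So [s - K] is a row-wise curl, and its
    symmetric part is [s]. *)
Lemma divdiv0_symcurl n (s : 'M[P]_3) : s^T = s -> inPmx n.+1 s -> divdiv s = 0 ->
  exists2 t, inPT n.+2 t & s = symcurl t.
Proof.
move=> hs ds dds.
have [|i|w dw ew] := @poincare_curl n (fun i => \sum_j dpar j (s i j)).
- by rewrite -[RHS]dds; apply: eq_bigr => i _; rewrite dpar_sum.
- by apply: inPm_sum => j _; apply: inPm_deriv.
pose K : 'M[P]_3 := \matrix_(i, j) (if j == nxt i then w (nxt (nxt i)) else
   if i == nxt j then - w (nxt (nxt j)) else 0).
have KT i j : K j i = - K i j.
  by rewrite !mxE; move: i j; apply: ord3P; apply: ord3P; rewrite !nxtE /= ?oppr0 ?opprK.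
have [i|i j|t dt et] := @div_rows_curl n.+1 (s - K).
- rewrite (eq_bigr (fun j => dpar j (s i j) - dpar j (K i j))) => [|j _].
    rewrite sumrB ew; apply/eqP; rewrite subr_eq0; apply/eqP.
    by move: i; apply: ord3P; rewrite sum3 !mxE !nxtE /= ?nxtE ?dpar0 ?dparN; ring.
  by rewrite !mxE -dparB.
- rewrite mxBE; apply: inPmB => //.
  by rewrite mxE; case: eqP => _; [|case: eqP => _; [apply: inPmN|exact: inPm0]].
exists (dev t); first exact: inPT_dev.
rewrite symcurl_dev; apply/matrixP => i j; rewrite symcurlE -et.
rewrite !mxBE (KT i j) -{3}hs [s^T _ _]mxE.
by rewrite opprK addrACA addNr addr0 halfDK.
Qed.

Definition xx q : 'M[P]_3 := q *: ((xvec R)^T *m xvec R).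

Lemma xxE q i j : xx q i j = q * ('X_i * 'X_j).
Proof. by rewrite !mxE big_ord1 !mxE. Qed.

Lemma divdiv_xx q : divdiv (xx q) =
  euler (euler q + 4%:R * q) + 3%:R * (euler q + 4%:R * q).
Proof.
rewrite /divdiv (eq_bigr (fun i => dpar i ('X_i * (euler q + 4%:R * q)))) => [|i _].
  set f := euler q + _; rewrite (eq_bigr (fun i => 'X_i * dpar i f + f)) => [|i _].
    by rewrite big_split /= -/(euler f) sum3; ring.
  by rewrite dparM dparX eqxx mul1r addrC.
rewrite -dpar_sum; congr dpar; rewrite /euler !sum3 !xxE !dparM !dparX.
by move: i; apply: ord3P; rewrite /=; ring.
Qed.

(** [div div (q x x^T)] is diagonal on monomials with nonzero eigenvalues: this gives injectivity,
    and [einv 3] after [einv 4] as inverse. *)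
Lemma mcoeff_divdiv_xx q m : (divdiv (xx q))@_m = ((mdeg m + 3) * (mdeg m + 4))%:R * q@_m.
Proof.
have mcN k (p : P) : (k%:R * p)@_m = k%:R * p@_m by rewrite !mulr_natl mcoeffMn.
rewrite divdiv_xx !mcoeffD mcN mcoeff_euler !mcoeffD mcN mcoeff_euler natrM !natrD.
by move: (mdeg m)%:R => d; ring.
Qed.

End Poincare.

(** * Integration over the faces of the reference simplex *)

Section SimplexFunctionals.
Variable R : rcfType.
Local Notation P := {mpoly R[3]}.
Implicit Types (p q g : P) (n : nat) (A : {set 'I_3}) (m : 'X_{1..3}).

(** A linear functional prescribed on monomials; the simplex integrals have this form, and [lin_ext]
    reduces their linear identities to monomials. *)
Definition mlin (w : 'X_{1..3} -> R) p : R := \sum_(m <- msupp p) p@_m * w m.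

Lemma mlinE w k p : (msize p <= k)%N ->
  mlin w p = \sum_(m : 'X_{1..3 < k}) p@_m * w m.
Proof.
move=> le_pi; pose I : subFinType _ := 'X_{1..3 < k}.
rewrite /mlin (big_mksub I) //=; first last.
- by move=> m /msize_mdeg_lt /leq_trans; apply.
- by rewrite msupp_uniq.
rewrite big_rmcond //= => m /memN_msupp_eq0 ->.
by rewrite mul0r.
Qed.

Lemma mlinD w p q : mlin w (p + q) = mlin w p + mlin w q.
Proof.
pose k := maxn (msize (p + q)) (maxn (msize p) (msize q)).
rewrite !(@mlinE _ k) ?leq_max ?leqnn ?orbT // -big_split.
by apply: eq_bigr => m _; rewrite mcoeffD mulrDl.
Qed.

Lemma mlinZ w c p : mlin w (c *: p) = c * mlin w p.
Proof.
pose k := maxn (msize (c *: p)) (msize p).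
rewrite !(@mlinE _ k) ?leq_max ?leqnn ?orbT // mulr_sumr.
by apply: eq_bigr => m _; rewrite mcoeffZ mulrA.
Qed.

Lemma mlin0 w : mlin w 0 = 0.
Proof. by rewrite /mlin msupp0 big_nil. Qed.

Lemma mlinX w m : mlin w 'X_[m] = w m.
Proof. by rewrite /mlin msuppX big_seq1 mcoeffX eqxx mul1r. Qed.

Lemma mlin_sum w (I : Type) (r : seq I) (Q : pred I) (F : I -> P) :
  mlin w (\sum_(i <- r | Q i) F i) = \sum_(i <- r | Q i) mlin w (F i).
Proof. by apply: (big_morph (mlin w)); [apply: mlinD | apply: mlin0]. Qed.

Lemma lin_ext (f g : P -> R) : (forall p q, f (p + q) = f p + f q) ->
  (forall c p, f (c *: p) = c * f p) -> (forall p q, g (p + q) = g p + g q) ->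
  (forall c p, g (c *: p) = c * g p) -> (forall m, f 'X_[m] = g 'X_[m]) ->
  forall p, f p = g p.
Proof.
move=> fD fZ gD gZ fg p.
have f0 : f 0 = 0 by rewrite -(scale0r 0) fZ mul0r.
have g0 : g 0 = 0 by rewrite -(scale0r 0) gZ mul0r.
rewrite (mpolyE p) (big_morph f fD f0) (big_morph g gD g0).
by apply: eq_bigr => m _; rewrite fZ gZ fg.
Qed.

(** It is the exponents that vanish on [A]: these are the monomials that survive on the flat
    [X_j = 0], [j] in [A]. *)
Definition vanishing A m := [forall j in A, m j == 0%N].

(* Integral of X^m over the face {X_j = 0, j in A} of the standard simplex, or,
   when e = 2 - #|A|, over the intersection of that face with sum X = 1. *)
Definition simpw A e m : R := if vanishing A m then
  (\prod_(i < 3) (m i)`!)%:R / ((mdeg m + e)`!)%:R else 0.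

Definition simpf A e p : R := mlin (simpw A e) p.

Lemma simpintE e p : simpint e p = simpf set0 e p.
Proof.
apply: eq_bigr => m _; rewrite /simpw /vanishing.
by case: ifP => // /negP []; apply/forallP => j; rewrite inE.
Qed.

Lemma prod_factU m i :
  (\prod_(k < 3) ((m + U_(i))%MM k)`! = (m i).+1 * \prod_(k < 3) (m k)`!)%N.
Proof.
rewrite (bigD1 i) //= [in RHS](bigD1 i) //= mulnA mnmDE mnm1E eqxx addn1 factS.
congr (_ * _)%N; apply: eq_bigr => k ki.
by rewrite mnmDE mnm1E eq_sym (negPf ki) addn0.
Qed.

Lemma vanishingU A m i : vanishing A (m + U_(i))%MM = (i \notin A) && vanishing A m.
Proof.
apply/forall_inP/andP => [h|[iA /forall_inP h] j jA]; last first.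
  rewrite mnmDE (eqP (h j jA)) mnm1E; case: (eqVneq i j) => // ij.
  by move: iA; rewrite ij jA.
split; first by apply/negP => /h; rewrite mnmDE mnm1E eqxx addn1.
by apply/forall_inP => j /h; rewrite mnmDE addn_eq0 => /andP [].
Qed.

Lemma factR_neq0 n : (n`!)%:R != 0 :> R.
Proof. by rewrite pnatr_eq0 -lt0n fact_gt0. Qed.

Lemma simpwU A e m i : i \notin A ->
  simpw A e (m + U_(i))%MM = (m i).+1%:R / (mdeg m + e.+1)%:R * simpw A e m.
Proof.
move=> iA; rewrite /simpw vanishingU iA /=; case: ifP => _; last by rewrite mulr0.
by rewrite prod_factU mdegD mdeg1 -addnA add1n !addnS factS !natrM mulrACA -invfM.
Qed.

(** For [e + #|A| = 2] this is integration in the direction [X_i]: the boundary consists of the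
    slanted facet [sum X = 1] and the facet [X_i = 0]. *)
Lemma simpf_deriv A e i p : i \notin A ->
  simpf A e.+1 (dpar i p) = simpf A e p - simpf (i |: A) e p.
Proof.
move=> iA; rewrite /simpf; move: p; apply: lin_ext => [p q|c p|p q|c p|m].
- by rewrite dparD mlinD.
- by rewrite /dpar mderivZ mlinZ.
- by rewrite !mlinD; ring.
- by rewrite !mlinZ mulrBr.
rewrite !mlinX /dpar mderivX mlinZ mlinX.
have [mi|mi] := eqVneq (m i) 0%N.
  rewrite mi mul0r; apply/esym/eqP; rewrite subr_eq0; apply/eqP.
  rewrite /simpw; congr (if _ then _ else _).
  apply/forall_inP/forall_inP => h j; rewrite ?inE => jA; last by apply: h; rewrite !inE jA orbT.
  by case/predU1P: jA => [->|/h //]; rewrite mi.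
have ne : vanishing (i |: A) m = false.
  by apply/negP => /forall_inP /(_ i); rewrite setU11 (negPf mi) => /(_ isT).
rewrite [simpw (i |: A) e m]/simpw ne subr0.
rewrite -{3}(@submK _ U_(i)%MM m) ?lep1mP //; set m' := (m - U_(i))%MM.
have -> : m i = (m' i).+1 by rewrite mnmBE mnm1E eqxx subn1 prednK // lt0n.
rewrite /simpw vanishingU iA /=; case: ifP => _; last by rewrite mulr0.
by rewrite prod_factU mdegD mdeg1 -addnA add1n natrM mulrA.
Qed.

Definition lam0 : P := 1 - \sum_(j < 3) 'X_j.

Lemma simpf_X A e i p : i \in A -> simpf A e ('X_i * p) = 0.
Proof.
move=> iA; move: p; apply: lin_ext => [p q|c p|p q|c p|m]; rewrite /simpf ?addr0 ?mulr0 //.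
- by rewrite mulrDr mlinD.
- by rewrite -scalerAr mlinZ.
- by rewrite -mpolyXD mlinX /simpw addmC vanishingU iA.
Qed.

Lemma sum_vanishing A m : vanishing A m ->
  (\sum_(j < 3 | j \notin A) (m j).+1 = mdeg m + (3 - #|A|))%N.
Proof.
move=> /forall_inP h; have m0 : (\sum_(j | j \in A) m j = 0)%N.
  by apply: big1 => j jA; apply/eqP; apply: h.
rewrite mdegE [in RHS](bigID (mem A)) /= m0 add0n.
rewrite (eq_bigr (fun j => m j + 1)%N) => [|j _]; last by rewrite addn1.
rewrite big_split /= sum1_card; congr addn.
have := cardC A; rewrite card_ord => e.
by rewrite -[X in (X - _)%N]e addKn; apply: eq_card => j; rewrite !inE.
Qed.

(** [lam0] is zero on the slanted facet, over which [simpf A e] integrates. On monomials this is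
    [sum_vanishing] with [3 - #|A| = e.+1]. *)
Lemma simpf_lam0 A e p : (e + #|A| = 2)%N -> simpf A e (lam0 * p) = 0.
Proof.
move=> eA; move: p; apply: lin_ext => [p q|c p|p q|c p|m]; rewrite /simpf ?addr0 ?mulr0 //.
- by rewrite mulrDr mlinD.
- by rewrite -scalerAr mlinZ.
have simpwXU i : mlin (simpw A e) ('X_i * 'X_[m]) =
    (i \notin A)%:R * ((m i).+1%:R / (mdeg m + e.+1)%:R * simpw A e m).
  rewrite -mpolyXD mlinX addmC; have [iA|iA] := boolP (i \in A); last by rewrite simpwU ?mul1r.
  by rewrite mul0r /simpw vanishingU iA.
rewrite /lam0 mulrBl mul1r mulr_suml mlinD -scaleN1r mlinZ mlin_sum mlinX mulN1r.
rewrite (eq_bigr _ (fun i _ => simpwXU i)).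
have [vm|vm] := boolP (vanishing A m); last first.
  rewrite /simpw (negPf vm) sub0r big1 ?oppr0 // => i _; by rewrite !mulr0.
rewrite (eq_bigr (fun i => (i \notin A)%:R * (m i).+1%:R * (simpw A e m / (mdeg m + e.+1)%:R))).
  rewrite -mulr_suml (eq_bigr (fun i => if i \notin A then (m i).+1%:R else 0 : R)).
    rewrite -big_mkcond -natr_sum sum_vanishing // (_ : 3 - #|A| = e.+1)%N; last by lia.
    by rewrite mulrCA divff ?mulr1 ?subrr // pnatr_eq0 addnS.
  by move=> i _; case: ifP => _; rewrite ?mul1r ?mul0r.
by move=> i _; ring.
Qed.

Definition indep A g := forall j, j \in A -> dpar j g = 0.

Fixpoint wgt (a : nat) (b : 'X_{1..3}) : P := if a is a'.+1 then lam0 * wgt a' b else 'X_[b].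

Lemma wgtE a b : wgt a b = lam0 ^+ a * 'X_[b].
Proof. by elim: a => [|a /= ->]; rewrite ?mul1r // exprS mulrA. Qed.

(** Dirichlet's integral, by induction on [a]: one factor [lam0] is expanded and the resulting terms
    are added by [sum_vanishing]. *)
Lemma simpf_wgt A d a m : (d + #|A| = 3)%N -> vanishing A m ->
  simpf A d (wgt a m) = (a`! * \prod_(i < 3) (m i)`!)%:R / ((mdeg m + a + d)`!)%:R.
Proof.
move=> dA; elim: a m => [|a ih] m vm.
  by rewrite /simpf mlinX /simpw vm mul1n addn0.
have -> : wgt a.+1 m = wgt a m - \sum_(i < 3) wgt a (m + U_(i))%MM.
  rewrite /= !wgtE {1}/lam0 mulrBl mul1r mulr_suml; congr (_ - _).
  by apply: eq_bigr => i _; rewrite wgtE addmC mpolyXD mulrCA.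
rewrite /simpf mlinD -scaleN1r mlinZ mulN1r mlin_sum -!/(simpf _ _ _) ih //.
set C := RHS; pose f : R := (a`! * \prod_(i < 3) (m i)`!)%:R / ((mdeg m + a.+1 + d)`!)%:R.
have E : (mdeg m + a.+1 + d = (mdeg m + a + d).+1)%N by lia.
rewrite (eq_bigr (fun i => if i \notin A then (m i).+1%:R * f else 0)) => [|i _]; last first.
  rewrite -/(simpf _ _ _); case: ifPn => [iA|]; last first.
    by rewrite negbK => iA; rewrite wgtE addmC mpolyXD mulrCA simpf_X.
  rewrite ih ?vanishingU ?iA // prod_factU mdegD mdeg1 addn1 !addSn -E.
  by rewrite /f mulrA -natrM mulnCA.
rewrite -big_mkcond /=.
rewrite -mulr_suml -natr_sum sum_vanishing // (_ : 3 - #|A| = d)%N; last by lia.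
have -> : (a`! * \prod_(i < 3) (m i)`!)%:R / ((mdeg m + a + d)`!)%:R = (mdeg m + a + d).+1%:R * f.
  rewrite /f E factS (natrM _ _.+1) invfM mulrCA mulrA (mulrC (_%:R)) -!mulrA mulrA.
  by rewrite (mulrC _^-1) mulrA mulfK // pnatr_eq0.
rewrite -mulrBl -natrB; last by lia.
rewrite (_ : _ - _ = a.+1)%N; last by lia.
by rewrite /f /C factS mulrA -natrM mulnA.
Qed.

(** The integral of the weight is a quotient of factorials, hence nonzero. *)
Lemma nondeg_const A d a b c g : (d.+1 + #|A| = 3)%N -> vanishing A b ->
  g = c%:MP -> simpf A d.+1 (wgt a b * g * 1) = 0 -> g = 0.
Proof.
move=> dA vb ->; rewrite mulr1 mulrC mul_mpolyC /simpf mlinZ -/(simpf _ _ _) simpf_wgt //.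
move/eqP; rewrite mulf_eq0 => /orP [/eqP -> //|].
rewrite mulf_eq0 invr_eq0 (negPf (factR_neq0 _)) orbF pnatr_eq0 muln_eq0.
rewrite eqn0Ngt fact_gt0 /= => /negPn /negP []; rewrite -lt0n.
by apply: prodn_gt0 => k; apply: fact_gt0.
Qed.

Lemma dpar_lam0 i : dpar i lam0 = -1.
Proof.
rewrite /lam0 dparB (dparC i 1) sub0r dpar_sum (bigD1 i) //= dparX eqxx big1 ?addr0 //.
by move=> j /negPf ji; rewrite dparX ji.
Qed.

(** The logarithmic derivative of the weight, cleared of its denominators ['X_i] and [lam0]. *)
Lemma dpar_wgt i a b :
  'X_i * lam0 * dpar i (wgt a b) = wgt a b * (lam0 * (b i)%:R - 'X_i * a%:R).
Proof.
elim: a => [|a /= ih].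
  rewrite /= mulr0 subr0 /dpar mderivX mulrAC.
  have [bi|bi] := eqVneq (b i) 0%N; first by rewrite bi scale0r !mulr0 mul0r.
  rewrite -scalerAr -mpolyXD addmC submK ?lep1mP // scaler_nat -mulr_natr; ring.
by rewrite dparM dpar_lam0 mulrDr [X in _ + X]mulrCA ih -[a.+1]addn1 natrD; ring.
Qed.

(* With the weight W = lam0^a X^b, q is replaced by W^-1 d_i (W X_i lam0 q), a
   polynomial of the same degree as X_i q; integration by parts then turns the
   hypothesis on g into the same hypothesis on d_i g for the weight W X_i lam0. *)
Lemma simpf_nondeg A d n a b g : (d.+1 + #|A| = 3)%N -> vanishing A b ->
  inPm n g -> indep A g ->
  (forall q, inPm n q -> simpf A d.+1 (wgt a b * g * q) = 0) -> g = 0.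
Proof.
move=> dA; elim: n a b g => [|n ih] a b g vb dg ig hg.
  exact: (nondeg_const dA vb (inPm0_const dg) (hg _ (inPmC 0 1))).
(* It is enough that all derivatives of [g] vanish: then [g] is constant, and the test polynomial 1
   finishes. *)
apply: (nondeg_const dA vb _ (hg _ (inPmC n.+1 1))); apply: deriv0_const => i.
have [iA|iA] := boolP (i \in A); first exact: ig.
apply: (ih a.+1 (b + U_(i))%MM); first by rewrite vanishingU iA.
- exact: inPm_deriv.
- by move=> j jA; rewrite dparCA ig // dpar0.
move=> q dq.
pose D := (lam0 * ((b i).+1)%:R - 'X_i * (a.+1)%:R) * q + lam0 * 'X_i * dpar i q.
have dD : inPm n.+1 D.
  have dX : inPm 1 ('X_i : P) by exact: inPmX.
  have dl : inPm 1 lam0.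
    by apply: inPmB; [exact: (inPmC 1 1) | apply: inPm_sum => j _; apply: inPmX].
  have dN k (p : P) : inPm 1 p -> inPm 1 (p * k%:R).
    by move=> hp; rewrite mulr_natr -scaler_nat; apply: inPmZ.
  rewrite /D -[n.+1]add1n; apply: inPmD.
    by apply: inPmM => //; apply: inPmB; apply: dN.
  (* The last summand has degree [2 + (n - 1)]; for [n = 0] this count fails, but then [q] is
     constant and the summand is zero. *)
  case: n dq {ih dg hg} => [|n] dq.
    by rewrite (inPm0_const dq) dparC mulr0; apply: inPm0.
  by rewrite add1n -add2n; apply: inPmM; [apply: (inPmM dl dX) | apply: inPm_deriv].
have hD := hg _ dD.
have : simpf A d.+1 (dpar i ('X_i * (lam0 * (wgt a b * g * q)))) = 0.
  rewrite (simpf_deriv d _ iA) (simpf_X _ _ (setU11 _ _)) subr0 mulrCA simpf_lam0 //; lia.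
have -> : dpar i ('X_i * (lam0 * (wgt a b * g * q))) =
    wgt a b * g * D + wgt a.+1 (b + U_(i))%MM * dpar i g * q.
  rewrite !dparM dparX eqxx mul1r dpar_lam0 /D (_ : wgt a.+1 _ = lam0 * (wgt a b * 'X_i)); last first.
    by rewrite !wgtE addmC mpolyXD exprS; ring.
  transitivity (lam0 * (wgt a b * g * q) - 'X_i * (wgt a b * g * q) +
    'X_i * lam0 * dpar i (wgt a b) * g * q +
    'X_i * lam0 * (wgt a b * dpar i g * q + wgt a b * g * dpar i q)); first by ring.
  by rewrite dpar_wgt -[(b i).+1]addn1 -[a.+1]addn1 !natrD; ring.
by rewrite /simpf mlinD -/(simpf _ _ _) hD add0r.
Qed.

End SimplexFunctionals.

(** * The Euclidean inner product *)

Section Dot.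
Variable R : rcfType.
Implicit Types a b c : 'rV[R]_3.

Lemma dotvE a b : dotv a b = \sum_j a 0 j * b 0 j.
Proof. by rewrite /dotv mxE; apply: eq_bigr => j _; rewrite mxE. Qed.
Lemma dotvC a b : dotv a b = dotv b a.
Proof. by rewrite !dotvE; apply: eq_bigr => j _; rewrite mulrC. Qed.
Lemma dotvDl a b c : dotv (a + b) c = dotv a c + dotv b c.
Proof. by rewrite /dotv mulmxDl mxE. Qed.
Lemma dotvDr a b c : dotv c (a + b) = dotv c a + dotv c b.
Proof. by rewrite dotvC dotvDl !(dotvC c). Qed.
Lemma dotvZl x a b : dotv (x *: a) b = x * dotv a b.
Proof. by rewrite /dotv -scalemxAl mxE. Qed.
Lemma dotvZr x a b : dotv a (x *: b) = x * dotv a b.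
Proof. by rewrite dotvC dotvZl dotvC. Qed.
Lemma dotvNl a b : dotv (- a) b = - dotv a b.
Proof. by rewrite -scaleN1r dotvZl mulN1r. Qed.
Lemma dotvNr a b : dotv a (- b) = - dotv a b.
Proof. by rewrite dotvC dotvNl dotvC. Qed.
Lemma dotvBl a b c : dotv (a - b) c = dotv a c - dotv b c.
Proof. by rewrite dotvDl dotvNl. Qed.
Lemma dotvBr a b c : dotv c (a - b) = dotv c a - dotv c b.
Proof. by rewrite dotvDr dotvNr. Qed.
Lemma dotv0l a : dotv 0 a = 0. Proof. by rewrite /dotv mul0mx mxE. Qed.
Lemma dotv0r a : dotv a 0 = 0. Proof. by rewrite dotvC dotv0l. Qed.
Lemma dotv_suml (I : Type) (r : seq I) (Q : pred I) (F : I -> 'rV[R]_3) b :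
  dotv (\sum_(i <- r | Q i) F i) b = \sum_(i <- r | Q i) dotv (F i) b.
Proof. by apply: (big_morph (fun a => dotv a b)) => [x y|]; rewrite ?dotv0l ?dotvDl. Qed.
Lemma dotv_sumr (I : Type) (r : seq I) (Q : pred I) (F : I -> 'rV[R]_3) b :
  dotv b (\sum_(i <- r | Q i) F i) = \sum_(i <- r | Q i) dotv b (F i).
Proof. by rewrite dotvC dotv_suml; apply: eq_bigr => i _; rewrite dotvC. Qed.
Lemma dotv_eq0 a : dotv a a = 0 -> a = 0.
Proof.
rewrite dotvE => /eqP; rewrite psumr_eq0 => [/allP h|j _]; last by rewrite -expr2 sqr_ge0.
apply/rowP => j; rewrite mxE; have := h j (mem_index_enum _).
by rewrite /= mulf_eq0 orbb => /eqP.
Qed.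
End Dot.

(** * Barycentric coordinates, vanishing on the flats they cut out, and division by them *)

Section Barycentric.
Variables (R : rcfType) (v : 'I_4 -> 'rV[R]_3).
Hypothesis nondeg : tet_nondeg v.
Local Notation P := {mpoly R[3]}.
Implicit Types (p q : P) (x y z : 'rV[R]_3) (a b c : 'I_4) (A B : {set 'I_4}).

Let E : 'M[R]_3 := \matrix_(i < 3, j < 3) (v (lift ord0 i) 0 j - v ord0 0 j).

(* Gradient of the barycentric coordinate lam a; it is normal to the face opposite to v a. *)
Definition dl a : 'rV[R]_3 := if unlift ord0 a is Some i then
  (col i (invmx (\matrix_(i < 3, j < 3) (v (lift ord0 i) 0 j - v ord0 0 j))))^T
  else - \sum_i (col i (invmx (\matrix_(i < 3, j < 3) (v (lift ord0 i) 0 j - v ord0 0 j))))^T.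

Lemma unitE : E \in unitmx.
Proof. by rewrite unitmxE unitfE. Qed.

Lemma dl_lift i : dl (lift ord0 i) = (col i (invmx E))^T.
Proof. by rewrite /dl liftK. Qed.

Lemma dl_ord0 : dl ord0 = - \sum_i dl (lift ord0 i).
Proof. by rewrite {1}/dl unlift_none; under [in RHS]eq_bigr => i _ do rewrite dl_lift. Qed.

Lemma dl_sum : \sum_a dl a = 0.
Proof. by rewrite big_ord_recl dl_ord0 addNr. Qed.

Lemma dl_v0 a b : dotv (dl a) (v b - v ord0) = (a == b)%:R - (a == ord0)%:R.
Proof.
have base i j : dotv (dl (lift ord0 i)) (v (lift ord0 j) - v ord0) = (i == j)%:R.
  rewrite dl_lift dotvC dotvE eq_sym.
  have /matrixP /(_ j i) := mulmxV unitE; rewrite !mxE => <-.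
  by apply: eq_bigr => k _; rewrite !mxE.
case: (unliftP ord0 b) => [j ->|->]; last by rewrite !subrr dotv0r.
case: (unliftP ord0 a) => [i ->|->].
  by rewrite base (inj_eq (@lift_inj _ ord0)) [lift _ _ == ord0]eq_sym (negPf (neq_lift _ _)) subr0.
rewrite dl_ord0 dotvNl dotv_suml (negPf (neq_lift _ _)) eqxx sub0r; congr (- _).
rewrite (eq_bigr (fun i => (i == j)%:R)) => [|i _]; last exact: base.
by rewrite (bigD1 j) //= eqxx big1 ?addr0 // => i /negPf ->.
Qed.

Lemma dl_v a b c : dotv (dl a) (v b - v c) = (a == b)%:R - (a == c)%:R.
Proof.
have e : v b - v c = (v b - v ord0) - (v c - v ord0) by rewrite opprB addrA subrK.
by rewrite e dotvBr !dl_v0 opprB addrA subrK.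
Qed.

Lemma dl_expand x : x = \sum_a dotv (dl a) x *: v a.
Proof.
have e0 : x = \sum_i dotv (dl (lift ord0 i)) x *: (v (lift ord0 i) - v ord0).
  have := mulmxKV unitE x => {1}<-; rewrite mulmx_sum_row; apply: eq_bigr => i _.
  congr (_ *: _); last by apply/rowP => j; rewrite !mxE.
  by rewrite dl_lift dotvC dotvE mxE; apply: eq_bigr => j _; rewrite !mxE.
rewrite [LHS]e0 [RHS]big_ord_recl dl_ord0 dotvNl dotv_suml scaleNr scaler_suml addrC -sumrB.
by apply: eq_bigr => i _; rewrite scalerBr.
Qed.

Definition lam a : P :=
  cP ((a == ord0)%:R - dotv (dl a) (v ord0)) + \sum_j cP (dl a 0 j) * 'X_j.

Lemma lamE a :
  lam a = cP ((a == ord0)%:R - dotv (dl a) (v ord0)) + \sum_j cP (dl a 0 j) * 'X_j.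
Proof. by []. Qed.

Lemma ev_lam x a : ev x (lam a) = (a == ord0)%:R + dotv (dl a) (x - v ord0).
Proof.
rewrite /lam evD evcP ev_sum dotvBr -addrA [- _ + _]addrC; congr (_ + (_ - _)).
by rewrite dotvE; apply: eq_bigr => j _; rewrite evM evcP evX.
Qed.

Lemma ev_lamD x y a : ev (x + y) (lam a) = ev x (lam a) + dotv (dl a) y.
Proof. by rewrite !ev_lam [x + y - _]addrAC (dotvDr (x - _)) addrA. Qed.

Lemma ev_lam_v a b : ev (v b) (lam a) = (a == b)%:R.
Proof. by rewrite ev_lam dl_v addrC subrK. Qed.

Lemma inPm_lam a : inPm 1 (lam a).
Proof. by apply: inPmD; [apply: inPmC | apply: inPm_sum => j _; apply: inPmMC; apply: inPmX]. Qed.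

Lemma lam_sum : \sum_a lam a = 1.
Proof.
apply: mpoly_evP => x; rewrite ev1 ev_sum (eq_bigr _ (fun a _ => ev_lam x a)) big_split /=.
by rewrite -dotv_suml dl_sum dotv0l addr0 (bigD1 ord0) //= big1 ?addr0 // => a /negPf ->.
Qed.

Lemma point_expand x : x = \sum_a ev x (lam a) *: v a.
Proof.
rewrite (eq_bigr (fun a => (a == ord0)%:R *: v a + dotv (dl a) (x - v ord0) *: v a)).
  rewrite big_split /= -dl_expand (bigD1 ord0) //= big1 => [|a /negPf ->]; last exact: scale0r.
  by rewrite scale1r addr0 addrC subrK.
by move=> a _; rewrite ev_lam scalerDl.
Qed.

Lemma X_expand i : 'X_i = \sum_a cP (v a 0 i) * lam a.
Proof.
apply: mpoly_evP => x; rewrite evX {1}(point_expand x) summxE ev_sum.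
by apply: eq_bigr => a _; rewrite mxE evM evcP mulrC.
Qed.

(** Vanishing on a whole flat: the plane of a face for one index, the line of an edge for two, a
    vertex for three. Unlike the faces themselves, flats contain full lines, so restriction to a
    line gives an identity of polynomials. *)
Definition van A p := forall x, (forall a, a \in A -> ev x (lam a) = 0) -> ev x p = 0.

Lemma van0 A : van A 0. Proof. by move=> x _; rewrite ev0. Qed.
Lemma vanD A p q : van A p -> van A q -> van A (p + q).
Proof. by move=> hp hq x hx; rewrite evD hp // hq // addr0. Qed.
Lemma vanN A p : van A p -> van A (- p).
Proof. by move=> hp x hx; rewrite evN hp // oppr0. Qed.
Lemma vanB A p q : van A p -> van A q -> van A (p - q).
Proof. by move=> hp hq; apply: vanD => //; apply: vanN. Qed.
Lemma vanMl A p q : van A p -> van A (q * p).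
Proof. by move=> hp x hx; rewrite evM hp // mulr0. Qed.
Lemma vanMr A p q : van A p -> van A (p * q).
Proof. by move=> hp; rewrite mulrC; apply: vanMl. Qed.
Lemma van_sum A (I : Type) (r : seq I) (Q : pred I) (F : I -> P) :
  (forall i, Q i -> van A (F i)) -> van A (\sum_(i <- r | Q i) F i).
Proof. by move=> h; elim/big_ind: _ => //; [apply: van0 | apply: vanD]. Qed.
Lemma vanS A B p : A \subset B -> van A p -> van B p.
Proof. by move=> /subsetP AB h x hx; apply: h => a /AB /hx. Qed.
Lemma van_lam A a : a \in A -> van A (lam a).
Proof. by move=> aA x; apply. Qed.
Lemma van_subr A p q : van A (p - q) -> van A q -> van A p.
Proof. by move=> h hq; rewrite -[p](subrK q); apply: vanD. Qed.
Lemma van_subl A p q : van A (p - q) -> van A p -> van A q.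
Proof. by move=> h hp; rewrite -[q](subKr p); apply: vanB. Qed.
Lemma van_trans A p q r : van A (p - q) -> van A (q - r) -> van A (p - r).
Proof. by move=> h1 h2; rewrite -(subrK q p) -addrA; apply: vanD. Qed.

Definition line x y : P -> P := sub x (fun j => if j == 0 then y else 0).

Lemma ev_line x y z p : ev z (line x y p) = ev (x + z 0 0 *: y) p.
Proof. by rewrite ev_sub sum3 /= !scaler0 !addr0. Qed.

Lemma line0 x y p : line x y p = 0 -> ev x p = 0.
Proof.
by move=> h; have := ev_line x y 0 p; rewrite h ev0 mxE scale0r addr0.
Qed.

Lemma van_line A x y p : van A p -> (forall a, a \in A -> ev x (lam a) = 0) ->
  (forall a, a \in A -> dotv (dl a) y = 0) -> line x y p = 0.
Proof.
move=> h hx hy; apply: mpoly_ev0 => z; rewrite ev_line; apply: h => a aA.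
by rewrite ev_lamD dotvZr hx // hy // mulr0 addr0.
Qed.

(** [p] is the zero polynomial on the line in direction [y] through any point of the flat. *)
Lemma van_dird A y p : (forall a, a \in A -> dotv (dl a) y = 0) ->
  van A p -> van A (dird y p).
Proof.
move=> hy h x hx; apply: (@line0 _ y).
have := deriv_sub x (fun j => if j == 0 then y else 0) 0 p.
by rewrite /= -!/(line _ _ _) (van_line h) // dpar0.
Qed.

(** The direction [v a - v c] lies in the flat and [lam a] has slope 1 along it, so [lam a] is a
    nonzero polynomial on each such line and can be cancelled. *)
Lemma van_cancel A a c p : c != a -> c \notin A -> a \notin A ->
  van A (lam a * p) -> van A p.
Proof.
move=> ca cA aA h x hx; pose y := v a - v c; apply: (@line0 _ y).
have hy b : b \in A -> dotv (dl b) y = 0.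
  move=> bA; rewrite dl_v; do 2![case: eqP => [e|_]; first by rewrite -e bA in cA, aA *].
  by rewrite subr0.
have := van_line h hx hy; rewrite /line subM => /eqP; rewrite mulf_eq0.
case/orP => /eqP // e; pose z : 'rV[R]_3 := \row__ (1 - ev x (lam a)).
have := ev_line x y z (lam a); rewrite /line e ev0 ev_lamD mxE dotvZr dl_v eqxx eq_sym.
by rewrite (negPf ca) subr0 mulr1 addrC subrK => /eqP; rewrite eq_sym oner_eq0.
Qed.

(** For [c != a], composition with the projection onto the plane of [F_a] along the edge
    [v a - v c]; it leaves the other coordinates [lam b], [b] not [a] or [c], unchanged. *)
Definition proj a c : P -> P := sub (- ev 0 (lam a) *: (v a - v c))
  (fun j => delta_mx 0 j - dl a 0 j *: (v a - v c)).

Lemma ev_proj a c x p : ev x (proj a c p) = ev (x - ev x (lam a) *: (v a - v c)) p.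
Proof.
rewrite ev_sub; congr (ev _ _).
have -> : ev x (lam a) = ev 0 (lam a) + dotv (dl a) x by rewrite -{1}[x]add0r ev_lamD.
rewrite scalerDl opprD -scaleNr addrCA; congr (_ + _).
rewrite (eq_bigr (fun j => x 0 j *: delta_mx 0 j - (dl a 0 j * x 0 j) *: (v a - v c))).
  by rewrite sumrB -scaler_suml -dotvE -row_sum_delta.
by move=> j _; rewrite scalerBr scalerA mulrC.
Qed.

(** Division with remainder by an affine form. Divisibility of [p - proj a c p] is checked on
    generators; the degree of the quotient follows since [lam a] is not constant. *)
Lemma lam_div a c n p : inPm n p ->
  exists2 p', inPm n.-1 p' & p = proj a c p + lam a * p'.
Proof.
move=> dp.
have [p' e] : exists p', p - proj a c p = lam a * p'.
  elim/mpoly_alg_ind: p {dp} => [x|i|p q [p' ep] [q' eq]|p q [p' ep] [q' eq]].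
  - by exists 0; rewrite /proj subC subrr mulr0.
  - exists (cP ((v a - v c) 0 i)); apply: mpoly_evP => x.
    rewrite evB ev_proj evM evcP !evX.
    set d := v a - v c; rewrite (_ : (x - _ *: d) 0 i = x 0 i - ev x (lam a) * d 0 i) ?subKr //.
    by rewrite !mxE.
  - by exists (p' + q'); rewrite mulrDr -ep -eq /proj subD; ring.
  - exists (p' * q + proj a c p * q').
    by rewrite mulrDr mulrA -ep mulrCA -eq /proj subM; ring.
exists p'; last by rewrite -e addrC subrK.
have [->|p0] := eqVneq p' 0; first exact: inPm0.
have l0 : lam a != 0 by apply/eqP => /(congr1 (ev (v a))) /eqP; rewrite ev_lam_v eqxx ev0 oner_eq0.
have : inPm n (p - proj a c p) by apply: inPmB => //; apply: inPm_sub.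
rewrite e /inPm msizeM //.
have l1 : (1 < msize (lam a))%N.
  rewrite ltnNge; apply/negP => /(@inPm0_const R) lc.
  have := ev_lam_v a a; have := ev_lam_v a (if a == 0 then 1 else 0); rewrite lc !evC => ->.
  by rewrite eqxx; case: (eqVneq a 0) => [->|/negPf ->] /eqP; rewrite eq_sym oner_eq0.
by move: l1 p0; rewrite -msize_poly_eq0; move: (msize (lam a)) (msize p') => s t; lia.
Qed.

(** As [c] is outside [A], the projection maps the flat of [A] into that of [a |: A], so the
    remainder of the division vanishes on the former. *)
Lemma van_div A a c n p : c != a -> c \notin A -> a \notin A -> inPm n p -> van (a |: A) p ->
  exists2 p', inPm n.-1 p' & van A (p - lam a * p').
Proof.
move=> ca cA aA dp h; have [p' dp' e] := lam_div a c dp; exists p' => // x hx.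
rewrite {1}e addrK ev_proj; apply: h => b; rewrite in_setU1 => /orP [/eqP ->|bA];
  rewrite -scaleNr ev_lamD dotvZr dl_v.
  by rewrite eqxx eq_sym (negPf ca) subr0 mulr1 subrr.
rewrite hx // (_ : b == a = false) 1?(_ : b == c = false) ?subrr ?mulr0 ?addr0 //.
  by apply/negP => /eqP e'; rewrite -e' bA in cA.
by apply/negP => /eqP e'; rewrite -e' bA in aA.
Qed.

End Barycentric.

(** * Affine charts at a vertex *)

Section Charts.
Variables (R : rcfType) (v : 'I_4 -> 'rV[R]_3).
Hypothesis nondeg : tet_nondeg v.
Local Notation P := {mpoly R[3]}.
Local Notation dl := (dl v).
Local Notation lam := (lam v).
Local Notation van := (van v).
Implicit Types (p q : P) (x y z : 'rV[R]_3) (a b c f : 'I_4) (A : {set 'I_3}).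

Definition tri b0 b1 b2 (i : 'I_3) : 'I_4 := if i == 0 then b0 else if i == 1 then b1 else b2.

Lemma sum_uniq4 (V : nmodType) (F : 'I_4 -> V) o b0 b1 b2 : uniq [:: o; b0; b1; b2] ->
  \sum_a F a = F o + (F b0 + F b1 + F b2).
Proof.
move=> u; rewrite -addrA -[F b2]addr0.
have pe : perm_eq (index_enum 'I_4) [:: o; b0; b1; b2].
  rewrite perm_sym; apply: uniq_perm => //; first exact: index_enum_uniq.
  have [||_ mm] := @uniq_min_size _ [:: o; b0; b1; b2] (index_enum 'I_4) u.
  - by move=> x _; apply: mem_index_enum.
  - by rewrite [index_enum _]unlock -enumT size_enum_ord.
  - exact: mm.
by rewrite (perm_big _ pe) !big_cons big_nil.
Qed.

Lemma fv_uniq f : uniq [:: f; fv f 0; fv f 1; fv f 2%:R].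
Proof.
by rewrite /fv /= !inE !negb_or !(neq_lift, inj_eq (@lift_inj _ f)).
Qed.

(** The edge shared by [F_f] and [F_c], with its ends ordered because edge normals and edge moments
    are given only for [a < b]. *)
Lemma other_pair f c : f != c -> exists a b, (a < b)%N /\ uniq [:: a; b; f; c].
Proof.
have h (n : nat) : (n < 4)%N -> exists2 i : 'I_4, i = n :> nat & true by move=> hn; exists (Ordinal hn).
have [i0 e0 _] := h 0%N isT; have [i1 e1 _] := h 1%N isT.
have [i2 e2 _] := h 2%N isT; have [i3 e3 _] := h 3%N isT.
have D (a b : 'I_4) : (a == b) = (a == b :> nat) by [].
rewrite D; move: f c => [[|[|[|[|//]]]] hf] [[|[|[|[|//]]]] hc] //= _;
 first [by exists i0, i1; rewrite /= !inE !D e0 e1 | by exists i0, i2; rewrite /= !inE !D e0 e2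
  | by exists i0, i3; rewrite /= !inE !D e0 e3 | by exists i1, i2; rewrite /= !inE !D e1 e2
  | by exists i1, i3; rewrite /= !inE !D e1 e3 | by exists i2, i3; rewrite /= !inE !D e2 e3].
Qed.

(** A face is Zariski dense in its plane: in coordinates on the plane it contains the square
    [[0, 1/2]^2], on which only the zero polynomial vanishes identically. *)
Lemma in_face_van f p : (forall x, in_face v f x -> ev x p = 0) <-> van [set f] p.
Proof.
split=> [h x /(_ f (set11 f)) hx|h x [l [_ lf l1 ->]]]; last first.
  apply: h => a; rewrite inE => /eqP ->; rewrite ev_lam.
  have -> : \sum_j l j *: v j - v ord0 = \sum_j l j *: (v j - v ord0).
    by rewrite -{1}[v ord0]scale1r -l1 scaler_suml -sumrB; apply: eq_bigr => j _; rewrite scalerBr.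
  rewrite dotv_sumr (eq_bigr (fun j => (f == j)%:R * l j - (f == ord0)%:R * l j)) => [|j _].
    rewrite sumrB -mulr_sumr l1 mulr1 addrC subrK (bigD1 f) //= lf mulr0 big1 ?addr0 // => j.
    by rewrite eq_sym => /negPf ->; rewrite mul0r.
  by rewrite dotvZr dl_v // mulrC mulrBl.
pose o := fv f 0; pose e := fun j : 'I_3 => if j == 0 then v (fv f 1) - v o else
  if j == 1 then v (fv f 2%:R) - v o else 0.
have u := fv_uniq f.
have := u; rewrite /= !inE !negb_or => /and4P [/and3P [n01 n02 n03] /andP [n12 n13] n23 _].
have h0 : sub (v o) e p = 0.
  apply: mpoly_box0 => y hy; rewrite ev_sub; apply: h.
  have /andP [y0 y0'] := hy 0; have /andP [y1 y1'] := hy 1.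
  exists (fun j => if j == f then 0 else if j == fv f 1 then y 0 0 else if j == fv f 2%:R then y 0 1
     else 1 - y 0 0 - y 0 1); split.
  - move=> j; case: ifP => // _; case: ifP => // _; case: ifP => // _.
    by move: y0' y1'; lra.
  - by rewrite eqxx.
  - rewrite (sum_uniq4 _ u) eqxx [fv f 0 == f]eq_sym (negPf n01) (negPf n12) (negPf n13).
    rewrite [fv f 1 == f]eq_sym (negPf n02) eqxx [fv f 2%:R == f]eq_sym (negPf n03).
    by rewrite [_ == fv f 1]eq_sym (negPf n23) eqxx; ring.
  - rewrite (sum_uniq4 _ u) eqxx [fv f 0 == f]eq_sym (negPf n01) (negPf n12) (negPf n13).
    rewrite [fv f 1 == f]eq_sym (negPf n02) eqxx [fv f 2%:R == f]eq_sym (negPf n03).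
    rewrite [_ == fv f 1]eq_sym (negPf n23) eqxx sum3 /e /= -/o.
    by apply/rowP => k; rewrite !mxE; ring.
pose y : 'rV[R]_3 := \row_i ev x (lam (fv f (if i == 0 then 1 else 2%:R))).
have := ev_sub (v o) e y p; rewrite h0 ev0 => ->; congr (ev _ _).
have := lam_sum v => /(congr1 (ev x)); rewrite ev1 ev_sum (sum_uniq4 _ u) hx add0r => s1.
have e0 : ev x (lam (fv f 0)) = 1 - ev x (lam (fv f 1)) - ev x (lam (fv f 2%:R)).
  by rewrite -s1; ring.
rewrite {1}(point_expand nondeg x) (sum_uniq4 _ u) hx scale0r add0r e0.
rewrite sum3 /e /y /= !mxE /= -/o.
by apply/rowP => k; rewrite !mxE; ring.
Qed.

(* Affine coordinates X_i = lam (b i) with origin the vertex o. *)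
Definition chart o (b : 'I_3 -> 'I_4) : P -> P := sub (v o) (fun i => v (b i) - v o).

Lemma chartD o (b : 'I_3 -> 'I_4) p q : chart o b (p + q) = chart o b p + chart o b q.
Proof. exact: subD. Qed.

(** The inverse of [chart]: it substitutes [lam (b i)] for ['X_i]. *)
Definition chartV (b : 'I_3 -> 'I_4) : P -> P :=
  sub (\row_i ev 0 (lam (b i))) (fun j => \row_i dl (b i) 0 j).

Definition kill A : P -> P := sub 0 (fun j => if j \in A then 0 else delta_mx 0 j).

Lemma ev_kill A y p : ev y (kill A p) = ev (\row_j (if j \in A then 0 else y 0 j)) p.
Proof.
rewrite ev_sub add0r; congr (ev _ _); rewrite [RHS]row_sum_delta; apply: eq_bigr => j _.
by rewrite mxE; case: ifP; rewrite ?scaler0 ?scale0r.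
Qed.

Lemma kill_idem A p : kill A (kill A p) = kill A p.
Proof.
apply: mpoly_evP => y; rewrite !ev_kill; congr (ev _ _); apply/rowP => j; rewrite !mxE.
by case: ifP => [//|->].
Qed.

Lemma indep_kill A p : indep A (kill A p).
Proof. by move=> j jA; rewrite /kill deriv_sub jA dird0l /sub raddf0. Qed.

Lemma killM A p q : kill A (p * q) = kill A p * kill A q. Proof. exact: subM. Qed.

Lemma chartM o (b : 'I_3 -> 'I_4) p q : chart o b (p * q) = chart o b p * chart o b q. Proof. exact: subM. Qed.

(** Restriction to the flat either fixes a monomial or kills it. This links the edge and face
    integrals, defined through parametrisations, with functionals in all three variables. *)
Lemma simpf_kill A d p : simpf A d p = simpint d (kill A p).
Proof.
rewrite simpintE; move: p; apply: lin_ext => [p q|c p|p q|c p|m].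
- exact: mlinD.
- exact: mlinZ.
- by rewrite /kill subD /simpf mlinD.
- by rewrite -mul_mpolyC /kill subM subC mul_mpolyC /simpf mlinZ.
have -> : kill A 'X_[m] = (vanishing A m)%:R *: 'X_[m].
  apply: mpoly_evP => y; rewrite ev_kill evZ /ev !mevalX.
  have [vm|vm] := boolP (vanishing A m).
    rewrite mul1r; apply: eq_bigr => i _; rewrite mxE; case: ifP => // iA.
    by have /forall_inP /(_ i iA) /eqP -> := vm; rewrite !expr0.
  rewrite mul0r; have /forall_inPn /= [j jA mj] := vm.
  by rewrite (bigD1 j) //= mxE jA expr0n (negPf mj) mul0r.
rewrite /simpf mlinZ !mlinX /simpw (_ : vanishing set0 m); last by apply/forall_inP => j; rewrite inE.
by case: ifP => _; rewrite ?mul1r ?mul0r.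
Qed.

Section Chart.
Variables (o : 'I_4) (b : 'I_3 -> 'I_4).
Hypothesis ob : uniq [:: o; b 0; b 1; b 2%:R].

Lemma chart_sum (V : nmodType) (F : 'I_4 -> V) : \sum_a F a = F o + \sum_i F (b i).
Proof. by rewrite (sum_uniq4 _ ob) sum3. Qed.

Lemma chart_neq i : (b i == o) = false.
Proof.
move: ob; rewrite /= !inE !negb_or => /and3P [/and3P [h0 h1 h2] _ _].
by rewrite eq_sym; apply: negPf; move: i; apply: ord3P.
Qed.

Lemma chart_inj i j : (b i == b j) = (i == j).
Proof.
move: ob; rewrite /= !inE !negb_or => /and4P [_ /andP [h0 h1] h2 _].
move: i j; apply: ord3P; apply: ord3P; rewrite ?eqxx //= ?(negPf h0) ?(negPf h1) ?(negPf h2) //;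
by rewrite eq_sym ?(negPf h0) ?(negPf h1) ?(negPf h2).
Qed.

Definition cpt y := v o + \sum_i y 0 i *: (v (b i) - v o).

Lemma ev_chart y p : ev y (chart o b p) = ev (cpt y) p.
Proof. exact: ev_sub. Qed.

Lemma lam_cpt y i : ev (cpt y) (lam (b i)) = y 0 i.
Proof.
rewrite /cpt ev_lamD ev_lam_v // chart_neq add0r dotv_sumr (bigD1 i) //= dotvZr dl_v //.
rewrite eqxx chart_neq subr0 mulr1 big1 ?addr0 // => j ji.
by rewrite dotvZr dl_v // chart_inj eq_sym (negPf ji) chart_neq subr0 mulr0.
Qed.

Lemma cptK z : cpt (\row_i ev z (lam (b i))) = z.
Proof.
rewrite [RHS](point_expand nondeg) chart_sum /cpt.
have := lam_sum v => /(congr1 (ev z)); rewrite ev1 ev_sum chart_sum => s1.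
rewrite -{1}[v o]scale1r -s1 scalerDl -addrA; congr (_ + _).
rewrite scaler_suml -big_split /=; apply: eq_bigr => i _.
by rewrite mxE scalerBr addrC subrK.
Qed.

Lemma ev_chartV z p : ev z (chartV b p) = ev (\row_i ev z (lam (b i))) p.
Proof.
rewrite ev_sub; congr (ev _ _); apply/rowP => i; rewrite !mxE summxE -{2}[z]add0r ev_lamD.
by congr (_ + _); rewrite dotvC dotvE; apply: eq_bigr => j _; rewrite !mxE.
Qed.

Lemma chartVK p : chart o b (chartV b p) = p.
Proof.
apply: mpoly_evP => y; rewrite ev_chart ev_chartV; congr (ev _ _).
by apply/rowP => i; rewrite mxE lam_cpt.
Qed.

Lemma chart_lam i : chart o b (lam (b i)) = 'X_i.
Proof. by apply: mpoly_evP => y; rewrite ev_chart lam_cpt evX. Qed.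

Lemma chart_lam0 : chart o b (lam o) = lam0 R.
Proof.
have -> : lam o = 1 - \sum_i lam (b i) by rewrite -(lam_sum v) chart_sum addrK.
rewrite /chart subB (subC _ _ 1) sub_sum; congr (_ - _).
by apply: eq_bigr => i _; apply: chart_lam.
Qed.

Lemma van_chart A p : van (b @: A) p <-> kill A (chart o b p) = 0.
Proof.
split=> h.
  apply: mpoly_ev0 => y; rewrite ev_kill ev_chart; apply: h => a /imsetP [i iA ->].
  by rewrite lam_cpt mxE iA.
move=> x hx; have := ev_kill A (\row_i ev x (lam (b i))) (chart o b p).
rewrite h ev0 ev_chart => ->; rewrite -{1}(cptK x); congr (ev (cpt _) _).
by apply/rowP => j; rewrite !mxE; case: ifP => // jA; rewrite hx // imset_f.
Qed.

Lemma van_nondeg A (d n a : nat) m g : (d.+1 + #|A| = 3)%N -> vanishing A m -> inPm n g ->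
  (forall q, inPm n q -> simpf A d.+1 (wgt R a m * chart o b (g * q)) = 0) -> van (b @: A) g.
Proof.
move=> dA vm dg hg; apply/van_chart.
apply: (simpf_nondeg (n := n) (a := a) dA vm).
- by apply: inPm_sub; apply: inPm_sub.
- exact: indep_kill.
move=> q dq; have := hg (chartV b q) (inPm_sub _ _ dq).
by rewrite !simpf_kill chartM chartVK !killM kill_idem mulrA.
Qed.

End Chart.
End Charts.

(** * Moments over edges and faces determine the restrictions *)

Section Integrals.
Variables (R : rcfType) (v : 'I_4 -> 'rV[R]_3).
Hypothesis nondeg : tet_nondeg v.
Local Notation P := {mpoly R[3]}.
Local Notation dl := (dl v).
Local Notation lam := (lam v).
Local Notation van := (van v).
Local Notation chart := (chart v).
Implicit Types (p q : P) (x y z : 'rV[R]_3) (a b c d f : 'I_4) (A : {set 'I_3}).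

(** The Binet-Cauchy identity. *)
Lemma cross_dot (s t x y : 'rV[R]_3) :
  dotv (cross s t) (cross x y) = dotv s x * dotv t y - dotv s y * dotv t x.
Proof. by rewrite !dotvE !sum3 !mxE !nxtE; ring. Qed.

Lemma cross_edges_neq0 a b c d : uniq [:: a; b; c; d] -> cross (v b - v a) (v c - v a) != 0.
Proof.
rewrite /= !inE !negb_or => /and4P [/and3P [ab ac ad] /andP [bc bd] cd _].
apply/eqP => e; have := cross_dot (dl b) (dl c) (v b - v a) (v c - v a).
rewrite e dotv0r !dl_v // !eqxx ![b == a]eq_sym ![c == a]eq_sym (negPf ab) (negPf ac).
rewrite (negPf bc) eq_sym (negPf bc) !subr0 mulr1 mulr0 subr0 => /eqP.
by rewrite eq_sym oner_eq0.
Qed.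

Lemma dotv_gt0 x : x != 0 -> 0 < dotv x x.
Proof.
move=> x0; rewrite lt_def; apply/andP; split; first by apply: contraNN x0 => /eqP /dotv_eq0 ->.
by rewrite dotvE; apply: sumr_ge0 => j _; rewrite -expr2 sqr_ge0.
Qed.

Lemma normR_neq0 x : x != 0 -> normR x != 0.
Proof. by move=> x0; rewrite /normR sqrtr_eq0 -ltNge dotv_gt0. Qed.

Lemma vtx_neq a b : a != b -> v b - v a != 0.
Proof.
move=> ab; apply/eqP => e; have := dl_v nondeg a b a.
by rewrite e dotv0r eqxx (negPf ab) sub0r => /eqP; rewrite eq_sym oppr_eq0 oner_eq0.
Qed.

Lemma kill_chart A o (b : 'I_3 -> 'I_4) e p :
  (forall j, e j = if j \in A then 0 else v (b j) - v o) ->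
  kill A (chart o b p) = sub (v o) e p.
Proof.
move=> he; apply: mpoly_evP => y; rewrite ev_kill ev_chart ev_sub; congr (ev _ _).
congr (_ + _); apply: eq_bigr => j _; rewrite mxE he.
by case: ifP; rewrite ?scaler0 ?scale0r.
Qed.

Lemma tri0 b c d : tri b c d 0 = b. Proof. by []. Qed.
Lemma tri1 b c d : tri b c d 1 = c. Proof. by []. Qed.
Lemma intEE a b c d p : intE v a b p =
  normR (v b - v a) * simpf [set 1; 2%:R] 1 (chart a (tri b c d) p).
Proof.
rewrite /intE simpf_kill (kill_chart (e := fun j => if j == 0 then v b - v a else 0)) //.
by apply: ord3P; rewrite !inE /=.
Qed.

Lemma intFE f p : intF v f p =
  normR (cross (v (fv f 1) - v (fv f 0)) (v (fv f 2%:R) - v (fv f 0))) *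
  simpf [set 2%:R] 2 (chart (fv f 0) (tri (fv f 1) (fv f 2%:R) f) p).
Proof.
rewrite /intF simpf_kill (kill_chart (e := fun j => if j == 0 then v (fv f 1) - v (fv f 0) else
  if j == 1 then v (fv f 2%:R) - v (fv f 0) else 0)) //.
by apply: ord3P; rewrite !inE /=.
Qed.

Lemma intKE p : intK v p =
  `|\det (\matrix_(i < 3, j < 3) (v (lift ord0 i) - v ord0) 0 j)| *
   simpf set0 3 (chart ord0 (fv ord0) p).
Proof. by rewrite -simpintE. Qed.

Lemma image_tri2 b c d : tri b c d @: [set 2%:R] = [set d].
Proof. by rewrite imset_set1. Qed.

Lemma image_tri12 b c d : tri b c d @: [set 1; 2%:R] = [set c; d].
Proof. by rewrite imsetU1 imset_set1. Qed.

Lemma intE_van a b c d p : uniq [:: a; b; c; d] -> van [set c; d] p -> intE v a b p = 0.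
Proof.
move=> u; rewrite (intEE a b c d) -(image_tri12 b) => /(van_chart nondeg (b := tri b c d) u) h.
by rewrite simpf_kill h /simpint msupp0 big_nil mulr0.
Qed.

Lemma intE_congr a b c d p q : uniq [:: a; b; c; d] -> van [set c; d] (p - q) ->
  intE v a b p = intE v a b q.
Proof.
move=> u h; rewrite -[p](subrK q) !(intEE a b c d) chartD /simpf mlinD mulrDr.
by rewrite -(intEE a b c d) (intE_van u h) add0r.
Qed.

Lemma fvo_uniq f : uniq [:: fv f 0; fv f 1; fv f 2%:R; f].
Proof. by have := fv_uniq f; rewrite -(rot_uniq 1). Qed.

Lemma intF_van f p : van [set f] p -> intF v f p = 0.
Proof.
rewrite intFE -(image_tri2 (fv f 1) (fv f 2%:R)) => /(van_chart nondeg (b := tri _ _ _) (fvo_uniq f)) h.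
by rewrite simpf_kill h /simpint msupp0 big_nil mulr0.
Qed.

Lemma intF_congr f p q : van [set f] (p - q) -> intF v f p = intF v f q.
Proof.
move=> h; rewrite -[p](subrK q) !intFE chartD /simpf mlinD mulrDr.
by rewrite -intFE intF_van // add0r.
Qed.

Lemma ev_vertex a b c d x : uniq [:: a; b; c; d] ->
  ev x (lam b) = 0 -> ev x (lam c) = 0 -> ev x (lam d) = 0 -> x = v a.
Proof.
move=> u hb hc hd; have := lam_sum v => /(congr1 (ev x)).
rewrite ev1 ev_sum (sum_uniq4 _ u) hb hc hd !addr0 => ha.
by rewrite (point_expand nondeg x) (sum_uniq4 _ u) hb hc hd ha !scale0r scale1r !addr0.
Qed.

Lemma edge_zero a b c d l p p0 : uniq [:: a; b; c; d] -> inPm l p0 ->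
  van [set c; d] (p - p0) -> ev (v a) p = 0 -> ev (v b) p = 0 ->
  (forall q, inPm (l - 2) q -> intE v a b (p * q) = 0) -> van [set c; d] p.
Proof.
move=> u dp hp pa pb hI.
have := u; rewrite /= !inE !negb_or => /and4P [/and3P [ab ac ad] /andP [bc bd] cd _].
have E q (y : 'I_4) : van [set c; d] (p - q) -> y \notin [set c; d] -> ev (v y) p = ev (v y) q.
  move=> h; rewrite !inE negb_or => /andP [yc yd]; apply/eqP; rewrite -subr_eq0 -evB; apply/eqP.
  by apply: h => z; rewrite !inE => /orP [] /eqP ->; rewrite ev_lam_v // eq_sym ?(negPf yc) ?(negPf yd).
have na : a \notin [set c; d] by rewrite !inE negb_or ac ad.
have nb : b \notin [set c; d] by rewrite !inE negb_or bc bd.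
have h1 : van (a |: [set c; d]) p0.
  move=> x hx; rewrite (_ : x = v b) -?(E p0 b) //.
  by apply: (@ev_vertex b a c d); rewrite ?hx ?inE ?eqxx ?orbT //= !inE !negb_or eq_sym ab bc bd ac ad cd.
have ba : b != a by rewrite eq_sym.
have [g1 dg1 hg1] := van_div nondeg ba nb na dp h1.
have {}hg1 : van [set c; d] (p - lam a * g1) by apply: van_trans hg1.
have h2 : van (b |: [set c; d]) g1.
  move=> x hx; rewrite (_ : x = v a).
    by have := E _ a hg1 na; rewrite pa evM ev_lam_v // eqxx mul1r.
  by apply: (@ev_vertex a b c d); rewrite ?hx ?inE ?eqxx ?orbT.
have [g2 dg2 hg2] := van_div nondeg ab na nb dg1 h2.
have {}hg2 : van [set c; d] (p - lam a * lam b * g2).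
  by apply: van_trans hg1 _; rewrite -mulrA -mulrBr; apply: vanMl.
have {}dg2 : inPm (l - 2) g2 by rewrite subn2.
apply: (van_subr hg2 _); apply: vanMl; rewrite -(image_tri12 b).
apply: (@van_nondeg R v nondeg a (tri b c d) u [set 1; 2%:R] 0%N (l - 2) 1%N U_(0%R)%MM g2 _ _ dg2).
- by rewrite cards2.
- by apply/forall_inP => j; rewrite !inE mnm1E => /orP [] /eqP ->.
move=> q dq; have := hI q dq; rewrite (intE_congr (q := lam a * lam b * g2 * q) u); last first.
  by rewrite -mulrBl; apply: vanMr.
have hb : chart a (tri b c d) (lam b) = 'X_0 := chart_lam nondeg u 0.
rewrite (intEE a b c d) -mulrA chartM chartM (chart_lam0 nondeg (b := tri b c d) u) hb /=.
move/eqP; rewrite mulf_eq0 (negPf (normR_neq0 (vtx_neq ab))) => /eqP.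
done.
Qed.

Lemma face_zero_gen f n p (m : 'X_{1..3}) (a : nat) (w : P) g : m 2%:R = 0%N ->
  chart (fv f 0) (tri (fv f 1) (fv f 2%:R) f) w = wgt R a m ->
  inPm n g -> van [set f] (p - w * g) ->
  (forall q, inPm n q -> intF v f (p * q) = 0) -> van [set f] g.
Proof.
move=> m2 hw dg hp hI; have u := fvo_uniq f; rewrite -(image_tri2 (fv f 1) (fv f 2%:R)).
apply: (@van_nondeg R v nondeg (fv f 0) (tri (fv f 1) (fv f 2%:R) f) u [set 2%:R] 1%N n a m g _ _ dg).
- by rewrite cards1.
- by apply/forall_inP => j; rewrite !inE => /eqP ->; rewrite m2.
move=> q dq; have := hI q dq; rewrite (intF_congr (q := w * g * q)); last first.
  by rewrite -mulrBl; apply: vanMr.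
rewrite intFE -mulrA chartM hw => /eqP; rewrite mulf_eq0.
by rewrite (negPf (normR_neq0 (cross_edges_neq0 u))) => /eqP.
Qed.

Lemma face_orth f n p p0 : inPm n p0 -> van [set f] (p - p0) ->
  (forall q, inPm n q -> intF v f (p * q) = 0) -> van [set f] p.
Proof.
move=> dp hp hI; apply: (van_subr hp _).
apply: (@face_zero_gen f n p 0%MM 0%N 1 p0 _ _ dp) => //; last by rewrite mul1r.
  by rewrite mnm0E.
by rewrite /= mpolyX0; apply: (subC _ _ 1).
Qed.

(** As on an edge, with three divisions: vanishing on the three edge lines gives the factor
    [lam o * lam b * lam c], hence a quotient of degree [l - 3]. Each division keeps the remaining
    vanishing conditions by [van_cancel]. *)
Lemma face_zero f l p p0 : inPm l p0 -> van [set f] (p - p0) ->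
  (forall c, c != f -> van [set f; c] p) ->
  (forall q, inPm (l - 3) q -> intF v f (p * q) = 0) -> van [set f] p.
Proof.
move=> dp hp he hI; have u := fvo_uniq f.
set o := fv f 0 in u *; set b := fv f 1 in u *; set c := fv f 2%:R in u *.
have := u; rewrite /= !inE !negb_or => /and4P [/and3P [ob oc of'] /andP [bc bf] cf _].
have sub1 (x : 'I_4) : [set f] \subset [set x; f] by rewrite subsetUr.
have [bo co cb] : [/\ b != o, c != o & c != b] by rewrite ![c == _]eq_sym [b == _]eq_sym.
have N (x y : 'I_4) : x != y -> x != f -> x \notin [set y; f] by rewrite !inE negb_or => -> ->.
have N1 (x : 'I_4) : x != f -> x \notin [set f] by rewrite inE.
have {}he (x : 'I_4) : x != f -> van [set x; f] p by rewrite setUC; apply: he.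
have h0 : van [set o; f] p0 by apply: van_subl (he o of'); apply: vanS (sub1 o) hp.
have [g1 dg1 hg1] := van_div nondeg bo (N1 _ bf) (N1 _ of') dp h0.
have {}hg1 : van [set f] (p - lam o * g1) by apply: van_trans hp hg1.
have h1 : van [set b; f] g1.
  apply: (van_cancel nondeg (a := o) (c := c)) => //; try exact: N.
  by apply: van_subl (he b bf); apply: vanS (sub1 b) hg1.
have [g2 dg2 hg2] := van_div nondeg ob (N1 _ of') (N1 _ bf) dg1 h1.
have {}hg2 : van [set f] (p - lam o * lam b * g2).
  by apply: van_trans hg1 _; rewrite -mulrA -mulrBr; apply: vanMl.
have h2 : van [set c; f] g2.
  apply: (van_cancel nondeg (a := b) (c := o)) => //; try exact: N.
  apply: (van_cancel nondeg (a := o) (c := b)) => //; try exact: N.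
  by apply: van_subl (he c cf); rewrite mulrA; apply: vanS (sub1 c) hg2.
have [g3 dg3 hg3] := van_div nondeg oc (N1 _ of') (N1 _ cf) dg2 h2.
have {}hg3 : van [set f] (p - lam o * lam b * lam c * g3).
  by apply: van_trans hg2 _; rewrite -[_ * lam c * g3]mulrA -mulrBr; apply: vanMl.
have {}dg3 : inPm (l - 3) g3 by move: dg3; rewrite -!subn1 -!subnDA.
apply: (van_subr hg3 _); apply: vanMl.
apply: (@face_zero_gen f (l - 3) p (U_(0%R) + U_(1%R))%MM 1%N _ g3 _ _ dg3 hg3 hI).
  by rewrite mnmDE !mnm1E.
have hb : chart o (tri b c f) (lam b) = 'X_0 := chart_lam nondeg u 0.
have hc : chart o (tri b c f) (lam c) = 'X_1 := chart_lam nondeg u 1.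
by rewrite !chartM (chart_lam0 nondeg (b := tri b c f) u) hb hc /= mpolyXD mulrA.
Qed.

End Integrals.

(** * Tangential calculus on faces *)

Section Traces.
Variables (R : rcfType) (v : 'I_4 -> 'rV[R]_3).
Hypothesis nondeg : tet_nondeg v.
Local Notation P := {mpoly R[3]}.
Local Notation dl := (dl v).
Local Notation van := (van v).
Implicit Types (p : P) (x y z : 'rV[R]_3) (a b c f : 'I_4) (s t : 'M[P]_3)
  (V W : 'I_3 -> P) (A : {set 'I_4}).

Definition mv t x (i : 'I_3) : P := \sum_k t i k * cP (x 0 k).
Definition dotP x V : P := \sum_i cP (x 0 i) * V i.
Definition divv V : P := \sum_i dpar i (V i).

Lemma cPD (k l : R) : cP (k + l) = cP k + cP l. Proof. exact: mpolyCD. Qed.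
Lemma cPM (k l : R) : cP (k * l) = cP k * cP l. Proof. exact: mpolyCM. Qed.
Lemma cP0 : cP 0 = 0 :> P. Proof. exact: mpolyC0. Qed.
Lemma cP1 : cP 1 = 1 :> P. Proof. exact: mpolyC1. Qed.
Lemma cPN (k : R) : cP (- k) = - cP k. Proof. exact: mpolyCN. Qed.

Lemma dotPE x V : dotP x V = cP (x 0 0) * V 0 + cP (x 0 1) * V 1 + cP (x 0 2%:R) * V 2%:R.
Proof. exact: sum3. Qed.
Lemma dotPDr x V W : dotP x (fun i => V i + W i) = dotP x V + dotP x W.
Proof. by rewrite !dotPE; ring. Qed.
Lemma dotPBr x V W : dotP x (fun i => V i - W i) = dotP x V - dotP x W.
Proof. by rewrite !dotPE; ring. Qed.
Lemma dotPMr x V p : dotP x (fun i => p * V i) = p * dotP x V.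
Proof. by rewrite !dotPE; ring. Qed.
Lemma dotPDl x y V : dotP (x + y) V = dotP x V + dotP y V.
Proof. by rewrite !dotPE !mxE !cPD; ring. Qed.
Lemma dotPZl (k : R) x V : dotP (k *: x) V = cP k * dotP x V.
Proof. by rewrite !dotPE !mxE !cPM; ring. Qed.
Lemma dotP0l V : dotP 0 V = 0.
Proof. by rewrite !dotPE !mxE !cP0; ring. Qed.
Lemma dotP_suml (I : Type) (r : seq I) (Q : pred I) (F : I -> 'rV[R]_3) V :
  dotP (\sum_(i <- r | Q i) F i) V = \sum_(i <- r | Q i) dotP (F i) V.
Proof. by apply: (big_morph (fun x => dotP x V)) => [x y|]; rewrite ?dotP0l ?dotPDl. Qed.
Lemma dotPcP x y : dotP x (fun i => cP (y 0 i)) = cP (dotv x y).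
Proof. by rewrite dotPE dotvE sum3 !cPD !cPM. Qed.
Lemma dotP_ext x V W : (forall i, V i = W i) -> dotP x V = dotP x W.
Proof. by move=> h; apply: eq_bigr => i _; rewrite h. Qed.
Lemma dird_dotP x y V : dird x (dotP y V) = dotP y (fun i => dird x (V i)).
Proof. by rewrite dird_sum; apply: eq_bigr => i _; rewrite dirdMC. Qed.
Lemma dirdMr x p (k : R) : dird x (p * cP k) = dird x p * cP k.
Proof. by rewrite mulrC dirdMC mulrC. Qed.

Lemma mvD t x y i : mv t (x + y) i = mv t x i + mv t y i.
Proof. by rewrite /mv !sum3 !mxE !cPD; ring. Qed.
Lemma mvZ t (k : R) x i : mv t (k *: x) i = cP k * mv t x i.
Proof. by rewrite /mv !sum3 !mxE !cPM; ring. Qed.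
Lemma mvDl s t x i : mv (s + t) x i = mv s x i + mv t x i.
Proof. by rewrite /mv !sum3 !mxE; ring. Qed.
Lemma mvNl t x i : mv (- t) x i = - mv t x i.
Proof. by rewrite /mv !sum3 !mxE; ring. Qed.
Lemma mv0r t i : mv t 0 i = 0.
Proof. by rewrite /mv !sum3 !mxE !cP0; ring. Qed.

Lemma vanZ A (k : R) p : k != 0 -> van A (cP k * p) -> van A p.
Proof.
move=> k0 h x hx; have := h x hx; rewrite evM evcP => /eqP.
by rewrite mulf_eq0 (negPf k0) => /eqP.
Qed.

Lemma van_dotP A x V : (forall i, van A (V i)) -> van A (dotP x V).
Proof. by move=> h; apply: van_sum => i _; apply: vanMl. Qed.

Lemma covector_expand x o : x = \sum_a dotv x (v a - v o) *: dl a.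
Proof.
apply/eqP; rewrite -subr_eq0; apply/eqP/dotv_eq0; set w := x - _.
have h z : dotv w z = 0.
  rewrite dotvBl dotv_suml {1}(dl_expand nondeg z) dotv_sumr -sumrB.
  rewrite (eq_bigr (fun a => dotv (dl a) z * dotv x (v o))) => [|a _].
    by rewrite -mulr_suml -dotv_suml dl_sum dotv0l mul0r.
  by rewrite dotvZr dotvZl dotvBr; ring.
exact: h.
Qed.

(** Six times the signed volume of the tetrahedron. *)
Definition edet o b c f : R := dotv (cross (v b - v o) (v c - v o)) (v f - v o).

Lemma cross_dl o b c f : uniq [:: o; b; c; f] ->
  cross (v b - v o) (v c - v o) = edet o b c f *: dl f.
Proof.
move=> u; rewrite [LHS](covector_expand _ o) (sum_uniq4 _ u) subrr dotv0r scale0r add0r.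
have -> : dotv (cross (v b - v o) (v c - v o)) (v b - v o) = 0.
  by rewrite dotvE sum3 !mxE !nxtE; ring.
have -> : dotv (cross (v b - v o) (v c - v o)) (v c - v o) = 0.
  by rewrite dotvE sum3 !mxE !nxtE; ring.
by rewrite !scale0r !add0r.
Qed.

Lemma edet_neq0 o b c f : uniq [:: o; b; c; f] -> edet o b c f != 0.
Proof.
move=> u; apply: contraNneq (cross_edges_neq0 nondeg u) => e.
by rewrite (cross_dl u) e scale0r.
Qed.

Lemma edet_swap o b c f : edet o b f c = - edet o b c f.
Proof. by rewrite /edet !dotvE !sum3 !mxE !nxtE; ring. Qed.

Lemma dl_neq0 f : dl f != 0.
Proof.
have := fv_uniq f; rewrite /= !inE !negb_or => /andP [/and3P [h _ _] _].
apply/eqP => e; have := dl_v nondeg f f (fv f 0).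
by rewrite e dotv0l eqxx (negPf h) subr0 => /eqP; rewrite eq_sym oner_eq0.
Qed.

Definition mf f : 'rV[R]_3 := (dotv (dl f) (dl f))^-1 *: dl f.

Lemma dl_mf f : dotv (dl f) (mf f) = 1.
Proof. by rewrite dotvZr mulVf // gt_eqF // dotv_gt0 // dl_neq0. Qed.

Lemma divv_expand V : divv V = \sum_a dird (v a) (dotP (dl a) V).
Proof.
rewrite (eq_bigr (fun a => \sum_i cP (dl a 0 i) * dird (v a) (V i))) => [|a _].
  rewrite exchange_big; apply: eq_bigr => i _ /=.
  have -> : dpar i (V i) = dird (delta_mx 0 i) (V i).
    rewrite /dird (bigD1 i) //= mxE !eqxx cP1 mul1r big1 ?addr0 // => j /negPf ji.
    by rewrite mxE ji andbF cP0 mul0r.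
  have e : delta_mx 0 i = \sum_a dl a 0 i *: v a :> 'rV[R]_3.
    rewrite [LHS](dl_expand nondeg); apply: eq_bigr => a _; congr (_ *: _).
    rewrite dotvE (bigD1 i) //= mxE !eqxx mulr1 big1 ?addr0 // => j /negPf ji.
    by rewrite mxE ji andbF mulr0.
  rewrite {1}e (big_morph (fun x => dird x (V i)) (fun x y => dird_addl x y (V i)) (dird0l (V i))).
  by apply: eq_bigr => a _; rewrite dird_scalel.
by rewrite dird_dotP.
Qed.

Lemma divv_edges o V : divv V = \sum_a dird (v a - v o) (dotP (dl a) V).
Proof.
rewrite divv_expand [RHS](eq_bigr (fun a => dird (v a) (dotP (dl a) V) -
  dird (v o) (dotP (dl a) V))) => [|a _]; last by rewrite dird_subl.
by rewrite sumrB -dird_sum -dotP_suml dl_sum dotP0l dird0 subr0.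
Qed.

(** The surface divergence on [F_f] of the tangential part of [V], written without a unit normal. *)
Definition Lf f V : P := divv V - dird (mf f) (dotP (dl f) V).

(** Only tangential derivatives occur: [v f - v o - mf f] is tangent because [dl f] takes the value
    1 on both [v f - v o] and [mf f]. *)
Lemma LfE o b c f V : uniq [:: o; b; c; f] -> Lf f V =
  dird (v b - v o) (dotP (dl b) V) + dird (v c - v o) (dotP (dl c) V) +
  dird (v f - v o - mf f) (dotP (dl f) V).
Proof.
move=> u; rewrite /Lf (divv_edges o) (sum_uniq4 _ u) subrr dird0l add0r.
by rewrite (dird_subl (v f - v o)); ring.
Qed.

Lemma dl_edge0 b c f : b != f -> c != f -> dotv (dl f) (v b - v c) = 0.
Proof. by move=> bf cf; rewrite dl_v // ![f == _]eq_sym (negPf bf) (negPf cf) subrr. Qed.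

Lemma Lf_van f V : (forall i, van [set f] (V i)) -> van [set f] (Lf f V).
Proof.
move=> h; have u := fvo_uniq f; rewrite (LfE _ u).
have := u; rewrite /= !inE !negb_or => /and4P [/and3P [ob oc of'] /andP [bc bf] cf _].
have hv y : van [set f] (dotP y V) by apply: van_dotP.
by apply: vanD; [apply: vanD|]; apply: van_dird => // a; rewrite inE => /eqP ->;
   rewrite ?dl_edge0 // dotvBr dl_mf dl_v // eqxx eq_sym (negPf of') subr0 subrr.
Qed.

(* The two face conditions of B(sym curl) together say that t acts on the tangent
   vectors of the face as a scalar k, which is a polynomial on the face (bscP). *)
Definition TrCc f t (k : P) := forall x, dotv (dl f) x = 0 ->
  forall i, van [set f] (mv t x i - k * cP (x 0 i)).
Definition TrC f t := exists k, TrCc f t k.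

(* The pointwise form of the conditions defining Sigma-ring: the values at the vertices
   are determined by the values on the edges, and the conditions on the faces become
   independent of the scaling of the normal. *)
Definition Tr0 s := [/\ forall f, van [set f] (dotP (dl f) (mv s (dl f))),
  forall f, van [set f] (2%:R * divv (mv s (dl f)) - dird (mf f) (dotP (dl f) (mv s (dl f))))
  & forall f j, f != j -> van [set f; j] (dotP (dl f) (mv s (dl j)))].

(** The curl as an exterior derivative, row by row: for tangent [x] and [y] the normal component of
    a row of the curl involves only tangential data of [t]. *)
Lemma mv_curl_cross t x y i :
  mv (curl t) (cross x y) i = dird x (mv t y i) - dird y (mv t x i).
Proof.
rewrite /mv !sum3 !curlE !mxE !nxtE !dirdD !dirdMr /dird !sum3 /cP !mpolyCB !mpolyCM; ring.
Qed.

(* On F_f the field curl t dl_f is, up to a constant, the surface curl of k. *)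
Lemma curl_face f t k o b c y : TrCc f t k -> uniq [:: o; b; c; f] ->
  van [set f] (cP (edet o b c f) * dotP y (mv (curl t) (dl f)) -
    (cP (dotv y (v c - v o)) * dird (v b - v o) k - cP (dotv y (v b - v o)) * dird (v c - v o) k)).
Proof.
move=> h u; have := u; rewrite /= !inE !negb_or => /and4P [/and3P [ob oc of'] /andP [bc bf] cf _].
set x1 := v b - v o; set x2 := v c - v o.
have hx1 : dotv (dl f) x1 = 0 by apply: dl_edge0.
have hx2 : dotv (dl f) x2 = 0 by apply: dl_edge0.
have -> : cP (edet o b c f) * dotP y (mv (curl t) (dl f)) -
    (cP (dotv y x2) * dird x1 k - cP (dotv y x1) * dird x2 k) =
  dird x1 (dotP y (fun i => mv t x2 i - k * cP (x2 0 i))) -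
  dird x2 (dotP y (fun i => mv t x1 i - k * cP (x1 0 i))).
  rewrite -dotPMr (@dotP_ext _ _ (fun i => dird x1 (mv t x2 i) - dird x2 (mv t x1 i))) => [|i].
    rewrite !dotPBr !dotPMr !dotPcP !dirdB ![dird _ (k * _)]dirdMr !dird_dotP; ring.
  by rewrite -mvZ -cross_dl // mv_curl_cross.
by apply: vanB; apply: van_dird => [a|]; rewrite ?inE; first [by move=> /eqP -> | apply: van_dotP; apply: h].
Qed.

End Traces.

(** * Traces of [sym curl t] when [t] is scalar on the tangent vectors of each face *)

Section Bubbles.
Variables (R : rcfType) (v : 'I_4 -> 'rV[R]_3).
Hypothesis nondeg : tet_nondeg v.
Local Notation P := {mpoly R[3]}.
Local Notation dl := (dl v).
Local Notation van := (van v).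
Local Notation TrC := (TrC v).
Local Notation edet := (edet v).
Implicit Types (x y : 'rV[R]_3) (a b c f : 'I_4) (t : 'M[P]_3)
  (V W : 'I_3 -> P).

Lemma mv_symm t x i : mv (symm t) x i = cP (2%:R^-1) * (mv t x i + mv t^T x i).
Proof. by rewrite /mv !sum3 !mxE; ring. Qed.

Lemma dotP_tr t x y : dotP y (mv t^T x) = dotP x (mv t y).
Proof. by rewrite !dotPE /mv !sum3 !mxE; ring. Qed.

Lemma dotP_symcurl t x y : dotP y (mv (symcurl t) x) =
  cP (2%:R^-1) * (dotP y (mv (curl t) x) + dotP x (mv (curl t) y)).
Proof.
rewrite -(dotP_tr (curl t) x y) -dotPDr -[RHS]dotPMr; apply: dotP_ext => i; exact: mv_symm.
Qed.

Lemma divv_mv_curlT t x : divv (mv (curl t)^T x) = 0.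
Proof.
have h k : \sum_i dpar i (curl t k i) = 0 by exact: div_curl.
transitivity (\sum_k cP (x 0 k) * \sum_i dpar i (curl t k i)); last first.
  by rewrite big1 // => k _; rewrite h mulr0.
rewrite /divv; under eq_bigr => i _ do rewrite /mv dpar_sum.
rewrite exchange_big; apply: eq_bigr => k _; rewrite mulr_sumr; apply: eq_bigr => i _.
by rewrite [_^T _ _]mxE mulrC dparMC.
Qed.

(** The transposed half of [sym curl t] has no divergence, so the factor 2 cancels the one half; the
    quadratic form is that of [curl t]. *)
Lemma symcurl_second_trace f t :
  2%:R * divv (mv (symcurl t) (dl f)) - dird (mf v f) (dotP (dl f) (mv (symcurl t) (dl f))) =
  Lf v f (mv (curl t) (dl f)).
Proof.
rewrite dotP_symcurl halfDK /Lf; congr (_ - _).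
have -> : divv (mv (symcurl t) (dl f)) = cP (2%:R^-1) *
    (divv (mv (curl t) (dl f)) + divv (mv (curl t)^T (dl f))).
  rewrite /divv -big_split mulr_sumr; apply: eq_bigr => i _.
  by rewrite mv_symm dparMC dparD.
by rewrite divv_mv_curlT addr0 mulrA [2%:R * _]mulrC cP2 mul1r.
Qed.

Lemma dotP_delta i V : dotP (delta_mx 0 i) V = V i.
Proof.
rewrite /dotP (bigD1 i) //= mxE !eqxx cP1 mul1r big1 ?addr0 // => j /negPf ji.
by rewrite mxE ji andbF cP0 mul0r.
Qed.

Lemma LfB f V W : Lf v f (fun i => V i - W i) = Lf v f V - Lf v f W.
Proof.
rewrite /Lf dotPBr dirdB; have -> : divv (fun i => V i - W i) = divv V - divv W.
  by rewrite /divv -sumrB; apply: eq_bigr => i _; rewrite dparB.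
ring.
Qed.

Lemma LfZ f (k : R) V : Lf v f (fun i => cP k * V i) = cP k * Lf v f V.
Proof.
rewrite /Lf dotPMr dirdMC; have -> : divv (fun i => cP k * V i) = cP k * divv V.
  by rewrite /divv mulr_sumr; apply: eq_bigr => i _; rewrite dparMC.
by rewrite mulrBr.
Qed.

(** A surface curl is tangential and, as derivatives commute, has no surface divergence. On an edge
    the scalars of the two faces coincide, so their derivatives along it do too. *)
Lemma TrC_Tr0 t : (forall f, TrC f t) -> Tr0 v (symcurl t).
Proof.
move=> ht; split=> [f|f|f c fc].
- rewrite dotP_symcurl halfDK; have [k hk] := ht f; have u := fvo_uniq f.
  apply: (vanZ (edet_neq0 nondeg u)).
  have := curl_face nondeg (dl f) hk u; have := u; rewrite /= !inE !negb_or.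
  move=> /and4P [/and3P [ob oc of'] /andP [bc bf] cf _].
  by rewrite !(dl_edge0 nondeg) // !cP0 !mul0r subrr subr0.
- rewrite symcurl_second_trace; have [k hk] := ht f; have u := fvo_uniq f.
  have := u; rewrite /= !inE !negb_or => /and4P [/and3P [ob oc of'] /andP [bc bf] cf _].
  set o := fv f 0 in u ob oc of' *; set b := fv f 1 in u ob bc bf *.
  set c := fv f 2%:R in u oc bc cf *.
  apply: (vanZ (edet_neq0 nondeg u)); rewrite -LfZ.
  (* [W] is the surface curl of [k], to which [curl_face] compares [(curl t) (dl f)]. *)
  pose W i := cP ((v c - v o) 0 i) * dird (v b - v o) k - cP ((v b - v o) 0 i) * dird (v c - v o) k.
  have dW y : dotP y W = cP (dotv y (v c - v o)) * dird (v b - v o) k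
      - cP (dotv y (v b - v o)) * dird (v c - v o) k.
    by rewrite -!dotPcP /W !dotPE; ring.
  have LW : Lf v f W = 0.
    rewrite (LfE nondeg _ u) !dW !dl_v // !eqxx ![b == o]eq_sym ![c == o]eq_sym (negPf ob) (negPf oc).
    rewrite (negPf bc) [c == b]eq_sym (negPf bc) ![f == _]eq_sym (negPf cf) (negPf bf) (negPf of').
    rewrite !subr0 cP0 cP1 !mul0r !mul1r !(subr0, sub0r, oppr0) dird0 dirdN addr0 dirdCA addNr //.
  have : van [set f] (Lf v f (fun i => cP (edet o b c f) * mv (curl t) (dl f) i - W i)).
    apply: (Lf_van nondeg) => i; have := curl_face nondeg (delta_mx 0 i) hk u.
    rewrite dotP_delta (_ : dotv (delta_mx 0 i) (v c - v o) = (v c - v o) 0 i); last first.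
      rewrite dotvE (bigD1 i) //= mxE !eqxx mul1r big1 ?addr0 // => j /negPf ji.
      by rewrite mxE ji andbF mul0r.
    rewrite (_ : dotv (delta_mx 0 i) (v b - v o) = (v b - v o) 0 i) //.
    rewrite dotvE (bigD1 i) //= mxE !eqxx mul1r big1 ?addr0 // => j /negPf ji.
    by rewrite mxE ji andbF mul0r.
  by rewrite LfB LW subr0.
have [a [b [_ u]]] := other_pair fc.
have [kf hf] := ht f; have [kc hc] := ht c.
have := u; rewrite /= !inE !negb_or => /and4P [/and3P [ab af ac] /andP [bf bc] _ _].
have u1 : uniq [:: a; b; c; f] by rewrite /= !inE !negb_or ab af ac bf bc eq_sym fc.
have sf : [set f] \subset [set f; c] by rewrite subsetUl.
have sc : [set c] \subset [set f; c] by rewrite subsetUr.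
set x := v b - v a.
have xf : dotv (dl f) x = 0 by apply: dl_edge0 => //.
have xc : dotv (dl c) x = 0 by apply: dl_edge0 => //.
have h1 := curl_face nondeg (dl c) hf u1.
have h2 := curl_face nondeg (dl f) hc u.
(* Since [dl b] takes the value 1 on [x], both scalars equal [dl b . t x] on the edge line. *)
have kk : van [set f; c] (kf - kc).
  have e1 := van_dotP (dl b) (fun i => vanS sf (hf x xf i)).
  have e2 := van_dotP (dl b) (fun i => vanS sc (hc x xc i)).
  rewrite !dotPBr !dotPMr !dotPcP in e1 e2.
  have xb : dotv (dl b) x = 1 by rewrite dl_v // eqxx eq_sym (negPf ab) subr0.
  move: e1 e2; rewrite xb !cP1 !mulr1 => e1 e2.
  have := vanB e2 e1; congr (van _ _); ring.
have Dk : van [set f; c] (dird x (kf - kc)).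
  by apply: van_dird => // e; rewrite !inE => /orP [] /eqP ->.
rewrite dotP_symcurl; apply: vanMl.
apply: (vanZ (edet_neq0 nondeg u1)).
(* [u] and [u1] exchange the last two vertices, so [edet] changes sign and the sum in the
   symmetrised curl becomes the derivative of [kf - kc] along the edge. *)
move: h1 h2; rewrite edet_swap !dl_v // !eqxx ![_ == a]eq_sym ![_ == b]eq_sym (negPf af) (negPf ac) (negPf bf) (negPf bc) -/x.
rewrite !subr0 cP0 cP1 !mul1r !mul0r !subr0 cPN mulNr => /(vanS sf) h1 /(vanS sc) h2.
have := vanD (vanB h1 h2) Dk; rewrite dirdB; congr (van _ _); ring.
Qed.

End Bubbles.

(** * Pointwise meaning of the face conditions of B(sym curl) *)

Section BubbleTraces.
Variables (R : rcfType) (v : 'I_4 -> 'rV[R]_3).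
Hypothesis nondeg : tet_nondeg v.
Local Notation P := {mpoly R[3]}.
Local Notation dl := (dl v).
Local Notation lam := (lam v).
Local Notation van := (van v).
Local Notation TrC := (TrC v).
Implicit Types (p q : P) (x y z n w : 'rV[R]_3) (a b c f : 'I_4) (s t : 'M[P]_3).

Lemma onormalP f : exists k, [/\ k != 0, onormal v f = k *: dl f &
  dotv (onormal v f) (onormal v f) = 1].
Proof.
rewrite /onormal; have u := fvo_uniq f; have D0 := edet_neq0 nondeg u.
rewrite (cross_dl nondeg u); set D := edet _ _ _ _ _ in D0 *.
pose k := if dotv (D *: dl f) (v f - v (fv f 0)) < 0 then D else - D.
have k0 : k != 0 by rewrite /k; case: ifP => _; rewrite ?oppr_eq0.
have -> : (if dotv (D *: dl f) (v f - v (fv f 0)) < 0 then D *: dl f else - (D *: dl f)) = k *: dl f.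
  by rewrite /k; case: ifP => _; rewrite ?scaleNr.
have w0 : k *: dl f != 0 by rewrite scaler_eq0 negb_or k0 dl_neq0.
have pos := dotv_gt0 w0.
have s0 : Num.sqrt (dotv (k *: dl f) (k *: dl f)) != 0 by rewrite gt_eqF // sqrtr_gt0.
exists ((Num.sqrt (dotv (k *: dl f) (k *: dl f)))^-1 * k); split.
- by rewrite mulf_neq0 // invr_eq0.
- by rewrite scalerA.
move: pos s0; set w := k *: dl f; set D' := dotv w w => pos s0.
rewrite dotvZl dotvZr -/D' mulrA -expr2 -{2}(sqr_sqrtr (ltW pos)) -exprMn mulVf // expr1n //.
Qed.

Lemma vec_expand o x : x = \sum_a dotv (dl a) x *: (v a - v o).
Proof.
rewrite [RHS](eq_bigr (fun a => dotv (dl a) x *: v a - dotv (dl a) x *: v o)) => [|a _].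
  by rewrite sumrB -dl_expand // -scaler_suml -dotv_suml dl_sum dotv0l scale0r subr0.
by rewrite scalerBr.
Qed.

Lemma tangent_expand o b c f x : uniq [:: o; b; c; f] -> dotv (dl f) x = 0 ->
  x = dotv (dl b) x *: (v b - v o) + dotv (dl c) x *: (v c - v o).
Proof.
by move=> u h; rewrite {1}(vec_expand o x) (sum_uniq4 _ u) h subrr scaler0 scale0r add0r addr0.
Qed.

Definition symR (B : 'M[R]_3) : 'M[R]_3 := 2%:R^-1 *: (B + B^T).

(** Tested against vectors, the products with [n] become bilinear forms [x . A y] whose arguments
    are turned by [cross n]. *)
Lemma trace1_id (A : 'M[R]_3) n z :
  dotv (n *m mxcr A n) z = dotv n (cross n z *m A^T).
Proof. by rewrite !dotvE !sum3 !mxE !sum3 !mxE !nxtE; ring. Qed.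

Lemma trace2_id (S : 'M[R]_3) n x y :
  dotv (x *m mxcr (crmx n S) n) y = dotv (cross x n) (cross n y *m S^T).
Proof. by rewrite !dotvE !sum3 !mxE !sum3 !mxE !nxtE; ring. Qed.

Lemma trace3_id (A : 'M[R]_3) n x y :
  dotv x (y *m (mxcr A n)^T) = dotv x (cross n y *m A^T).
Proof. by rewrite !dotvE !sum3 !mxE !sum3 !mxE !nxtE; ring. Qed.

Lemma dotv_symR (B : 'M[R]_3) x y :
  dotv x (y *m (symR B)^T) = 2%:R^-1 * (dotv x (y *m B^T) + dotv y (x *m B^T)).
Proof. by rewrite !dotvE !sum3 !mxE !sum3 !mxE; ring. Qed.

Lemma cross_tangent n z : dotv n n = 1 -> dotv n z = 0 -> cross n (cross z n) = z.
Proof.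
move=> n1 nz; have : cross n (cross z n) = dotv n n *: z - dotv n z *: n.
  by apply/rowP; apply: ord3P; rewrite !dotvE !sum3 !mxE !nxtE; ring.
by rewrite n1 nz scale1r scale0r subr0.
Qed.

Lemma crossC x y : cross x y = - cross y x.
Proof. by apply/rowP => i; rewrite !mxE; ring. Qed.

(** The first condition says that [A] preserves the tangent plane, the second that the form
    [(z x n) . A w] is skew on it, since [z |-> z x n] is a quarter turn there. *)
Lemma bubble_point_fwd (A : 'M[R]_3) n z w : dotv n n = 1 ->
  n *m mxcr A n = 0 -> mxcr (crmx n (symR (mxcr A n))) n = 0 ->
  dotv n z = 0 -> dotv n w = 0 ->
  dotv n (z *m A^T) = 0 /\ dotv (cross z n) (w *m A^T) + dotv (cross w n) (z *m A^T) = 0.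
Proof.
move=> n1 h1 h2 nz nw; split.
  by rewrite -{1}(cross_tangent n1 nz) -trace1_id h1 dotv0l.
have := trace2_id (symR (mxcr A n)) n z w; rewrite h2 mulmx0 dotv0l dotv_symR !trace3_id.
rewrite (cross_tangent n1 nz) (crossC n w).
have -> : cross n (- cross w n) = - w.
  by rewrite -[in RHS](cross_tangent n1 nw); apply/rowP => i; rewrite !mxE; ring.
move/esym/eqP; rewrite mulf_eq0 invr_eq0 pnatr_eq0 /= mulNmx dotvNr dotvNl -opprD oppr_eq0.
by move/eqP.
Qed.

Lemma bubble_point_bwd (A : 'M[R]_3) n k :
  (forall z, dotv n z = 0 -> z *m A^T = k *: z) ->
  n *m mxcr A n = 0 /\ mxcr (crmx n (symR (mxcr A n))) n = 0.
Proof.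
move=> h; have nc z : dotv n (cross n z) = 0 by rewrite dotvE sum3 !mxE !nxtE; ring.
split.
  apply: dotv_eq0; rewrite trace1_id h // dotvZr nc mulr0 //.
have key x y : dotv (x *m mxcr (crmx n (symR (mxcr A n))) n) y = 0.
  rewrite trace2_id dotv_symR !trace3_id !h // !dotvZr -mulrDr.
  have -> : dotv (cross x n) (cross n (cross n y)) + dotv (cross n y) (cross n (cross x n)) = 0.
    by rewrite !dotvE !sum3 !mxE !nxtE; ring.
  by rewrite !mulr0.
by apply/row_matrixP => i; rewrite row0 rowE; apply: dotv_eq0.
Qed.

Lemma evm_mxcr z t n : evm z (mxcr t (cvec n)) = mxcr (evm z t) n.
Proof.
by apply/matrixP => i j; rewrite !mxE -/(ev z _) evB !evM !evcP.
Qed.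

Lemma evm_crmx z t n : evm z (crmx (cvec n) t) = crmx n (evm z t).
Proof. by apply/matrixP => i j; rewrite !mxE -/(ev z _) evB !evM !evcP. Qed.

Lemma evm_symm z t : evm z (symm t) = symR (evm z t).
Proof. by apply/matrixP => i j; rewrite !mxE -/(ev z _) evM evD evcP. Qed.

Lemma evm_mulrow z t n : evm z (cvec n *m t) = n *m evm z t.
Proof.
apply/matrixP => i j; rewrite !mxE -/(ev z _) ev_sum; apply: eq_bigr => k _.
by rewrite evM !mxE ord1 evcP.
Qed.

Lemma ev_mv z t x i : ev z (mv t x i) = (x *m (evm z t)^T) 0 i.
Proof.
by rewrite ev_sum mxE; apply: eq_bigr => k _; rewrite evM evcP !mxE mulrC.
Qed.

Lemma ev_dotP z x (V : 'I_3 -> P) : ev z (dotP x V) = dotv x (\row_i ev z (V i)).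
Proof. by rewrite ev_sum dotvE; apply: eq_bigr => i _; rewrite evM evcP mxE. Qed.

Lemma ev_mv_row z t x : \row_i ev z (mv t x i) = x *m (evm z t)^T.
Proof. by apply/rowP => i; rewrite mxE ev_mv. Qed.

(** A skew form on a plane is a multiple of the area form, so [A] is scalar on tangent vectors. The
    scalar is the [dl b] coordinate of [t (v b - v o)], which is a polynomial. *)
Lemma bubble_trace f t :
  (forall x, in_face v f x -> let n := cvec (onormal v f) in
    evm x (n *m mxcr t n) = 0 /\ evm x (mxcr (crmx n (symm (mxcr t n))) n) = 0) <->
  TrC f t.
Proof.
have [k [k0 nE n1]] := onormalP f; set n := onormal v f in nE n1 *.
have tan z : (dotv n z == 0) = (dotv (dl f) z == 0).
  by rewrite nE dotvZl mulf_eq0 (negPf k0).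
split=> [h|[p hp] x hx]; last first.
  lazy zeta; rewrite evm_mulrow evm_mxcr evm_mxcr evm_crmx evm_symm evm_mxcr.
  apply: (@bubble_point_bwd _ _ (ev x p)) => z /eqP; rewrite tan => /eqP hz.
  have hx' : forall a, a \in [set f] -> ev x (lam a) = 0.
    move=> a; rewrite inE => /eqP ->; have /(in_face_van nondeg) := @van_lam R v [set f] f (set11 f).
    by apply.
  apply/rowP => i; rewrite -ev_mv mxE; have := hp z hz i x hx'.
  by rewrite evB evM evcP => /eqP; rewrite subr_eq0 => /eqP.
have u := fvo_uniq f; set o := fv f 0 in u; set b := fv f 1 in u; set c := fv f 2%:R in u.
have := u; rewrite /= !inE !negb_or => /and4P [/and3P [ob oc of'] /andP [bc bf] cf _].
exists (dotP (dl b) (mv t (v b - v o))) => x hx i z hz.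
have [h1 h2] : n *m mxcr (evm z t) n = 0 /\ mxcr (crmx n (symR (mxcr (evm z t) n))) n = 0.
  split; apply/matrixP => a' b'; rewrite [RHS]mxE.
    rewrite -evm_mxcr -evm_mulrow mxE -/(ev _ _).
    suff : van [set f] ((cvec n *m mxcr t (cvec n)) a' b') by apply.
    apply/(in_face_van nondeg) => y /h [/matrixP /(_ a' b') + _].
    by rewrite [X in X = _ -> _]mxE [X in _ = X -> _]mxE.
  rewrite -evm_mxcr -evm_symm -evm_crmx -evm_mxcr mxE -/(ev _ _).
  set M := mxcr _ _; suff : van [set f] (M a' b') by apply.
  apply/(in_face_van nondeg) => y /h [_ /matrixP /(_ a' b')].
  by rewrite [X in X = _ -> _]mxE [X in _ = X -> _]mxE.
set A := evm z t in h1 h2.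
rewrite evB evM evcP ev_dotP ev_mv_row ev_mv -/A.
set x1 := v b - v o; set x2 := v c - v o.
have t1 : dotv n x1 = 0 by apply/eqP; rewrite tan dl_edge0.
have t2 : dotv n x2 = 0 by apply/eqP; rewrite tan dl_edge0.
have [a1 e11] := bubble_point_fwd n1 h1 h2 t1 t1.
have [a2 e22] := bubble_point_fwd n1 h1 h2 t2 t2.
have [_ e12] := bubble_point_fwd n1 h1 h2 t1 t2.
move: a1 a2 => /eqP; rewrite tan => /eqP a1 /eqP; rewrite tan => /eqP a2.
have E1 := tangent_expand u a1; have E2 := tangent_expand u a2; rewrite -/x1 -/x2 in E1 E2.
set om := dotv (cross x1 n) x2.
have om0 : om != 0.
  have : om = - (k * (edet v o b c f * dotv (dl f) (dl f))).
    rewrite -(dotvZl (edet v o b c f)) -cross_dl // -/x1 -/x2 dotvC -dotvZl -nE /om.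
    by rewrite !dotvE !sum3 !mxE !nxtE; ring.
  by move->; rewrite oppr_eq0 !mulf_neq0 ?edet_neq0 // gt_eqF // dotv_gt0 // dl_neq0.
have o11 : dotv (cross x1 n) x1 = 0 by rewrite dotvE sum3 !mxE !nxtE; ring.
have o22 : dotv (cross x2 n) x2 = 0 by rewrite dotvE sum3 !mxE !nxtE; ring.
have o21 : dotv (cross x2 n) x1 = - om by rewrite /om !dotvE !sum3 !mxE !nxtE; ring.
have two (e : R) : e * om + e * om = 0 -> e = 0.
  rewrite -mulr2n => /eqP; rewrite -mulr_natl mulf_eq0 pnatr_eq0 /= mulf_eq0 (negPf om0) orbF.
  by move/eqP.
set p := dotv (dl b) (x1 *m A^T) in E1 *; set q := dotv (dl c) (x1 *m A^T) in E1.
set r := dotv (dl b) (x2 *m A^T) in E2; set s := dotv (dl c) (x2 *m A^T) in E2.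
have q0 : q = 0 by apply: two; move: e11; rewrite E1 !dotvDr !dotvZr o11; rewrite mulr0 add0r.
have r0 : r = 0.
  apply: two; move: e22; rewrite E2 !dotvDr !dotvZr o22 o21 mulr0 addr0 => e.
  by apply/eqP; rewrite -oppr_eq0 opprD -!mulrN e.
have sp : s = p.
  move: e12; rewrite E1 E2 q0 r0 !scale0r add0r addr0 !dotvZr o21 -/om mulrN -mulrBl => /eqP.
  by rewrite mulf_eq0 (negPf om0) orbF subr_eq0 => /eqP.
have := tangent_expand u hx; rewrite -/x1 -/x2 => ->.
rewrite mulmxDl -!scalemxAl E1 E2 q0 r0 sp !mxE; ring.
Qed.

End BubbleTraces.

(** * Exactness at B(sym curl) and injectivity of dev grad *)

Section Potentials.
Variables (R : rcfType) (v : 'I_4 -> 'rV[R]_3).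
Hypothesis nondeg : tet_nondeg v.
Local Notation P := {mpoly R[3]}.
Local Notation dl := (dl v).
Local Notation lam := (lam v).
Local Notation van := (van v).
Local Notation TrC := (TrC v).
Local Notation TrCc := (TrCc v).
Implicit Types (p : P) (x y z : 'rV[R]_3) (a b c d f : 'I_4) (t : 'M[P]_3)
  (u : 'rV[P]_3) (A : {set 'I_4}).

Lemma bvecP l u : Bvec v l u <-> inPmx (l + 2) u /\ forall f i, van [set f] (u 0 i).
Proof.
split=> -[du h]; split=> // f.
  move=> i; apply/(in_face_van nondeg) => x /h /matrixP /(_ 0 i).
  by rewrite mxE [in X in _ = X -> _]mxE.
move=> x hx; apply/matrixP => i j; rewrite ord1 mxE [RHS]mxE.
by have /(in_face_van nondeg) := h f j; apply.
Qed.

Lemma bscP l t : Bsc v l t <-> inPT (l + 1) t /\ forall f, TrC f t.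
Proof.
by split=> -[dt h]; split=> // f; apply/(bubble_trace nondeg) => //; exact: h.
Qed.

Lemma mv_grad u x i : mv (grad u) x i = dird x (u 0 i).
Proof. by apply: eq_bigr => j _; rewrite mxE mulrC. Qed.

Lemma mv_devgrad u x i : mv (devgrad u) x i =
  dird x (u 0 i) - cP (3%:R^-1) * \tr (grad u) * cP (x 0 i).
Proof.
rewrite -mv_grad /mv (eq_bigr (fun k => grad u i k * cP (x 0 k) -
   ((cP (3%:R^-1) * \tr (grad u)) *+ (i == k)) * cP (x 0 k))) => [|k _].
  rewrite sumrB; congr (_ - _); rewrite (bigD1 i) //= eqxx mulr1n big1 ?addr0 // => j ji.
  by rewrite eq_sym (negPf ji) mulr0n mul0r.
by rewrite devE mulrBl.
Qed.

Lemma bvec_devgrad l u : Bvec v l u -> Bsc v l (devgrad u).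
Proof.
move=> /bvecP [du hu]; apply/bscP; split; first by apply: inPT_devgrad; rewrite addn1 -addn2.
move=> f; exists (- (cP (3%:R^-1) * \tr (grad u))) => x hx i.
rewrite mv_devgrad mulNr opprK subrK; apply: van_dird => // a; rewrite inE => /eqP ->.
exact: hx.
Qed.

Lemma van_vertex A a p : (forall f, f \in A -> f != a) -> van A p -> ev (v a) p = 0.
Proof. by move=> h; apply=> f /h fa; rewrite ev_lam_v // (negPf fa). Qed.

Lemma van_const A o p : (forall a, a \in A -> a != o) ->
  (forall x, (forall a, a \in A -> dotv (dl a) x = 0) -> van A (dird x p)) ->
  van A (p - cP (ev (v o) p)).
Proof.
move=> Ao h z hz; rewrite evB evcP; apply/eqP; rewrite subr_eq0; apply/eqP.
set x := z - v o.
have ho a : a \in A -> ev (v o) (lam a) = 0 by move=> /Ao ao; rewrite ev_lam_v // (negPf ao).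
have hx a : a \in A -> dotv (dl a) x = 0.
  by move=> aA; have := ev_lamD v (v o) x a; rewrite addrC subrK hz // ho // add0r.
have /deriv0_const e i : dpar i (line (v o) x p) = 0.
  rewrite /line deriv_sub -/(line _ _ _); case: (i == 0); last by rewrite dird0l /line /sub raddf0.
  by apply: (@van_line _ v A) => //; apply: h.
have e0 := ev_line (v o) x 0 p; have e1 := ev_line (v o) x (const_mx 1) p.
move: e0 e1; rewrite e !evC !mxE scale0r scale1r addr0 => ->.
by rewrite /x addrC subrK.
Qed.

Lemma van_const_face f o p : f != o -> (forall x, dotv (dl f) x = 0 -> van [set f] (dird x p)) ->
  van [set f] (p - cP (ev (v o) p)).
Proof.
move=> fo h; apply: van_const => [a|x hx]; first by rewrite inE => /eqP ->.
by apply: h; apply: hx; rewrite inE.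
Qed.

Lemma devgrad_trace f u t : t = devgrad u -> TrC f t -> TrC f (grad u).
Proof.
move=> -> [k hk]; exists (k + cP (3%:R^-1) * \tr (grad u)) => x hx i.
have := hk x hx i; rewrite mv_devgrad mv_grad; congr (van _ _); ring.
Qed.

Lemma curl_grad u : curl (grad u) = 0.
Proof.
by apply/matrixP => i j; rewrite curlE !mxE (dparCA (nxt j)) subrr.
Qed.

(** As [curl (grad u) = 0], [curl_face] makes both tangential derivatives of the scalar vanish. *)
Lemma grad_face_const f u o : f != o -> TrC f (grad u) ->
  exists k : R, TrCc f (grad u) (cP k).
Proof.
move=> fo [k hk]; exists (ev (v o) k) => x hx i.
have := hk x hx i => h1.
have : van [set f] (k - cP (ev (v o) k)).
  apply: van_const_face => // y hy; have un := fvo_uniq f.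
  have hC z : dotP z (mv (curl (grad u)) (dl f)) = 0.
    by rewrite curl_grad dotPE /mv !big1 ?mulr0 ?addr0 // => j _; rewrite mxE mul0r.
  have hb := curl_face nondeg (dl (fv f 1)) hk un.
  have hc := curl_face nondeg (dl (fv f 2%:R)) hk un.
  move: un hb hc; set o' := fv f 0; set b := fv f 1; set c := fv f 2%:R => un.
  have := un; rewrite /= !inE !negb_or => /and4P [/and3P [ob oc of'] /andP [bc bf] cf _].
  rewrite !hC mulr0 !sub0r !dl_v // !eqxx ![b == o']eq_sym ![c == o']eq_sym ![c == b]eq_sym.
  rewrite (negPf ob) (negPf oc) (negPf bc) !subr0 !cP0 !cP1 !mul1r !mul0r sub0r opprK subr0.
  move=> hb /vanN; rewrite opprK => hc.
  rewrite (tangent_expand nondeg un hy) dird_addl !dird_scalel.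
  by apply: vanD; apply: vanMl.
move/(@vanMl _ _ _ _ (cP (x 0 i))) => h2; have := vanD h1 h2; congr (van _ _); ring.
Qed.

Lemma bsc_potential l t : Bsc v l t -> symcurl t = 0 -> exists2 u, Bvec v l u & t = devgrad u.
Proof.
move=> /bscP [dt ht] st.
have [u du tu] : exists2 u, inPmx l.+2 u & t = devgrad u.
  by apply: symcurl0_devgrad => //; rewrite -addn1.
have hg f : exists k : R, TrCc f (grad u) (cP k).
  have := fv_uniq f; rewrite /= !inE !negb_or => /andP [/and3P [h _ _] _].
  exact: grad_face_const h (devgrad_trace tu (ht f)).
have [k0 hk0] := hg 0.
have hk f : TrCc f (grad u) (cP k0).
  have [->//|f0] := eqVneq f 0; have [k hk] := hg f.
  suff -> : k0 = k by [].
  have [a [b [_ un]]] := other_pair f0.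
  have := un; rewrite /= !inE !negb_or => /and4P [/and3P [ab af ac] /andP [bf bc] _ _].
  pose x := v b - v a.
  have h1 := van_dotP (dl b) (hk x (dl_edge0 nondeg bf af)).
  have h2 := van_dotP (dl b) (hk0 x (dl_edge0 nondeg bc ac)).
  have ha g : g \in [set f] -> g != a by rewrite inE => /eqP ->; rewrite eq_sym.
  have ha0 g : g \in [set (0 : 'I_4)] -> g != a by rewrite inE => /eqP ->; rewrite eq_sym.
  have := van_vertex ha h1; have := van_vertex ha0 h2.
  rewrite !dotPBr !dotPMr !dotPcP dl_v // eqxx eq_sym (negPf ab) subr0 !evB !evM !evcP !mulr1.
  by move=> /eqP; rewrite subr_eq0 => /eqP <- /eqP; rewrite subr_eq0 => /eqP.
(* On every face the tangential derivative of [u] along [x] is [k0 x], so [u - k0 x] is constant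
   there; common vertices make the four constants equal. *)
pose w i : P := u 0 i - cP k0 * 'X_i.
have hw f o i : f != o -> van [set f] (w i - cP (ev (v o) (w i))).
  move=> fo; apply: van_const_face => // x hx; have := hk f x hx i.
  by rewrite mv_grad /w dirdB dirdMC dirdX.
have w0 i a b : ev (v a) (w i) = ev (v b) (w i).
  have [->//|ab] := eqVneq a b; have [c [d [_ un]]] := other_pair ab.
  have := un; rewrite /= !inE !negb_or => /and4P [/and3P [cd ca cb] /andP [da db] _ _].
  have hb g : g \in [set c] -> g != b by rewrite inE => /eqP ->.
  by have := van_vertex hb (hw c a i ca); rewrite evB evcP => /eqP; rewrite subr_eq0 => /eqP.
pose u' : 'rV[P]_3 := \row_i (w i - cP (ev (v 0) (w i))).
exists u'.
  apply/bvecP; split.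
    move=> j i; rewrite mxE; apply: inPmB; last exact: inPmC.
    apply: inPmB; first by rewrite addn2; have := du 0 i.
    by apply: inPmMC; apply: inPmW (inPmX _ i); rewrite addn2.
  move=> f i; rewrite mxE; have := fv_uniq f; rewrite /= !inE !negb_or => /andP [/and3P [h _ _] _].
  by rewrite (w0 i 0 (fv f 0)); apply: hw.
rewrite tu; have gE : grad u' = grad u - (cP k0)%:M.
  apply/matrixP => i j; rewrite mxBE !mxE /w !dparB dparcP dparMC dparX subr0; congr (_ - _).
  by rewrite mulr_natr.
rewrite /devgrad gE; apply/matrixP => i j; rewrite !devE !trE !mxBE ![_%:M _ _]mxE /= !mulr1n.
set g := grad u.
have -> : cP (3%:R^-1) * (g 0 0 - cP k0 + (g 1 1 - cP k0) + (g 2%:R 2%:R - cP k0)) =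
   cP (3%:R^-1) * (g 0 0 + g 1 1 + g 2%:R 2%:R) - cP (3%:R^-1) * 3%:R * cP k0 by ring.
rewrite cP3 mul1r mulrnBl; ring.
Qed.

(** The kernel of dev grad consists of the fields [alpha + beta x]; such a field is zero if it
    vanishes at two vertices. *)
Lemma bvec_inj l u : Bvec v l u -> devgrad u = 0 -> u = 0.
Proof.
move=> /bvecP [_ hu] h; pose k := cP (3%:R^-1) * \tr (grad u).
have hd i j : dpar j (u 0 i) = k *+ (i == j).
  have := congr1 (fun M : 'M[P]_3 => M i j) h; rewrite devE !mxE => /eqP.
  by rewrite subr_eq0 => /eqP.
have /deriv0_const kc j : dpar j k = 0.
  have e i : i != j -> dpar j k = 0.
    move=> ij; have -> : k = dpar i (u 0 i) by rewrite hd eqxx.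
    by rewrite dparCA hd (negPf ij) mulr0n dpar0.
  by move: j e; apply: ord3P => e; [apply: (e 1) | apply: (e 0) | apply: (e 0)].
set k0 := k@_0%MM in kc.
have wc i : (u 0 i - cP k0 * 'X_i) = ((u 0 i - cP k0 * 'X_i)@_0%MM)%:MP.
  apply: deriv0_const => j; have := dparB j (u 0 i) (cP k0 * 'X_i).
  by rewrite hd dparMC dparX kc mulr_natr subrr.
have hv a i : ev (v a) (u 0 i) = 0.
  have := fv_uniq a; rewrite /= !inE !negb_or => /andP [/and3P [h' _ _] _].
  by apply: (van_vertex (A := [set fv a 0]) _ (hu _ i)) => f; rewrite inE => /eqP ->; rewrite eq_sym.
have ex a i : ev (v a) (u 0 i - cP k0 * 'X_i) = - (k0 * v a 0 i) by rewrite evB hv evM evcP evX sub0r.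
have k00 : k0 = 0.
  have : k0 *: (v 1 - v 0) = 0.
    apply/rowP => i; rewrite mxE [RHS]mxE (_ : (v 1 - v 0) 0 i = v 1 0 i - v 0 0 i); last by rewrite !mxE.
    apply/eqP.
    have := ex 0 i; have := ex 1 i; rewrite wc !evC => -> /eqP.
    by rewrite eqr_opp mulrBr subr_eq0.
  by move/eqP; rewrite scaler_eq0 (negPf (vtx_neq nondeg _)) ?orbF // => /eqP.
apply/rowP => i; rewrite mxE; have := wc i; rewrite k00 cP0 mul0r subr0 => e.
by have := hv 0 i; rewrite e evC => ->; rewrite mpolyC0.
Qed.

End Potentials.

(** * Degrees of the traces of fields in Sigma *)

Section Sigma.
Variables (R : rcfType) (v : 'I_4 -> 'rV[R]_3).
Hypothesis nondeg : tet_nondeg v.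
Local Notation P := {mpoly R[3]}.
Local Notation dl := (dl v).
Local Notation lam := (lam v).
Local Notation van := (van v).
Implicit Types (p q : P) (x y z n : 'rV[R]_3) (a b c d f : 'I_4) (s t : 'M[P]_3)
  (u : 'rV[P]_3) (A : {set 'I_4}).

Lemma quadE s x y : (cvec x *m s *m (cvec y)^T) 0 0 = dotP x (mv s y).
Proof.
rewrite -mulmxA mxE; apply: eq_bigr => i _; rewrite [cvec x _ _]mxE; congr (_ * _).
by rewrite mxE; apply: eq_bigr => k _; rewrite [_^T _ _]mxE [cvec y _ _]mxE.
Qed.

(** The normal derivative removed here turns [2 div_F (s n) + d_n (n . s n)] into the expression
    with a minus sign in [Tr0]. *)
Lemma divFE s n : dotv n n = 1 -> divF (cvec n) (s *m (cvec n)^T)^T =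
  divv (mv s n) - dird n (dotP n (mv s n)).
Proof.
move=> n1; pose V := mv s n.
have VE i : (s *m (cvec n)^T)^T 0 i = V i.
  by rewrite !mxE; apply: eq_bigr => k _; rewrite !mxE.
have n1P : cP (n 0 0) * cP (n 0 0) + cP (n 0 1) * cP (n 0 1) + cP (n 0 2%:R) * cP (n 0 2%:R) = 1 :> P.
  by rewrite -!cPM -!cPD -cP1 -n1 dotvE sum3.
rewrite /divF; set u := (s *m _)^T.
have PE i j : (1%:M - (cvec n)^T *m cvec n) i j = (i == j)%:R - cP (n 0 i) * cP (n 0 j) :> P.
  by rewrite !mxE big_ord1 !mxE.
have wE i : (u *m (1%:M - (cvec n)^T *m cvec n)) 0 i = V i - cP (n 0 i) * dotP n V.
  rewrite mxE (eq_bigr (fun k => V k * (k == i)%:R - cP (n 0 i) * (cP (n 0 k) * V k))) => [|k _].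
    rewrite sumrB -mulr_sumr (bigD1 i) //= eqxx mulr1 big1 ?addr0 // => j /negPf ->.
    by rewrite mulr0.
  by rewrite PE VE; ring.
under eq_bigr => i _ do under eq_bigr => j _ do rewrite PE wE dparB dparMC.
have gE j : dpar j (dotP n V) = cP (n 0 0) * dpar j (V 0) + cP (n 0 1) * dpar j (V 1) +
    cP (n 0 2%:R) * dpar j (V 2%:R) by rewrite dotPE !dparD !dparMC.
rewrite !sum3 /= /divv /dird !sum3 -/V.
have S0 : cP (n 0 0) * dpar 0 (dotP n V) + cP (n 0 1) * dpar 1 (dotP n V) +
    cP (n 0 2%:R) * dpar 2%:R (dotP n V) =
   cP (n 0 0) * (cP (n 0 0) * dpar 0 (V 0) + cP (n 0 1) * dpar 1 (V 0) + cP (n 0 2%:R) * dpar 2%:R (V 0))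
   + cP (n 0 1) * (cP (n 0 0) * dpar 0 (V 1) + cP (n 0 1) * dpar 1 (V 1) + cP (n 0 2%:R) * dpar 2%:R (V 1))
   + cP (n 0 2%:R) * (cP (n 0 0) * dpar 0 (V 2%:R) + cP (n 0 1) * dpar 1 (V 2%:R) + cP (n 0 2%:R) * dpar 2%:R (V 2%:R)).
  rewrite !gE; move: (cP (n 0 0)) (cP (n 0 1)) (cP (n 0 2%:R)) => n0' n1' n2'.
  move: (dpar 0 (V 0)) (dpar 1 (V 0)) (dpar 2%:R (V 0)) (dpar 0 (V 1)) (dpar 1 (V 1)) (dpar 2%:R (V 1)).
  move: (dpar 0 (V 2%:R)) (dpar 1 (V 2%:R)) (dpar 2%:R (V 2%:R)) => *; ring.
move: S0 n1P {gE wE PE VE}; move: (cP (n 0 0)) (cP (n 0 1)) (cP (n 0 2%:R)) => m0 m1 m2.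
move: (dpar 0 (V 0)) (dpar 1 (V 0)) (dpar 2%:R (V 0)) (dpar 0 (V 1)) (dpar 1 (V 1)) (dpar 2%:R (V 1))
  (dpar 0 (V 2%:R)) (dpar 1 (V 2%:R)) (dpar 2%:R (V 2%:R)) => v00 v10 v20 v01 v11 v21 v02 v12 v22.
move: (dpar 0 (dotP n V)) (dpar 1 (dotP n V)) (dpar 2%:R (dotP n V)) => g0 g1 g2 S0 n1P.
(* The two sides differ by a multiple of [1 - |n|^2]. *)
transitivity (v00 + v11 + v22 - (m0 * (m0 * v00 + m1 * v10 + m2 * v20)
   + m1 * (m0 * v01 + m1 * v11 + m2 * v21) + m2 * (m0 * v02 + m1 * v12 + m2 * v22))
  - (1 - (m0 * m0 + m1 * m1 + m2 * m2)) * (m0 * g0 + m1 * g1 + m2 * g2)); first by ring.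
by rewrite n1P -S0 subrr mul0r subr0.
Qed.

Definition lin x : P := dotP x (fun i => 'X_i).

Lemma mv_xx q x i : mv (xx q) x i = 'X_i * (q * lin x).
Proof. by rewrite /mv /lin dotPE sum3 !xxE; ring. Qed.

Lemma dotP_xx q x y : dotP y (mv (xx q) x) = q * lin x * lin y.
Proof. by rewrite !dotPE !mv_xx /lin !dotPE; ring. Qed.

Lemma lin_lam a : lam a = lin (dl a) + cP (ev 0 (lam a)).
Proof.
rewrite [LHS]lamE addrC; congr (_ + cP _).
by rewrite ev_lam sub0r dotvNr.
Qed.

Lemma dird_lin x y : dird x (lin y) = cP (dotv y x).
Proof. by rewrite /lin dird_dotP -dotPcP; apply: dotP_ext => i; rewrite dirdX. Qed.

Lemma divv_X p : divv (fun i => 'X_i * p) = euler p + 3%:R * p.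
Proof. by rewrite /divv /euler !sum3 !dparM !dparX /=; ring. Qed.

Lemma euler_lin q x : euler (q * lin x) = (euler q + q) * lin x.
Proof.
have h i : dpar i (lin x) = cP (x 0 i).
  by rewrite /lin dotPE !dparD !dparMC !dparX; move: i; apply: ord3P; rewrite /=; ring.
have e : lin x = cP (x 0 0) * 'X_0 + cP (x 0 1) * 'X_1 + cP (x 0 2%:R) * 'X_2%:R by exact: dotPE.
rewrite /euler !sum3 !dparM !h mulrDl [X in _ = _ + q * X]e; ring.
Qed.

Lemma xx_second_trace q x n : dotv x n = 1 ->
  2%:R * divv (mv (xx q) x) - dird n (dotP x (mv (xx q) x)) =
  lin x * (6%:R * q + 2%:R * euler q) - lin x * lin x * dird n q.
Proof.
move=> xn; have -> : divv (mv (xx q) x) = divv (fun i => 'X_i * (q * lin x)).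
  by apply: eq_bigr => i _; rewrite mv_xx.
by rewrite divv_X euler_lin dotP_xx !dirdM dird_lin xn cP1; ring.
Qed.

Lemma inPm_euler m p : inPm m p -> inPm m (euler p).
Proof. by move=> /inPmP h; apply/inPmP => k hk; rewrite mcoeff_euler h ?mulr0. Qed.

Lemma inPm_dotP m x (V : 'I_3 -> P) : (forall i, inPm m (V i)) -> inPm m (dotP x V).
Proof. by move=> h; apply: inPm_sum => i _; apply: inPmMC. Qed.

Lemma inPm_mv m s x i : inPmx m s -> inPm m (mv s x i).
Proof. by move=> h; apply: inPm_sum => k _; rewrite mulrC; apply: inPmMC. Qed.

Lemma mv_add s t x y : dotP y (mv (s + t) x) = dotP y (mv s x) + dotP y (mv t x).
Proof. by rewrite -dotPDr; apply: dotP_ext => i; apply: mvDl. Qed.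

Lemma inSigmaP l k s : inSigma l k s -> exists t q,
  [/\ inPT (l + 1) t, inPm (k - 2) q & s = symcurl t + xx q].
Proof. by []. Qed.

(** On the flat the linear forms [dl d . x] and [dl c . x] are constants, so the trace of [q x x^T]
    is a constant multiple of [q], although the field has degree up to [k]. *)
Lemma sigma_trace_deg l k s A d c : inSigma l k s -> (k - 2 <= l)%N -> d \in A -> c \in A ->
  exists2 p0, inPm l p0 & van A (dotP (dl d) (mv s (dl c)) - p0).
Proof.
move=> /inSigmaP [t [q [[dt _] dq ->]]] kl dA cA; rewrite mv_add dotP_xx.
exists (dotP (dl d) (mv (symcurl t) (dl c)) + cP (ev 0 (lam d) * ev 0 (lam c)) * q).
  apply: inPmD; last by apply: inPmMC; apply: inPmW kl dq.
  apply: inPm_dotP => i; apply: inPm_mv; apply: inPmx_symcurl; by rewrite -addn1.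
have h (e : 'I_4) : e \in A -> van A (lin (dl e) + cP (ev 0 (lam e))).
  by move=> eA; rewrite -lin_lam; apply: van_lam.
have := vanD (vanMl (q * lin (dl c)) (h d dA)) (vanMl (- q * cP (ev 0 (lam d))) (h c cA)).
by congr (van _ _); rewrite cPM; ring.
Qed.

(** Every term contributed by [q x x^T] contains [dl f . x], constant on [F_f]; the terms in [q]
    itself require [k - 2 <= l - 1]. *)
Lemma sigma_second_trace_deg l k s f : inSigma l k s -> (k - 2 <= l - 1)%N -> (0 < l)%N ->
  exists2 p0, inPm (l - 1) p0 &
  van [set f] (2%:R * divv (mv s (dl f)) - dird (mf v f) (dotP (dl f) (mv s (dl f))) - p0).
Proof.
move=> /inSigmaP [t [q [[dt _] dq ->]]] kl l0; rewrite mv_add.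
have dS : inPmx (l - 1).+1 (symcurl t) by rewrite subn1 prednK //; apply: inPmx_symcurl; rewrite -addn1.
set K := cP (ev 0 (lam f)).
exists (2%:R * divv (mv (symcurl t) (dl f)) - dird (mf v f) (dotP (dl f) (mv (symcurl t) (dl f)))
   - K * (6%:R * q + 2%:R * euler q) - K * (K * dird (mf v f) q)).
  have dq' := inPmW kl dq.
  have dN m (p : P) (j : nat) : inPm m p -> inPm m (j%:R * p).
    by move=> h; rewrite mulr_natl -scaler_nat; apply: inPmZ.
  apply: inPmB; last by do 2 apply: inPmMC; apply: inPm_dirdW.
  apply: inPmB; last by apply: inPmMC; apply: inPmD; apply: dN => //; apply: inPm_euler.
  apply: inPmB; last by apply: inPm_dird; apply: inPm_dotP => i; apply: inPm_mv.
  by apply: dN; apply: inPm_sum => i _; apply: inPm_deriv; apply: inPm_mv.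
have -> : divv (mv (symcurl t + xx q) (dl f)) = divv (mv (symcurl t) (dl f)) + divv (mv (xx q) (dl f)).
  by rewrite /divv -big_split; apply: eq_bigr => i _; rewrite mvDl dparD.
have e := xx_second_trace q (dl_mf nondeg f).
have h : van [set f] (lin (dl f) + K) by rewrite -lin_lam; apply: van_lam; rewrite set11.
(* The difference is divisible by [L + k'], which will be [lin (dl f) + K = lam f]. *)
have aux (d1 d2 g1 g2 L k' q' E Q : P) : 2%:R * d2 - g2 = L * (6%:R * q' + 2%:R * E) - L * L * Q ->
    2%:R * (d1 + d2) - (g1 + g2) - (2%:R * d1 - g1 - k' * (6%:R * q' + 2%:R * E) - k' * (k' * Q)) =
    (6%:R * q' + 2%:R * E - (L - k') * Q) * (L + k').
  move=> e'; transitivity ((2%:R * d2 - g2) + k' * (6%:R * q' + 2%:R * E) + k' * (k' * Q)); first by ring.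
  by rewrite e'; ring.
by rewrite dirdD (aux _ _ _ _ _ _ _ _ _ e); apply: vanMl.
Qed.

Lemma sigma_tr l k s : inSigma l k s -> s^T = s.
Proof.
move=> /inSigmaP [t [q [_ _ ->]]]; apply/matrixP => i j; rewrite mxE.
rewrite [LHS]mxE [RHS]mxE !xxE; congr (_ + _); last by rewrite (mulrC 'X_i).
by rewrite -{2}(symcurl_tr t) [in RHS]mxE.
Qed.

Lemma quad_expand o s x y : dotP x (mv s y) = \sum_a \sum_b
  cP (dotv x (v a - v o) * dotv y (v b - v o)) * dotP (dl a) (mv s (dl b)).
Proof.
have hy z : dotP z (mv s y) = \sum_b cP (dotv y (v b - v o)) * dotP z (mv s (dl b)).
  rewrite {1}(covector_expand nondeg y o).
  rewrite (big_morph (fun y => dotP z (mv s y)) (id1 := 0) (op1 := +%R)).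
  - by apply: eq_bigr => b _; rewrite -dotPMr; apply: dotP_ext => i; rewrite mvZ.
  - by move=> y1 y2; rewrite -dotPDr; apply: dotP_ext => i; rewrite mvD.
  - by rewrite dotPE !mv0r; ring.
rewrite {1}(covector_expand nondeg x o) dotP_suml; apply: eq_bigr => a _.
rewrite dotPZl hy mulr_sumr; apply: eq_bigr => b _.
by rewrite cPM mulrA.
Qed.

(** The normals of the three faces through [v a] form a basis, and all their pairwise traces vanish
    at [v a]. *)
Lemma Tr0_vertex s a : Tr0 v s -> evm (v a) s = 0.
Proof.
move=> [h1 _ h3]; have hq x y : ev (v a) (dotP x (mv s y)) = 0.
  rewrite (quad_expand a) ev_sum big1 // => b _; rewrite ev_sum big1 // => c _.
  rewrite evM evcP; have [->|ba] := eqVneq b a; first by rewrite subrr dotv0r !mul0r.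
  have [->|ca] := eqVneq c a; first by rewrite subrr dotv0r mulr0 mul0r.
  rewrite (_ : ev _ _ = 0) ?mulr0 //; have [->|bc] := eqVneq b c.
    by apply: (van_vertex nondeg _ (h1 c)) => f; rewrite inE => /eqP ->.
  by apply: (van_vertex nondeg _ (h3 b c bc)) => f; rewrite !inE => /orP [] /eqP ->.
apply/matrixP => i j; rewrite [RHS]mxE mxE -/(ev _ _).
have <- : dotP (delta_mx 0 i) (mv s (delta_mx 0 j)) = s i j.
  rewrite dotP_delta /mv (bigD1 j) //= mxE !eqxx cP1 mulr1 big1 ?addr0 // => c /negPf cj.
  by rewrite mxE cj andbF cP0 mulr0.
exact: hq.
Qed.

End Sigma.

(** * Sigma-ring: moments against pointwise traces *)

Section SigmaTraces.
Variables (R : rcfType) (v : 'I_4 -> 'rV[R]_3) (en : 'I_2 -> 'I_4 -> 'I_4 -> 'rV[R]_3).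
Hypotheses (nondeg : tet_nondeg v) (hen : edge_normals v en).
Local Notation P := {mpoly R[3]}.
Local Notation dl := (dl v).
Local Notation van := (van v).
Implicit Types (p q : P) (x y z n : 'rV[R]_3) (a b c d f : 'I_4) (s : 'M[P]_3).

Lemma simpintD m p q : simpint m (p + q) = simpint m p + simpint m q.
Proof. by rewrite !simpintE /simpf mlinD. Qed.

Lemma simpintZ m (k : R) p : simpint m (cP k * p) = k * simpint m p.
Proof. by rewrite !simpintE /simpf mul_mpolyC mlinZ. Qed.

Lemma intED a b p q : intE v a b (p + q) = intE v a b p + intE v a b q.
Proof. by rewrite /intE -!/(sub _ _ _) subD simpintD mulrDr. Qed.

Lemma intEZ a b (k : R) p : intE v a b (cP k * p) = k * intE v a b p.
Proof. by rewrite /intE -!/(sub _ _ _) subM subC simpintZ mulrCA. Qed.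

Lemma intFZ f (k : R) p : intF v f (cP k * p) = k * intF v f p.
Proof. by rewrite /intF -!/(sub _ _ _) subM subC simpintZ mulrCA. Qed.

(** The orthogonal complement of the edge is two-dimensional, so the two given normals span it. *)
Lemma normal_span a b d : (a < b)%N -> dotv (dl d) (v b - v a) = 0 ->
  exists k : 'I_2 -> R, dl d = k 0 *: en 0 a b + k 1 *: en 1 a b.
Proof.
move=> ab hd; have [h0 _ hr] := hen ab; set x := v b - v a in hd h0.
have x0 : x != 0 by apply: vtx_neq => //; apply: contraTneq ab => ->; rewrite ltnn.
pose M := col_mx (en 0 a b) (en 1 a b).
have m11 (y : 'rV[R]_3) : dotv y x = 0 -> y *m x^T = 0.
  by move=> h; apply/matrixP => i j; rewrite !ord1 [RHS]mxE.
have MK : (M <= kermx x^T)%MS.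
  by apply/sub_kermxP; rewrite mul_col_mx !m11 // col_mx0.
have rK : \rank (kermx x^T) = 2%N by rewrite mxrank_ker mxrank_tr rank_rV x0.
have : (dl d <= M)%MS.
  have rM : \rank M = 2%N by exact: hr.
  have [_] := mxrank_leqif_eq MK; rewrite rM rK eqxx => /esym /eqmxP ->.
  by apply/sub_kermxP; apply: m11.
move=> /submxP [D ->]; exists (fun i => if i == 0 then lsubmx D 0 0 else rsubmx D 0 0).
rewrite -{1}(hsubmxK D) mul_row_col; congr (_ + _).
  by rewrite {1}[lsubmx D]mx11_scalar mul_scalar_mx.
by rewrite {1}[rsubmx D]mx11_scalar mul_scalar_mx.
Qed.

Lemma mem_uniq4 a b c d f : uniq [:: a; b; c; d] -> f \in [:: a; b; c; d].
Proof.
move=> u; have := sum_uniq4 (fun g : 'I_4 => (g == f)%:R : R) u.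
rewrite (bigD1 f) //= eqxx big1 ?addr0 => [|x /negPf -> //].
rewrite !inE ![f == _]eq_sym; do 4![case: eqP => _ //=].
by rewrite !addr0 => /eqP; rewrite oner_eq0.
Qed.

Lemma mv_comb2 s (k1 k2 : R) x y z :
  dotP z (mv s (k1 *: x + k2 *: y)) = cP k1 * dotP z (mv s x) + cP k2 * dotP z (mv s y).
Proof.
rewrite -!dotPMr -dotPDr; apply: dotP_ext => i; by rewrite mvD !mvZ.
Qed.

Lemma edge_moment s a b d c q : (a < b)%N ->
  (forall i j : 'I_2, intE v a b (dotP (en i a b) (mv s (en j a b)) * q) = 0) ->
  dotv (dl d) (v b - v a) = 0 -> dotv (dl c) (v b - v a) = 0 ->
  intE v a b (dotP (dl d) (mv s (dl c)) * q) = 0.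
Proof.
move=> ab h /(normal_span ab) [k ->] /(normal_span ab) [m ->].
rewrite mv_comb2 !dotPDl !dotPZl !mulrDr !mulrDl !intED -!mulrA !intEZ !h !mulr0 !addr0 //.
Qed.

(** For the unit normal [n = m dl f] one has [mf f = m n], so both terms scale by the same factor
    [m]. *)
Lemma second_trace_scale s f : let n := cvec (onormal v f) in exists m : R, m != 0 /\
  2%:R * divF n (s *m n^T)^T + dnorm n ((n *m s *m n^T) 0 0) =
  cP m * (2%:R * divv (mv s (dl f)) - dird (mf v f) (dotP (dl f) (mv s (dl f)))).
Proof.
have [m [m0 nE n1]] := onormalP nondeg f; lazy zeta; exists m; split=> //.
rewrite quadE divFE //; set n := onormal v f in nE n1 *.
have -> : dnorm (cvec n) (dotP n (mv s n)) = dird n (dotP n (mv s n)).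
  by apply: eq_bigr => j _; rewrite mxE.
have mm : m * m * dotv (dl f) (dl f) = 1 by rewrite -n1 nE dotvZl dotvZr mulrA.
have -> : divv (mv s n) = cP m * divv (mv s (dl f)).
  by rewrite /divv mulr_sumr; apply: eq_bigr => i _; rewrite nE mvZ dparMC.
have -> : dotP n (mv s n) = cP m * (cP m * dotP (dl f) (mv s (dl f))).
  rewrite nE dotPZl (@dotP_ext R _ _ (fun i => cP m * mv s (dl f) i)) => [|i]; last exact: mvZ.
  by rewrite dotPMr.
have -> : mf v f = m *: n.
  rewrite /mf nE scalerA; congr (_ *: _); rewrite -[RHS]mulr1 -[in RHS](mulfV (x := dotv (dl f) (dl f))).
    by rewrite mulrA mm mul1r.
  by rewrite gt_eqF // dotv_gt0 // dl_neq0.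
rewrite !dirdMC dird_scalel; move: (dird n _) (divv _) => g h; ring.
Qed.

(** Vertex values and edge moments give vanishing on the edges; this is what lets face moments of
    degree [l - 3] control [n . s n]. Moments of degree [l - 1] control the second trace
    directly. *)
Lemma Sigma0_Tr0 k l s : (3 <= k)%N -> (maxn (k - 1) 3 <= l)%N ->
  Sigma0 v en l k s -> Tr0 v s.
Proof.
rewrite geq_max => k3 /andP [kl l3] [hs hv he hf hf2].
have kl2 : (k - 2 <= l)%N by lia.
have kl1 : (k - 2 <= l - 1)%N by lia.
have l0 : (0 < l)%N by lia.
have E f c d e : f != c -> d \in [set f; c] -> e \in [set f; c] ->
    van [set f; c] (dotP (dl d) (mv s (dl e))).
  move=> fc dA eA; have [a [b [ab u]]] := other_pair fc.
  have [p0 dp0 hp0] := sigma_trace_deg v hs kl2 dA eA.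
  have hx g : g \in [set f; c] -> dotv (dl g) (v b - v a) = 0.
    have := u; rewrite /= !inE !negb_or => /and4P [/and3P [n1 n2 n3] /andP [n4 n5] n6 _].
    by move=> /orP [] /eqP ->; rewrite dl_edge0.
  have ve g : ev (v g) (dotP (dl d) (mv s (dl e))) = 0.
    rewrite ev_dotP ev_mv_row (_ : evm (v g) s = 0) ?hv // trmx0 mulmx0; exact: dotv0r.
  apply: (edge_zero nondeg u dp0 hp0 (ve a) (ve b)) => q dq.
  by apply: (edge_moment ab _ (hx d dA) (hx e eA)) => i j; have := he a b ab i j q dq; rewrite quadE.
have F1 f : van [set f] (dotP (dl f) (mv s (dl f))).
  have [p0 dp0 hp0] := sigma_trace_deg v hs kl2 (set11 f) (set11 f).
  apply: (face_zero nondeg dp0 hp0) => [c cf|q dq].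
    by apply: E; rewrite ?inE ?eqxx // eq_sym.
  have [m [m0 nE n1]] := onormalP nondeg f; have := hf f q dq; lazy zeta.
  rewrite quadE nE dotPZl (@dotP_ext R _ _ (fun i => cP m * mv s (dl f) i)) => [|i]; last exact: mvZ.
  rewrite dotPMr -!mulrA !intFZ => /eqP.
  by rewrite mulf_eq0 (negPf m0) orFb mulf_eq0 (negPf m0) orFb => /eqP.
split=> // f; last by move=> c fc; apply: E => //; rewrite !inE eqxx ?orbT.
have [p0 dp0 hp0] := sigma_second_trace_deg nondeg f hs kl1 l0.
apply: (face_orth nondeg dp0 hp0) => q dq.
have [m [m0 e]] := second_trace_scale s f; have := hf2 f q dq; lazy zeta.
by rewrite e -mulrA intFZ => /eqP; rewrite mulf_eq0 (negPf m0) orFb => /eqP.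
Qed.

Lemma Tr0_intE s a b (i j : 'I_2) q : Tr0 v s -> (a < b)%N ->
  intE v a b ((cvec (en i a b) *m s *m (cvec (en j a b))^T) 0 0 * q) = 0.
Proof.
move=> [h1 _ h3] ab; rewrite quadE.
have [c [d u]] : exists c d, uniq [:: a; b; c; d].
  have ne : a != b by apply: contraTneq ab => ->; rewrite ltnn.
  have [c [d [_ u]]] := other_pair ne; exists c, d.
  by have := u; rewrite -(rot_uniq 2).
apply: (intE_van nondeg u); apply: vanMr.
have [hn _ _] := hen ab.
rewrite (quad_expand nondeg a); apply: van_sum => e _; apply: van_sum => g _.
have := u; rewrite /= !inE !negb_or => /and4P [/and3P [n1 n2 n3] /andP [n4 n5] n6 _].
have K m : m \notin [set c; d] -> forall i', dotv (en i' a b) (v m - v a) = 0.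
  move=> mn i'; have : m \in [:: a; b].
    by move: mn (mem_uniq4 m u); rewrite !inE negb_or => /andP [/negPf -> /negPf ->]; rewrite !orbF.
  by rewrite !inE => /orP [] /eqP ->; rewrite ?subrr ?dotv0r.
have [eA|/K ->] := boolP (e \in [set c; d]); last by rewrite mul0r cP0 mul0r; apply: van0.
have [gA|/K ->] := boolP (g \in [set c; d]); last by rewrite mulr0 cP0 mul0r; apply: van0.
apply: vanMl; move: eA gA; rewrite !inE => /orP [] /eqP -> /orP [] /eqP ->.
+ by apply: vanS (h1 c); rewrite subsetUl.
+ exact: h3.
+ by rewrite setUC; apply: h3; rewrite eq_sym.
+ by apply: vanS (h1 d); rewrite subsetUr.
Qed.

Lemma Tr0_intF s f q : Tr0 v s -> let n := cvec (onormal v f) in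
  intF v f ((n *m s *m n^T) 0 0 * q) = 0.
Proof.
move=> [h1 _ _]; lazy zeta; rewrite quadE.
have [m [m0 nE n1]] := onormalP nondeg f; rewrite nE dotPZl.
rewrite (@dotP_ext R _ _ (fun i => cP m * mv s (dl f) i)) => [|i]; last exact: mvZ.
by apply: intF_van => //; rewrite dotPMr; apply: vanMr; do 2 apply: vanMl.
Qed.

Lemma Tr0_intF2 s f q : Tr0 v s -> let n := cvec (onormal v f) in
  intF v f ((2%:R * divF n (s *m n^T)^T + dnorm n ((n *m s *m n^T) 0 0)) * q) = 0.
Proof.
move=> [_ h2 _]; lazy zeta; have [m [_ e]] := second_trace_scale s f; rewrite {}e.
by apply: intF_van => //; apply: vanMr; apply: vanMl.
Qed.

Lemma Tr0_Sigma0 k l s : inSigma l k s -> Tr0 v s -> Sigma0 v en l k s.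
Proof.
move=> hs ht; split.
- exact: hs.
- by move=> a; apply: Tr0_vertex.
- by move=> a b ab i j q _; apply: Tr0_intE.
- by move=> f q _; apply: Tr0_intF.
- by move=> f q _; apply: Tr0_intF2.
Qed.

End SigmaTraces.

(** * Potentials on a single face *)

Section Peeling.
Variables (R : rcfType) (v : 'I_4 -> 'rV[R]_3).
Hypothesis nondeg : tet_nondeg v.
Local Notation P := {mpoly R[3]}.
Local Notation dl := (dl v).
Local Notation van := (van v).
Local Notation TrC := (TrC v).
Implicit Types (p q k : P) (x y z : 'rV[R]_3) (a b c f o : 'I_4) (t : 'M[P]_3)
  (u : 'rV[P]_3) (B : {set 'I_3}) (m : nat).

Lemma dpar_kill B j p : j \notin B -> dpar j (kill B p) = kill B (dpar j p).
Proof.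
move=> jB; rewrite /kill deriv_sub (negPf jB); congr (sub _ _ _).
rewrite /dird (bigD1 j) //= mxE !eqxx cP1 mul1r big1 ?addr0 // => i /negPf ij.
by rewrite mxE ij andbF cP0 mul0r.
Qed.

Lemma kill_sub B p q : kill B (p - q) = kill B p - kill B q.
Proof. exact: subB. Qed.

Lemma chart_sub o (b : 'I_3 -> 'I_4) p q : chart v o b (p - q) = chart v o b p - chart v o b q.
Proof. exact: subB. Qed.

(** The Poincare lemma on a plane, from the one in space: in the chart the closed form does not
    depend on the third variable and is given third component zero. *)
Lemma plane_grad o b c f m q1 q2 : uniq [:: o; b; c; f] -> inPm m q1 -> inPm m q2 ->
  van [set f] (dird (v c - v o) q1 - dird (v b - v o) q2) ->
  exists2 k, inPm m.+1 k &
    van [set f] (dird (v b - v o) k - q1) /\ van [set f] (dird (v c - v o) k - q2).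
Proof.
move=> u d1 d2; rewrite -(image_tri2 b c f) => /(van_chart nondeg (b := tri b c f) u) h.
set K := @kill R [set 2%:R] in h *; set F := chart v o (tri b c f) in h *.
have n0 : 0 \notin [set 2%:R : 'I_3] by rewrite inE.
have n1 : 1 \notin [set 2%:R : 'I_3] by rewrite inE.
have D0 p : dpar 0 (K (F p)) = K (F (dird (v b - v o) p)) by rewrite dpar_kill // /F /chart deriv_sub.
have D1 p : dpar 1 (K (F p)) = K (F (dird (v c - v o) p)) by rewrite dpar_kill // /F /chart deriv_sub.
have D2 p : dpar 2%:R (K (F p)) = 0 by apply: indep_kill; rewrite inE.
have cl : dpar 1 (K (F q1)) = dpar 0 (K (F q2)).
  by apply/eqP; rewrite D0 D1 -subr_eq0 -kill_sub -chart_sub; apply/eqP; exact: h.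
have dK p : inPm m p -> inPm m (K (F p)) by move=> dp; do 2 apply: inPm_sub.
have [w [w0 w1 w2]] : exists w : 'I_3 -> P, [/\ w 0 = K (F q1), w 1 = K (F q2) & w 2%:R = 0].
  by exists (fun i => if i == 0 then K (F q1) else if i == 1 then K (F q2) else 0).
have D20 : dpar 2%:R (w 0) = 0 by rewrite w0.
have D21 : dpar 2%:R (w 1) = 0 by rewrite w1.
have D10 : dpar 1 (w 0) = dpar 0 (w 1) by rewrite w0 w1.
have wc i j : dpar i (w j) = dpar j (w i).
  by move: i j; apply: ord3P; apply: ord3P; rewrite ?w2 ?dpar0.
have [i|k' dk ek] := poincare_grad (n := m) wc.
  by move: i; apply: ord3P; [rewrite w0; apply: dK | rewrite w1; apply: dK | rewrite w2; apply: inPm0].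
have Kk j : F (dird (v (tri b c f j) - v o) (chartV v (tri b c f) k')) = w j.
  by rewrite -[RHS]ek -{2}(chartVK nondeg (b := tri b c f) u k') /F /chart deriv_sub.
exists (chartV v (tri b c f) k'); first exact: inPm_sub.
split; apply/(van_chart nondeg (b := tri b c f) u); rewrite -/K chart_sub -/F.
  by have := Kk 0; rewrite tri0 => ->; rewrite w0 /K kill_sub kill_idem subrr.
by have := Kk 1; rewrite tri1 => ->; rewrite w1 /K kill_sub kill_idem subrr.
Qed.

Lemma field_expand o (V : 'I_3 -> P) i :
  V i = \sum_a dotP (dl a) V * cP ((v a - v o) 0 i).
Proof.
apply: mpoly_evP => z; rewrite ev_sum.
have := congr1 (fun y : 'rV[R]_3 => y 0 i) (vec_expand nondeg o (\row_j ev z (V j))).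
rewrite [LHS]mxE summxE => ->; apply: eq_bigr => a _.
by rewrite evM evcP ev_dotP [LHS]mxE.
Qed.

(* Integrating twice on the plane of a face: first the scalar k with surface
   curl (curl t) dl f, then the components of w. *)
Lemma face_potential f t m : inPmx m.+1 t -> Tr0 v (symcurl t) ->
  exists2 w : 'rV[P]_3, inPmx m.+2 w & TrC f (t - grad w).
Proof.
move=> dt [h1 h2 _]; have u := fvo_uniq f.
set o := fv f 0 in u; set b := fv f 1 in u; set c := fv f 2%:R in u.
have := u; rewrite /= !inE !negb_or => /and4P [/and3P [ob oc of'] /andP [bc bf] cf _].
pose V := mv (curl t) (dl f); pose D := edet v o b c f.
pose x1 := v b - v o; pose x2 := v c - v o.
have dV y : inPm m (cP D * dotP y V).
  apply: inPmMC; apply: inPm_dotP => i; apply: inPm_mv => j k'.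
  by rewrite curlE; apply: inPmB; apply: inPm_deriv.
have F1 : van [set f] (dotP (dl f) V) by have := h1 f; rewrite dotP_symcurl halfDK.
have F2 : van [set f] (dird x1 (dotP (dl b) V) + dird x2 (dotP (dl c) V)).
  have := h2 f; rewrite symcurl_second_trace // (LfE nondeg _ u) => h.
  have F1' : van [set f] (dird (v f - v o - mf v f) (dotP (dl f) V)).
    apply: van_dird => // a; rewrite inE => /eqP ->.
    by rewrite dotvBr dl_mf // dl_v // eqxx eq_sym (negPf of') subr0 subrr.
  by have := vanB h F1'; rewrite addrK.
(* A quarter turn of the divergence-free tangential field is closed; its potential is [k]. *)
have [|k dk [k1 k2]] := plane_grad u (dV (dl c)) (inPmN (dV (dl b))).
  by rewrite dirdN !dirdMC opprK -mulrDr addrC; apply: vanMl.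
rewrite -/x1 -/x2 in k1 k2.
have VE i : van [set f] (cP D * V i - (cP (x2 0 i) * dird x1 k - cP (x1 0 i) * dird x2 k)).
  have -> : cP D * V i - (cP (x2 0 i) * dird x1 k - cP (x1 0 i) * dird x2 k) =
      cP D * cP ((v f - v o) 0 i) * dotP (dl f) V - cP (x2 0 i) * (dird x1 k - cP D * dotP (dl c) V)
      + cP (x1 0 i) * (dird x2 k - - (cP D * dotP (dl b) V)).
    rewrite {1}(field_expand o V i) (sum_uniq4 _ u) subrr mxE cP0 mulr0 add0r -/x1 -/x2.
    move: (dotP (dl b) V) (dotP (dl c) V) (dotP (dl f) V) (dird x1 k) (dird x2 k) => *; ring.
  by apply: vanD; [apply: vanB|]; apply: vanMl.
(* By [mv_curl_cross] and [VE], row [i] of [t - k I] is closed along the face. *)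
have hw i : exists w : P, inPm m.+2 w /\ (van [set f] (dird x1 w - (mv t x1 i - k * cP (x1 0 i))) /\
    van [set f] (dird x2 w - (mv t x2 i - k * cP (x2 0 i)))).
  have dmv y : inPm m.+1 (mv t y i - k * cP (y 0 i)).
    by apply: inPmB; [apply: inPm_mv | rewrite mulrC; apply: inPmMC].
  have [|w dw ew] := plane_grad u (dmv x1) (dmv x2); last by exists w.
  rewrite -/x1 -/x2 !dirdB !dirdMr.
  have := VE i; rewrite /V -mvZ -(cross_dl nondeg u) mv_curl_cross -/x1 -/x2 => /vanN.
  by congr (van _ _); ring.
have [w0 [d0 [a0 b0]]] := hw 0; have [w1 [d1 [a1 b1]]] := hw 1; have [w2 [d2 [a2 b2]]] := hw 2%:R.
exists (\row_i (if i == 0 then w0 else if i == 1 then w1 else w2)).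
  by move=> i; apply: ord3P; rewrite mxE /=.
exists k => x hx i.
have hg y : mv (t - grad (\row_i (if i == 0 then w0 else if i == 1 then w1 else w2))) y i -
   k * cP (y 0 i) = - (dird y (if i == 0 then w0 else if i == 1 then w1 else w2) -
   (mv t y i - k * cP (y 0 i))).
  by rewrite mvDl mvNl mv_grad mxE; ring.
have E1 : van [set f] (dird x1 (if i == 0 then w0 else if i == 1 then w1 else w2) -
   (mv t x1 i - k * cP (x1 0 i))) by move: i {hg}; apply: ord3P.
have E2 : van [set f] (dird x2 (if i == 0 then w0 else if i == 1 then w1 else w2) -
   (mv t x2 i - k * cP (x2 0 i))) by move: i {hg E1}; apply: ord3P.
rewrite hg; apply: vanN.
rewrite (tangent_expand nondeg u hx) -/x1 -/x2; set r1 := dotv _ _; set r2 := dotv _ _.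
move: (if i == 0 then w0 else _) E1 E2 {hg} => w E1 E2.
have := vanD (vanMl (cP r1) E1) (vanMl (cP r2) E2); congr (van _ _).
clearbody x1 x2 r1 r2; rewrite dird_addl !dird_scalel mvD !mvZ !mxE !cPD !cPM.
by move: (dird x1 w) (dird x2 w) (mv t x1 i) (mv t x2 i) => *; ring.
Qed.

End Peeling.

(** * Correcting one face without spoiling the earlier ones *)

Section PeelingStep.
Variables (R : rcfType) (v : 'I_4 -> 'rV[R]_3).
Hypothesis nondeg : tet_nondeg v.
Local Notation P := {mpoly R[3]}.
Local Notation dl := (dl v).
Local Notation lam := (lam v).
Local Notation van := (van v).
Local Notation TrC := (TrC v).
Local Notation TrCc := (TrCc v).
Implicit Types (p k : P) (x : 'rV[R]_3) (a b c d f g o : 'I_4) (s t : 'M[P]_3)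
  (u : 'rV[P]_3) (m : nat) (L : seq 'I_4).

Lemma fourth a b c : exists d, [/\ d != a, d != b & d != c].
Proof.
have [d hd] : exists d, d \notin [:: a; b; c].
  apply/existsP; apply: contraT; rewrite negb_exists => /forallP h.
  have : (#|'I_4| <= #|[:: a; b; c]|)%N.
    by apply: subset_leq_card; apply/subsetP => d _; have := h d; rewrite negbK.
  by rewrite card_ord => /leq_trans /(_ (card_size _)).
by exists d; move: hd; rewrite !inE !negb_or => /and3P [].
Qed.

(** Repeated division on [F_f]: after dividing by [lam g] the remaining vanishing conditions
    survive, because [lam g] is not zero along the other edge lines. *)
Lemma extend_face L f p m : uniq L -> f \notin L -> (size L <= m)%N -> inPm m p ->
  (forall g, g \in L -> van [set f; g] p) ->
  exists2 r, inPm (m - size L) r & van [set f] (p - (\prod_(g <- L) lam g) * r).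
Proof.
elim: L m p => [|g L ih] m p /=.
  move=> _ _ _ dp _; exists p; first by rewrite subn0.
  by rewrite big_nil mul1r subrr; apply: van0.
rewrite inE negb_or => /andP [gL uL] /andP [fg fL] hm dp h.
have [c [cf cg _]] := fourth f g g.
have cf' : c \notin [set f] by rewrite inE.
have gf' : g \notin [set f] by rewrite inE eq_sym.
have hg : van (g |: [set f]) p by rewrite setUC; apply: h; rewrite inE eqxx.
have [r1 dr1 hr1] := van_div nondeg cg cf' gf' dp hg.
have hm' : (size L <= m.-1)%N by move: hm; case: (m).
have [g' g'L|r dr hr] := ih m.-1 r1 uL fL hm' dr1.
  have [d [df dg dg']] := fourth f g g'.
  apply: (van_cancel nondeg (a := g) (c := d)) => //.
  + by rewrite !inE negb_or df dg'.
  + by rewrite !inE negb_or [g == f]eq_sym fg; apply: contraNneq gL => ->.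
  have sf : [set f] \subset [set f; g'] by rewrite subsetUl.
  by apply: (van_subl (vanS sf hr1)); apply: h; rewrite inE g'L orbT.
exists r; first by move: dr; rewrite -subn1 -subnDA add1n.
rewrite big_cons -mulrA; apply: van_trans hr1 _; rewrite -mulrBr; exact: vanMl.
Qed.

(** The product of the [lam g] with the quotient extends [p] from [F_f] to space within the same
    degree. *)
Lemma extend_zero L f p m : uniq L -> f \notin L -> (size L <= m)%N -> inPm m p ->
  (forall g, g \in L -> van [set f; g] p) ->
  exists p', [/\ inPm m p', van [set f] (p - p') & forall g, g \in L -> van [set g] p'].
Proof.
move=> uL fL hm dp h; have [r dr hr] := extend_face uL fL hm dp h.
exists ((\prod_(g <- L) lam g) * r); split=> //.
  rewrite -(subnKC hm); apply: inPmM dr; rewrite -sum1_size.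
  elim/big_ind2: _ => [||g _]; [exact: (inPmC 0 1)|by move=> *; apply: inPmM|exact: inPm_lam].
by move=> g gL; rewrite (big_rem g gL) /= -mulrA; apply: vanMr; apply: van_lam; rewrite inE.
Qed.

Lemma mv_sub s t x i : mv (s - t) x i = mv s x i - mv t x i.
Proof. by rewrite mvDl mvNl. Qed.

Lemma curl_sub_grad t u : curl (t - grad u) = curl t.
Proof.
have e : curl (t - grad u) = curl t - curl (grad u).
  by apply/matrixP => i j; rewrite mxBE !curlE !mxBE !dparB; ring.
by rewrite e curl_grad subr0.
Qed.

(* The scalars of two faces satisfy d_x (k - kg) = 2 Delta (dl f)^T sym curl t (dl g)
   along their common edge. *)
Lemma edge_scalar f g t t' k kg o : Tr0 v (symcurl t) -> curl t' = curl t ->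
  f != g -> TrCc f t' k -> TrCc g t kg -> f != o -> g != o ->
  van [set f; g] (k - kg - cP (ev (v o) (k - kg))).
Proof.
move=> [_ _ h3] ct fg hk hkg fo go.
apply: (van_const nondeg) => [a|x hx]; first by rewrite !inE => /orP [] /eqP ->.
have [a [b [_ u]]] := other_pair fg.
have := u; rewrite /= !inE !negb_or => /and4P [/and3P [ab af ag] /andP [bf bg] _ _].
have u1 : uniq [:: a; b; g; f] by rewrite /= !inE !negb_or ab af ag bf bg eq_sym fg.
have sf : [set f] \subset [set f; g] by rewrite subsetUl.
have sg : [set g] \subset [set f; g] by rewrite subsetUr.
have -> : x = dotv (dl b) x *: (v b - v a).
  have hf : dotv (dl f) x = 0 by apply: hx; rewrite !inE eqxx.
  have hg : dotv (dl g) x = 0 by apply: hx; rewrite !inE eqxx orbT.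
  by have := tangent_expand nondeg u1 hf; rewrite hg scale0r addr0.
rewrite dird_scalel; apply: vanMl.
have := curl_face nondeg (dl g) hk u1; have := curl_face nondeg (dl f) hkg u.
rewrite ct edet_swap !dl_v // !eqxx ![_ == a]eq_sym ![_ == b]eq_sym (negPf af) (negPf ag).
rewrite (negPf bf) (negPf bg) !subr0 cP0 cP1 !mul1r !mul0r !subr0 cPN mulNr.
move=> /(vanS sg) e2 /(vanS sf) e1.
have := h3 f g fg; rewrite dotP_symcurl => /(@vanMl _ _ _ _ (2%:R * cP (edet v a b g f))) e3.
have := vanB e3 (vanB e1 e2); congr (van _ _); rewrite dirdB.
move: (dird _ k) (dird _ kg) (dotP (dl f) _) (dotP (dl g) _) (cP (edet v a b g f)) => e4 e5 e6 e7 e8.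
transitivity (cP (2%:R^-1) * 2%:R * e8 * (e6 + e7) - (e8 * e7 - e4 - (- (e8 * e6) - e5))); first by ring.
by rewrite cP2; ring.
Qed.

(** Both scalars are read off from [t] applied to the vector of the common edge. *)
Lemma TrCc_agree f g t k k' : f != g -> TrCc f t k -> TrCc g t k' -> van [set f; g] (k - k').
Proof.
move=> fg hk hk'; have [a [b [_ u]]] := other_pair fg.
have := u; rewrite /= !inE !negb_or => /and4P [/and3P [ab af ag] /andP [bf bg] _ _].
have sf : [set f] \subset [set f; g] by rewrite subsetUl.
have sg : [set g] \subset [set f; g] by rewrite subsetUr.
have e1 := van_dotP (dl b) (fun i => vanS sf (hk _ (dl_edge0 nondeg bf af) i)).
have e2 := van_dotP (dl b) (fun i => vanS sg (hk' _ (dl_edge0 nondeg bg ag) i)).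
rewrite !dotPBr !dotPMr !dotPcP in e1 e2; move: e1 e2.
rewrite dl_v // eqxx eq_sym (negPf ab) subr0 cP1 !mulr1 => e1 e2.
have := vanB e2 e1; congr (van _ _); ring.
Qed.

Lemma van_tangent_row f u x i : dotv (dl f) x = 0 -> van [set f] (u 0 i) -> van [set f] (dird x (u 0 i)).
Proof. by move=> hx; apply: van_dird => a; rewrite inE => /eqP ->. Qed.

Lemma mv_sub_devgrad t u x i k : mv (t - devgrad u) x i - (k + cP (3%:R^-1) * \tr (grad u)) * cP (x 0 i) =
  mv t x i - k * cP (x 0 i) - dird x (u 0 i).
Proof. by rewrite mv_sub mv_devgrad; ring. Qed.

(** The tangential derivatives of [u] vanish on [F_g]; only the trace part of [devgrad u] remains,
    and it changes the scalar alone. *)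
Lemma TrC_sub_devgrad g t u : TrC g t -> (forall i, van [set g] (u 0 i)) -> TrC g (t - devgrad u).
Proof.
move=> [k hk] hu; exists (k + cP (3%:R^-1) * \tr (grad u)) => x hx i.
rewrite mv_sub_devgrad; apply: vanB; first exact: hk.
exact: van_tangent_row.
Qed.

(* The potential w of face_potential is unique up to alpha + beta x; a suitable
   choice of alpha and beta makes it vanish on the edges shared with the faces in L. *)
Lemma normalized_potential f t m L : inPmx m.+1 t -> Tr0 v (symcurl t) -> f \notin L ->
  (forall g, g \in L -> TrC g t) ->
  exists w : 'rV[P]_3, [/\ inPmx m.+2 w, TrC f (t - grad w) &
    forall g i, g \in L -> van [set f; g] (w 0 i)].
Proof.
move=> dt ht fL hL; have [w dw [k hk]] := face_potential nondeg f dt ht.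
case: L fL hL => [|g0 L]; first by exists w; split=> //; exists k.
set L0 := g0 :: L => fL hL.
have nf g : g \in L0 -> f != g by move=> gL; apply: contraNneq fL => ->.
have [kf hkf] : exists kf : 'I_4 -> P, forall g, g \in L0 -> TrCc g t (kf g).
  apply: (fin_all_exists (P := fun g kg => g \in L0 -> TrCc g t kg)) => g.
  have [gL|_] := boolP (g \in L0); last by exists 0.
  by have [kg hg] := hL g gL; exists kg.
have g0L : g0 \in L0 by rewrite inE eqxx.
have [o0 [f0 gg0 _]] := fourth f g0 g0; rewrite ![o0 == _]eq_sym in f0 gg0.
have ct : curl (t - grad w) = curl t by exact: curl_sub_grad.
have E g o : g \in L0 -> f != o -> g != o -> van [set f; g] (k - kf g - cP (ev (v o) (k - kf g))).
  by move=> gL fo go; apply: (edge_scalar ht ct (nf g gL) hk (hkf g gL)).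
have vx g o (p : P) : f != o -> g != o -> van [set f; g] p -> ev (v o) p = 0.
  by move=> fo go; apply: van_vertex => // a; rewrite !inE => /orP [] /eqP ->.
pose be := ev (v o0) (k - kf g0).
(* The constants of two edges are compared at their common vertex [v o], where [kf g] and [kf g0]
   agree as well. *)
have C1 g : g \in L0 -> van [set f; g] (k - kf g - cP be).
  move=> gL; have [->|gn] := eqVneq g g0; first exact: E.
  have [o [fo go g0o]] := fourth f g g0; rewrite ![o == _]eq_sym in fo go g0o.
  have := vx g0 o _ fo g0o (E g0 o0 g0L f0 gg0); rewrite -/be evB evcP => /eqP.
  rewrite subr_eq0 => /eqP e1.
  have e2 : ev (v o) (kf g - kf g0) = 0.
    apply: (van_vertex nondeg _ (TrCc_agree gn (hkf g gL) (hkf g0 g0L))) => a.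
    by rewrite !inE => /orP [] /eqP ->.
  have e3 : ev (v o) (k - kf g) = be.
    by rewrite -e1; apply/eqP; rewrite -subr_eq0 -evB -oppr_eq0 -evN -e2; apply/eqP; congr (ev _ _); ring.
  by have := E g o gL fo go; rewrite e3.
(* Adding [be x] lowers the scalar of [t - grad w] by [be], to that of [t] on each shared edge; so
   the derivative of [w1] along these edges vanishes. *)
pose w1 i : P := w 0 i + cP be * 'X_i.
have C2 g o i : g \in L0 -> f != o -> g != o -> van [set f; g] (w1 i - cP (ev (v o) (w1 i))).
  move=> gL fo go; apply: (van_const nondeg) => [a|x hx]; first by rewrite !inE => /orP [] /eqP ->.
  have hf : dotv (dl f) x = 0 by apply: hx; rewrite !inE eqxx.
  have hg : dotv (dl g) x = 0 by apply: hx; rewrite !inE eqxx orbT.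
  have sf : [set f] \subset [set f; g] by rewrite subsetUl.
  have sg : [set g] \subset [set f; g] by rewrite subsetUr.
  have e1 := vanS sf (hk x hf i); have e2 := vanS sg (hkf g gL x hg i).
  have e3 := vanMl (cP (x 0 i)) (C1 g gL); have := vanB (vanB e2 e1) e3; congr (van _ _).
  by rewrite mv_sub mv_grad /w1 dirdD dirdMC dirdX; ring.
pose ga i := ev (v o0) (w1 i).
have C3 g i : g \in L0 -> van [set f; g] (w1 i - cP (ga i)).
  move=> gL; have [->|gn] := eqVneq g g0; first exact: C2.
  have [o [fo go g0o]] := fourth f g g0; rewrite ![o == _]eq_sym in fo go g0o.
  have := vx g0 o _ fo g0o (C2 g0 o0 i g0L f0 gg0); rewrite evB evcP => /eqP.
  by rewrite subr_eq0 /ga => /eqP <-; apply: C2.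
exists (\row_i (w1 i - cP (ga i))); split; last by move=> g i gL; rewrite mxE; apply: C3.
  move=> j i; rewrite mxE; apply: inPmB; last exact: inPmC.
  by apply: inPmD; [exact: dw | apply: inPmMC; apply: inPmW (inPmX _ i)].
exists (k - cP be) => x hx i; have := hk x hx i; congr (van _ _).
by rewrite !mv_sub !mv_grad mxE /w1 dirdB dirdC dirdD dirdMC dirdX; ring.
Qed.

(** Only the values of the potential on [F_f] matter: [u] equals [w] there and vanishes on the faces
    of [L]. *)
Lemma peel_step f t m L : inPmx m.+1 t -> Tr0 v (symcurl t) -> uniq L -> f \notin L ->
  (size L <= m.+2)%N -> (forall g, g \in L -> TrC g t) ->
  exists u, inPmx m.+2 u /\ forall g, g \in f :: L -> TrC g (t - devgrad u).
Proof.
move=> dt ht uL fL sL hL.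
have [w [dw [k hk] hw]] := normalized_potential dt ht fL hL.
have h i := extend_zero uL fL sL (dw 0 i) (fun g gL => hw g i gL).
have [u0 [d0 e0 z0]] := h 0; have [u1 [d1 e1 z1]] := h 1; have [u2 [d2 e2 z2]] := h 2%:R.
pose u : 'rV[P]_3 := \row_i (if i == 0 then u0 else if i == 1 then u1 else u2).
have du : inPmx m.+2 u by move=> i; apply: ord3P; rewrite mxE /=.
have eu i : van [set f] (w 0 i - u 0 i) by rewrite /u mxE; move: i; apply: ord3P.
have zu g i : g \in L -> van [set g] (u 0 i).
  by move=> gL; rewrite /u mxE; move: i; apply: ord3P => /=; [apply: z0 | apply: z1 | apply: z2].
exists u; split=> // g; rewrite inE => /orP [/eqP ->|gL]; last first.
  by apply: TrC_sub_devgrad => [|i]; [apply: hL | apply: zu].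
exists (k + cP (3%:R^-1) * \tr (grad u)) => x hx i; rewrite mv_sub_devgrad.
have hwu : van [set f] (dird x (w 0 i - u 0 i)).
  by apply: van_dird => // a; rewrite inE => /eqP ->.
have := vanD (hk x hx i) hwu; congr (van _ _).
by rewrite mv_sub mv_grad dirdB; ring.
Qed.

Lemma devgradD u1 u2 : devgrad (u1 + u2) = devgrad u1 + devgrad u2.
Proof.
have gD : grad (u1 + u2) = grad u1 + grad u2.
  by apply/matrixP => i j; rewrite [RHS]mxE !mxE dparD.
rewrite /devgrad gD; apply/matrixP => i j; rewrite [RHS]mxE !devE mxtraceD [(grad u1 + _) i j]mxE.
by rewrite mulrDr mulrnDl; ring.
Qed.

Lemma peel t m L : inPT m.+1 t -> Tr0 v (symcurl t) -> uniq L -> (size L <= m.+2)%N ->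
  exists2 u, inPmx m.+2 u & forall g, g \in L -> TrC g (t - devgrad u).
Proof.
move=> dt ht; elim: L => [_ _|f L ih /= /andP [fL uL] sL].
  by exists 0 => // i j; rewrite mxE; apply: inPm0.
have [u du hu] := ih uL (ltnW sL).
have [du1 _] := inPT_devgrad du.
have d1 : inPmx m.+1 (t - devgrad u).
  by move=> i j; rewrite mxBE; apply: inPmB; [apply: (dt.1) | apply: du1].
have h1 : Tr0 v (symcurl (t - devgrad u)) by rewrite symcurlB symcurl_devgrad subr0.
have [u' [du' hu']] := peel_step d1 h1 uL fL (ltnW sL) hu.
exists (u + u').
  by move=> i j; rewrite mxE; apply: inPmD.
by move=> g gL; rewrite devgradD opprD addrA; apply: hu'.
Qed.

Lemma Tr0_symcurl_Bsc t l : (3 <= l)%N -> inPT (l + 1) t -> Tr0 v (symcurl t) ->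
  exists2 t', Bsc v l t' & symcurl t' = symcurl t.
Proof.
move=> l3 dt ht; rewrite addn1 in dt.
have [|u du hu] := peel dt ht (enum_uniq 'I_4).
  by rewrite size_enum_ord; lia.
exists (t - devgrad u); last by rewrite symcurlB symcurl_devgrad subr0.
apply/(bscP nondeg); split; last by move=> f; apply: hu; rewrite mem_enum.
have [du1 du2] := inPT_devgrad du; rewrite addn1; split.
  by move=> i j; rewrite mxBE; apply: inPmB; [apply: (dt.1) | apply: du1].
by rewrite linearB /= dt.2 du2 subr0.
Qed.

End PeelingStep.

(** * Stokes' formula and orthogonality to affine functions *)

Section Stokes.
Variables (R : rcfType) (v : 'I_4 -> 'rV[R]_3).
Hypothesis nondeg : tet_nondeg v.
Local Notation P := {mpoly R[3]}.
Local Notation dl := (dl v).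
Local Notation lam := (lam v).
Local Notation van := (van v).
Implicit Types (p q : P) (y : 'rV[R]_3) (b c f g : 'I_4) (s : 'M[P]_3)
  (V W : 'I_3 -> P) (B : {set 'I_3}).

Let o : 'I_4 := ord0.
Let b : 'I_3 -> 'I_4 := fv ord0.
Let F : P -> P := chart v o b.
Let ob : uniq [:: o; b 0; b 1; b 2%:R] := fv_uniq ord0.

Lemma simpf_van B e p : van (b @: B) p -> simpf B e (F p) = 0.
Proof.
by move=> /(van_chart nondeg ob) h; rewrite simpf_kill h /simpint msupp0 big_nil.
Qed.

Lemma simpf_chartD B e p q : simpf B e (F (p + q)) = simpf B e (F p) + simpf B e (F q).
Proof. by rewrite /F /chart subD /simpf mlinD. Qed.

Lemma simpf_chartN B e p : simpf B e (F (- p)) = - simpf B e (F p).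
Proof. by rewrite /F /chart subN -scaleN1r /simpf mlinZ mulN1r. Qed.

Lemma simpf_chart_sum B e (I : Type) (r : seq I) (Q : pred I) (G : I -> P) :
  simpf B e (F (\sum_(i <- r | Q i) G i)) = \sum_(i <- r | Q i) simpf B e (F (G i)).
Proof. by rewrite /F /chart sub_sum /simpf mlin_sum. Qed.

(** Modulo polynomials vanishing on the flat of [B], [p] is a multiple of [lam o], which is zero on
    the slanted facet. *)
Lemma simpf_slanted B e p : (e + #|B| = 2)%N -> van (o |: b @: B) p -> simpf B e (F p) = 0.
Proof.
move=> eB h.
have oB : o \notin b @: B.
  by apply/imsetP => -[i _ e']; have := chart_neq ob i; rewrite -e' eqxx.
have [c [co cB]] : exists c, c != o /\ c \notin b @: B.
  have [i iB] : exists i, i \notin B.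
    apply/existsP; apply: contraT; rewrite negb_exists => /forallP h'.
    have : (#|'I_3| <= #|B|)%N by apply: subset_leq_card; apply/subsetP => i _; have := h' i; rewrite negbK.
    by rewrite card_ord; lia.
  exists (b i); rewrite (chart_neq ob); split=> //; apply/imsetP => -[j jB /eqP].
  by rewrite (chart_inj ob) => /eqP ij; rewrite ij jB in iB.
have [r _ hr] := van_div nondeg co cB oB (leqnSn _ : inPm (msize p) p) h.
rewrite -[p](subrK (lam o * r)) simpf_chartD (simpf_van _ hr) add0r /F chartM.
by rewrite (chart_lam0 nondeg ob) simpf_lam0.
Qed.

Lemma sum_dl_chart V : \sum_i dotP (dl (b i)) V = - dotP (dl o) V.
Proof.
apply/eqP; rewrite -addr_eq0 -dotP_suml -dotPDl addrC.
by rewrite -(chart_sum ob) dl_sum dotP0l.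
Qed.

Lemma chart_divv V : F (divv V) = \sum_i dpar i (F (dotP (dl (b i)) V)).
Proof.
rewrite (divv_edges nondeg o) (chart_sum ob) subrr dird0l add0r /F /chart sub_sum.
by apply: eq_bigr => i _; rewrite deriv_sub.
Qed.

(** The divergence theorem on the tetrahedron; the three slanted boundary terms combine into one
    because the [dl a] sum to zero. *)
Lemma simpf3_divv V : simpf set0 3 (F (divv V)) =
  - simpf set0 2 (F (dotP (dl o) V)) - \sum_i simpf [set i] 2 (F (dotP (dl (b i)) V)).
Proof.
rewrite chart_divv /simpf mlin_sum.
rewrite (eq_bigr (fun i => simpf set0 2 (F (dotP (dl (b i)) V)) -
   simpf [set i] 2 (F (dotP (dl (b i)) V)))) => [|i _].
  by rewrite sumrB -simpf_chart_sum sum_dl_chart simpf_chartN.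
by rewrite -/(simpf _ _ _) simpf_deriv ?inE // setU0.
Qed.

(** The divergence theorem on a face, for a tangent field without flux through the edges. *)
Lemma simpf2_divv i V : dotP (dl (b i)) V = 0 ->
  (forall g, g != b i -> van [set b i; g] (dotP (dl g) V)) ->
  simpf [set i] 2 (F (divv V)) = 0.
Proof.
move=> h0 h; rewrite chart_divv /simpf mlin_sum.
have bo j : b j != o by rewrite (chart_neq ob).
rewrite (eq_bigr (fun j => simpf [set i] 1 (F (dotP (dl (b j)) V)))) => [|j _].
  rewrite -simpf_chart_sum sum_dl_chart simpf_chartN simpf_slanted ?oppr0 ?cards1 //.
  by rewrite imset_set1 setUC; apply: h; rewrite eq_sym.
rewrite -/(simpf _ _ _); have [->|ji] := eqVneq j i.
  by rewrite h0 /F /chart /sub raddf0 dpar0 /simpf !mlin0.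
rewrite simpf_deriv ?inE // (@simpf_van (j |: [set i])) ?subr0 //.
rewrite imsetU1 imset_set1 setUC; apply: h; by rewrite (chart_inj ob).
Qed.

Lemma simpf2_divv_slanted V : dotP (dl o) V = 0 ->
  (forall g, g != o -> van [set o; g] (dotP (dl g) V)) -> simpf set0 2 (F (divv V)) = 0.
Proof.
move=> h0 h; rewrite chart_divv /simpf mlin_sum.
rewrite (eq_bigr (fun j => simpf set0 1 (F (dotP (dl (b j)) V)))) => [|j _].
  by rewrite -simpf_chart_sum sum_dl_chart h0 oppr0 /F /chart /sub raddf0 /simpf mlin0.
rewrite -/(simpf _ _ _) simpf_deriv ?inE // setU0 [X in _ - X]simpf_slanted ?subr0 ?cards1 //.
by rewrite imset_set1; apply: h; rewrite (chart_neq ob).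
Qed.

Lemma dpar2_affine q i j : inPm 1 q -> dpar i (dpar j q) = 0.
Proof. by move=> /(@inPm_deriv R 0 j) /(@inPm0_const R) e; rewrite /dpar e mderivC. Qed.

(** The field [q div s - s grad q] of Green's formula; for affine [q] and symmetric [s] its
    divergence is [q div div s]. *)
Definition flux s q (i : 'I_3) : P := q * (\sum_j dpar j (s i j)) - \sum_j s i j * dpar j q.

Lemma divv_flux s q : s^T = s -> inPm 1 q -> divv (flux s q) = divdiv s * q.
Proof.
move=> hs dq; have sE i j : s i j = s j i by rewrite -{1}hs mxE.
have e i : dpar i (flux s q i) = q * (\sum_j dpar i (dpar j (s i j))) +
    (\sum_j dpar i q * dpar j (s i j) - \sum_j dpar i (s i j) * dpar j q).
  rewrite /flux dparB dparM !dpar_sum -mulr_sumr.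
  rewrite [X in _ - X = _](eq_bigr (fun j => dpar i (s i j) * dpar j q)) => [|j _]; first by ring.
  by rewrite dparM dpar2_affine // mulr0 addr0.
rewrite /divv (eq_bigr _ (fun i _ => e i)) big_split /= sumrB /divdiv mulrC -mulr_sumr.
rewrite [X in _ + (X - _)]exchange_big [X in _ + (X - _)](eq_bigr (fun i => \sum_j dpar i (s i j) * dpar j q)).
  by rewrite subrr addr0.
by move=> i _; apply: eq_bigr => j _; rewrite sE mulrC.
Qed.

(** [W] is the tangential part of [q s n]. The normal flux plus [div W] is [q] times the second
    trace minus a multiple of the first, so on [F_f] the flux is minus a surface divergence. *)
Lemma flux_face s q f : s^T = s -> Tr0 v s -> exists W, [/\ dotP (dl f) W = 0,
  forall g, g != f -> van [set f; g] (dotP (dl g) W) &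
  van [set f] (dotP (dl f) (flux s q) + divv W)].
Proof.
move=> hs [h1 h2 h3]; have sE i j : s i j = s j i by rewrite -{1}hs mxE.
pose g0 := dotP (dl f) (mv s (dl f)).
pose W i : P := q * (mv s (dl f) i - g0 * cP (mf v f 0 i)); exists W.
have dW y : dotP y W = q * (dotP y (mv s (dl f)) - g0 * cP (dotv y (mf v f))).
  by rewrite /W dotPMr dotPBr dotPMr dotPcP.
split; first by rewrite dW dl_mf // cP1 mulr1 subrr mulr0.
  move=> g gf; rewrite dW; apply: vanMl; apply: vanB.
    by rewrite setUC; apply: h3.
  by apply: vanMr; apply: vanS (h1 f); rewrite subsetUl.
have e1 : dotP (dl f) (flux s q) = q * divv (mv s (dl f)) - \sum_i mv s (dl f) i * dpar i q.
  rewrite /flux dotPBr dotPMr; congr (q * _ - _).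
    rewrite /dotP /divv (eq_bigr (fun i => \sum_j dpar j (s j i * cP (dl f 0 i)))) => [|i _].
      by rewrite exchange_big; apply: eq_bigr => i _; rewrite /mv dpar_sum.
    by rewrite mulr_sumr; apply: eq_bigr => j _; rewrite [in RHS]mulrC dparMC sE.
  rewrite /dotP (eq_bigr (fun i => \sum_j s j i * cP (dl f 0 i) * dpar j q)) => [|i _].
    by rewrite exchange_big; apply: eq_bigr => i _; rewrite /mv mulr_suml.
  by rewrite mulr_sumr; apply: eq_bigr => j _; rewrite sE; ring.
have e2 : divv W = q * (divv (mv s (dl f)) - dird (mf v f) g0) +
    \sum_i mv s (dl f) i * dpar i q - g0 * dird (mf v f) q.
  rewrite /divv (eq_bigr (fun i => q * (dpar i (mv s (dl f) i) - cP (mf v f 0 i) * dpar i g0) +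
    (mv s (dl f) i * dpar i q - g0 * (cP (mf v f 0 i) * dpar i q)))) => [|i _].
    by rewrite big_split /= -mulr_sumr !sumrB -mulr_sumr /dird; ring.
  by rewrite /W dparM dparB dparM dparcP; ring.
have e3 : dotP (dl f) (flux s q) + divv W =
   q * (2%:R * divv (mv s (dl f)) - dird (mf v f) g0) - g0 * dird (mf v f) q.
  rewrite e1 e2; move: (divv _) (dird _ g0) (dird _ q) (\sum_i _) => *; ring.
by rewrite e3; apply: vanB; [apply: vanMl | apply: vanMr].
Qed.

Lemma divdiv_orthogonal s q : s^T = s -> Tr0 v s -> inPm 1 q -> intK v (divdiv s * q) = 0.
Proof.
move=> hs ht dq; rewrite intKE -(divv_flux hs dq) -/b -/o -/F simpf3_divv.
have -> : simpf set0 2 (F (dotP (dl o) (flux s q))) = 0.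
  have [W [w1 w2 w3]] := flux_face q o hs ht.
  rewrite -[dotP _ _](addrK (divv W)) simpf_chartD simpf_chartN simpf2_divv_slanted // subr0.
  by apply: simpf_slanted; rewrite ?cards0 // imset0 setU0.
rewrite big1 ?subr0 ?oppr0 ?mulr0 // => i _.
have [W [w1 w2 w3]] := flux_face q (b i) hs ht.
rewrite -[dotP _ _](addrK (divv W)) simpf_chartD simpf_chartN simpf2_divv // subr0.
by apply: simpf_van; rewrite imset_set1.
Qed.

End Stokes.

(** * Surjectivity of div div *)

Section Surjectivity.
Variables (R : rcfType) (v : 'I_4 -> 'rV[R]_3).
Hypothesis nondeg : tet_nondeg v.
Local Notation P := {mpoly R[3]}.
Local Notation dl := (dl v).
Local Notation lam := (lam v).
Local Notation van := (van v).
Implicit Types (p q r : P) (x y : 'rV[R]_3) (a b c d f : 'I_4) (s t : 'M[P]_3).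

Lemma intK_nondeg p : inPm 1 p -> (forall q, inPm 1 q -> intK v (p * q) = 0) -> p = 0.
Proof.
move=> dp h; apply: mpoly_ev0 => x.
have ob := fv_uniq ord0.
have hv : van (fv ord0 @: set0) p.
  apply: (@van_nondeg R v nondeg ord0 (fv ord0) ob set0 2%N 1%N 0%N 0%MM p _ _ dp).
  - by rewrite cards0.
  - by apply/forall_inP => j; rewrite inE.
  move=> q dq; have := h q dq; rewrite intKE /= mpolyX0 mul1r => /eqP.
  rewrite mulf_eq0 normr_eq0 (_ : \det _ == 0 = false) ?orFb => [/eqP //|].
  apply: negPf; move: nondeg; rewrite /tet_nondeg; congr (\det _ != 0).
  by apply/matrixP => i j; rewrite !mxE.
by apply: hv => a; rewrite imset0 inE.
Qed.

(** Taylor's formula [p = p(0) + sum_i x_i D_i], with 1 and each [x_i] expanded in barycentric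
    coordinates. *)
Lemma lam_decomp n p : inPm n.+1 p ->
  exists2 r : 'I_4 -> P, forall a, inPm n (r a) & p = \sum_a lam a * r a.
Proof.
move=> dp; pose D i := einv 1 (dpar i p).
exists (fun a => cP (p@_0%MM) + \sum_i cP (v a 0 i) * D i).
  move=> a; apply: inPmD; first exact: inPmC.
  by apply: inPm_sum => i _; apply: inPmMC; apply: inPm_einv; apply: inPm_deriv.
transitivity (cP (p@_0%MM) + \sum_i 'X_i * D i).
  transitivity (cP (p@_0%MM) + euler (einv 0 p)); last first.
    by congr (_ + _); apply: eq_bigr => i _; rewrite dpar_einv.
  apply/mpolyP => m; rewrite mcoeffD mcoeff_euler mcoeff_einv mcoeffC addn0.
  have [->|m0] := eqVneq m 0%MM; first by rewrite mdeg0 mulr1 mul0r addr0.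
  by rewrite mulr0 add0r mulrC divfK // pnatr_eq0 mdeg_eq0.
set k := cP _; transitivity (k * \sum_a lam a + \sum_i (\sum_a cP (v a 0 i) * lam a) * D i).
  by rewrite lam_sum mulr1; congr (_ + _); apply: eq_bigr => i _; rewrite -X_expand.
rewrite [RHS](eq_bigr (fun a => k * lam a + \sum_i cP (v a 0 i) * lam a * D i)) => [|a _].
  rewrite [RHS]big_split /= -mulr_sumr; congr (_ + _); rewrite exchange_big.
  by apply: eq_bigr => i _; rewrite mulr_suml.
rewrite mulrDr mulrC mulr_sumr; congr (_ + _); apply: eq_bigr => i _.
by rewrite mulrCA mulrA.
Qed.

Lemma lam_decomp2 n p : inPm n.+2 p -> exists2 r : 'I_4 * 'I_4 -> P,
  forall e, inPm n (r e) & p = \sum_e lam e.1 * lam e.2 * r e.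
Proof.
move=> /lam_decomp [r dr ->].
have /fin_all_exists [r2 h] a : exists r2 : 'I_4 -> P,
    (forall b, inPm n (r2 b)) /\ r a = \sum_b lam b * r2 b.
  by have [r2 d2 e2] := lam_decomp (dr a); exists r2.
exists (fun e => r2 e.1 e.2); first by move=> e; apply: (h e.1).1.
rewrite -(pair_bigA _ (fun a b => lam a * lam b * r2 a b)) /=; apply: eq_bigr => a _.
by rewrite (h a).2 mulr_sumr; apply: eq_bigr => b _; rewrite mulrA.
Qed.

Definition off a (i : 'I_3) : P := 'X_i - cP (v a 0 i).

(* lam a lam b r (x - v a) (x - v b)^T, symmetrised: all traces vanish, because
   dl f . (x - v a) is lam f or lam f - 1, the latter only when f = a. *)
Definition bub a b r : 'M[P]_3 :=
  \matrix_(i, j) (lam a * lam b * r * (off a i * off b j + off b i * off a j)).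

Lemma dotP_off f a : dotP (dl f) (off a) = lam f - (f == a)%:R.
Proof.
rewrite /off dotPBr -/(lin _) dotPcP (lin_lam v f) -addrA; congr (_ + _).
have := ev_lamD v 0 (v a) f; rewrite add0r ev_lam_v // => e.
have -> : (f == a)%:R = cP (ev 0 (lam f)) + cP (dotv (dl f) (v a)) :> P.
  by rewrite -cPD -e /cP rmorph_nat.
ring.
Qed.

(** The cofactor of [lam f] in [lam a * (dl f . (x - v a))]: if [f = a], it is the factor [lam a]
    that supplies [lam f]. *)
Definition kap f a : P := if f == a then lam a - 1 else lam a.

Lemma lam_off f a : lam a * (lam f - (f == a)%:R) = lam f * kap f a.
Proof.
rewrite /kap; have [->|_] := eqVneq; first by [].
by rewrite subr0 mulrC.
Qed.

Lemma mv_bub a b r x i : mv (bub a b r) x i =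
  lam a * lam b * r * (off a i * dotP x (off b) + off b i * dotP x (off a)).
Proof. by rewrite /mv !dotPE sum3 ![bub _ _ _ _ _]mxE; ring. Qed.

Definition bub_field f a b r (i : 'I_3) : P :=
  r * (lam a * kap f b * off a i + lam b * kap f a * off b i).

Lemma mv_bub_dl f a b r i : mv (bub a b r) (dl f) i = lam f * bub_field f a b r i.
Proof.
rewrite mv_bub !dotP_off /bub_field.
transitivity (r * (lam a * (lam b * (lam f - (f == b)%:R)) * off a i +
   lam b * (lam a * (lam f - (f == a)%:R)) * off b i)); first by ring.
by rewrite !lam_off; ring.
Qed.

Lemma dotP_bub_field f a b r : dotP (dl f) (bub_field f a b r) =
  lam f * (2%:R * r * kap f a * kap f b).
Proof.
rewrite /bub_field dotPMr dotPDr !dotPMr !dotP_off.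
transitivity (r * (kap f b * (lam a * (lam f - (f == a)%:R)) + kap f a * (lam b * (lam f - (f == b)%:R)))).
  by ring.
by rewrite !lam_off; ring.
Qed.

Lemma dpar_lam a i : dpar i (lam a) = cP (dl a 0 i).
Proof.
rewrite lamE dparD dparcP add0r dpar_sum (bigD1 i) //= dparMC dparX eqxx mulr1.
by rewrite big1 ?addr0 // => j /negPf ji; rewrite dparMC dparX ji mulr0.
Qed.

(** [s n] is divisible by [lam f] and [n . s n] by its square, so [div (s n)] also vanishes on the
    face: its critical term [n . bub_field] carries the second factor. *)
Lemma Tr0_bub a b r : Tr0 v (bub a b r).
Proof.
have vl f : van [set f] (lam f) by apply: van_lam; rewrite inE.
have E f : dotP (dl f) (mv (bub a b r) (dl f)) = lam f * (lam f * (2%:R * r * kap f a * kap f b)).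
  rewrite (@dotP_ext R _ _ (fun i => lam f * bub_field f a b r i)) => [|i]; last exact: mv_bub_dl.
  by rewrite dotPMr dotP_bub_field.
split=> [f|f|f c fc].
- by rewrite E; apply: vanMr.
- rewrite E (dirdM _ (lam f) (lam f * _)) (dirdM _ (lam f) (2%:R * _ * _ * _)).
  set Z := 2%:R * r * kap f a * kap f b.
  have -> : divv (mv (bub a b r) (dl f)) = lam f * (Z + divv (bub_field f a b r)).
    rewrite mulrDr -dotP_bub_field /divv mulr_sumr -big_split; apply: eq_bigr => i _ /=.
    by rewrite mv_bub_dl dparM dpar_lam.
  set D := divv _; set d1 := dird _ (lam f); set d2 := dird _ Z.
  have := vanMr (2%:R * (Z + D) - d1 * Z - d1 * Z - lam f * d2) (vl f).
  by congr (van _ _); ring.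
rewrite (@dotP_ext R _ _ (fun i => lam c * bub_field c a b r i)) => [|i]; last exact: mv_bub_dl.
by rewrite dotPMr; apply: vanMr; apply: van_lam; rewrite !inE eqxx orbT.
Qed.

Lemma divvD (V W : 'I_3 -> P) : divv (fun i => V i + W i) = divv V + divv W.
Proof. by rewrite /divv -big_split; apply: eq_bigr => i _; rewrite dparD. Qed.

Lemma Tr0D s t : Tr0 v s -> Tr0 v t -> Tr0 v (s + t).
Proof.
move=> [s1 s2 s3] [t1 t2 t3]; split=> [f|f|f c fc].
- by rewrite mv_add; apply: vanD.
- have -> : divv (mv (s + t) (dl f)) = divv (mv s (dl f)) + divv (mv t (dl f)).
    by rewrite -divvD; apply: eq_bigr => i _; rewrite mvDl.
  have := vanD (s2 f) (t2 f); congr (van _ _); rewrite mv_add dirdD.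
  by move: (divv _) (divv (mv t _)) (dird _ _) (dird _ (dotP _ (mv t _))) => *; ring.
- by rewrite mv_add; apply: vanD; [apply: s3 | apply: t3].
Qed.

Lemma Tr0_0 : Tr0 v 0.
Proof.
have m0 x i : mv (0 : 'M[P]_3) x i = 0 by rewrite /mv big1 // => j _; rewrite mxE mul0r.
have d0 x y : dotP y (mv (0 : 'M[P]_3) x) = 0 by rewrite dotPE !m0; ring.
split=> *; rewrite ?d0 ?dird0; try exact: van0.
by rewrite /divv big1 ?mulr0 ?subr0 => [|i _]; [apply: van0 | rewrite m0 dpar0].
Qed.

Lemma divdivD s t : divdiv (s + t) = divdiv s + divdiv t.
Proof.
rewrite /divdiv -big_split; apply: eq_bigr => i _; rewrite -big_split; apply: eq_bigr => j _.
by rewrite mxE !dparD.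
Qed.

Lemma divdivN s : divdiv (- s) = - divdiv s.
Proof.
by apply/eqP; rewrite -addr_eq0 -divdivD addNr /divdiv big1 // => i _; rewrite big1 // => j _; rewrite mxE !dpar0.
Qed.

Lemma xxD q r : xx (q + r) = xx q + xx r.
Proof. by rewrite /xx scalerDl. Qed.

Lemma inPm_divdiv n s : inPmx n.+2 s -> inPm n (divdiv s).
Proof. by move=> h; do 2 apply: inPm_sum => ? _; do 2 apply: inPm_deriv. Qed.

Lemma inPm_divdiv_xx n q : inPm n q -> inPm n (divdiv (xx q)).
Proof. by move=> /inPmP h; apply/inPmP => m hm; rewrite mcoeff_divdiv_xx h ?mulr0. Qed.

Lemma divdiv_xx_eq0 q : divdiv (xx q) = 0 -> q = 0.
Proof.
move=> h; apply/mpolyP => m; have := congr1 (mcoeff m) h.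
rewrite mcoeff_divdiv_xx !mcoeff0 => /eqP; rewrite mulf_eq0 pnatr_eq0 muln_eq0 !addn_eq0 !andbF.
by move=> /eqP.
Qed.

Lemma xx_tr q : (xx q)^T = xx q.
Proof. by apply/matrixP => i j; rewrite mxE !xxE (mulrC 'X_i). Qed.

Lemma divdiv_xx_einv p : divdiv (xx (einv 3 (einv 4 p))) = p.
Proof.
apply/mpolyP => m; rewrite mcoeff_divdiv_xx !mcoeff_einv natrM.
have n3 : (mdeg m + 3)%:R != 0 :> R by rewrite pnatr_eq0 addnS.
have n4 : (mdeg m + 4)%:R != 0 :> R by rewrite pnatr_eq0 addnS.
by field; rewrite -!natrD n3 n4.
Qed.

(** Subtracting [q x x^T] with the same div div, [q] of degree [k - 3], leaves a sym curl of a field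
    of degree [k], and [k <= l + 1]. *)
Lemma inSigma_low l k s : (3 <= k)%N -> (k - 1 <= l)%N -> s^T = s -> inPmx (k - 1) s -> inSigma l k s.
Proof.
move=> k3 kl hs ds; have [n kn] : exists n, k = n.+3 by exists (k - 3)%N; lia.
rewrite kn subn1 /= in ds kl *; pose q := einv 3 (einv 4 (divdiv s)).
have dq : inPm n q by apply: inPm_einv; apply: inPm_einv; apply: inPm_divdiv.
have eq : divdiv (xx q) = divdiv s := divdiv_xx_einv _.
have [|||t dt et] := @divdiv0_symcurl _ n.+1 (s - xx q).
- by rewrite linearB /= hs xx_tr.
- move=> i j; rewrite mxBE; apply: inPmB; first exact: ds.
  by rewrite xxE -addn2; apply: inPmM dq _; apply: inPmM (inPmX _ i) (inPmX _ j).
- by rewrite divdivD divdivN eq subrr.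
exists t, q; split; last by rewrite -et subrK.
- split; last exact: dt.2.
  by move=> i j; apply: inPmW (dt.1 i j); rewrite addn1.
- by apply: inPmW dq; rewrite subn2.
Qed.

Lemma inSigmaD l k s t : inSigma l k s -> inSigma l k t -> inSigma l k (s + t).
Proof.
move=> /inSigmaP [t1 [q1 [[d1 e1] dq1 ->]]] /inSigmaP [t2 [q2 [[d2 e2] dq2 ->]]].
exists (t1 + t2), (q1 + q2); split; last by rewrite -/(xx _) xxD symcurlD addrACA.
- by split=> [i j|]; [rewrite mxE; apply: inPmD | rewrite mxtraceD e1 e2 addr0].
- exact: inPmD.
Qed.

Lemma inSigma_xx l k q : inPm (k - 2) q -> inSigma l k (xx q).
Proof.
move=> dq; exists 0, q; split=> //; last first.
  by rewrite -[symcurl 0](_ : 0 = _) ?add0r //; apply/matrixP => i j; rewrite symcurlE !curlE !mxE !dpar0; ring.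
by split=> [i j|]; [rewrite mxE; apply: inPm0 | rewrite mxtrace0].
Qed.

(** Replacing [x - v a] and [x - v b] by [x] changes only lower-degree terms; the one half undoes
    the doubling by symmetrisation. *)
Lemma bub_xx n a b r : inPm n r ->
  inPmx n.+3 (bub a b (cP 2%:R^-1 * r) - xx (lam a * lam b * r)).
Proof.
move=> dr i j; rewrite mxBE xxE mxE.
have half2 : 2%:R * cP 2%:R^-1 = 1 :> P.
  by rewrite -[2%:R](rmorph_nat (mpolyC 3 (R := R))) -cPM divff ?pnatr_eq0.
rewrite (_ : _ - _ = lam a * lam b * r * (cP 2%:R^-1 *
  (cP (v a 0 i) * cP (v b 0 j) + cP (v b 0 i) * cP (v a 0 j) - (cP (v a 0 i) + cP (v b 0 i)) * 'X_j
   - (cP (v a 0 j) + cP (v b 0 j)) * 'X_i))).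
  rewrite -addn1; apply: inPmM.
    by rewrite -addn2 addnC -[2%N]/(1 + 1)%N; apply: inPmM dr; apply: inPmM; apply: inPm_lam.
  apply: inPmMC; apply: inPmB; first apply: inPmB.
  - by rewrite -!cPM -cPD; apply: inPmC.
  - by rewrite -cPD; apply: inPmMC; apply: inPmX.
  - by rewrite -cPD; apply: inPmMC; apply: inPmX.
rewrite /off -[X in _ - X]mulr1 -half2.
move: (cP 2%:R^-1) (lam a) (lam b) => h la lb; ring.
Qed.

Lemma intKB p q : intK v (p - q) = intK v p - intK v q.
Proof. by rewrite !intKE simpf_chartD simpf_chartN mulrBr. Qed.

Lemma bub_tr a b r : (bub a b r)^T = bub a b r.
Proof. by apply/matrixP => i j; rewrite !mxE; ring. Qed.

Lemma divdiv_surj k l p : (3 <= k)%N -> (k - 1 <= l)%N -> inPm (k - 2) p ->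
  (forall q, inPm 1 q -> intK v (p * q) = 0) ->
  exists s, [/\ Tr0 v s, inSigma l k s & divdiv s = p].
Proof.
move=> k3 kl; move e : (k - 2)%N => d; have : (d <= k - 2)%N by rewrite e.
clear e; elim: d p => [|d IH] p dk dp hp.
  exists 0; split; [exact: Tr0_0 | | ].
    have -> : 0 = xx (0 : P) by rewrite /xx scale0r.
    by apply: inSigma_xx; apply: inPm0.
  by rewrite -[0](subrr 0) divdivD divdivN subrr (intK_nondeg (inPmW _ dp) hp).
(* Splitting off [lam a * lam b] needs degree at least 2; an affine [p] orthogonal to all affine
   functions is zero. *)
have [d1|d1] := leqP d 0.
  apply: (IH p (ltnW dk)) => //.
  by rewrite (intK_nondeg (inPmW _ dp) hp); [apply: inPm0 | lia].
case: d d1 => // n _ in IH dk dp *.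
pose q := einv 3 (einv 4 p).
have dq : inPm n.+2 q by apply: inPm_einv; apply: inPm_einv.
have [r dr eq] := lam_decomp2 dq.
pose S : 'M[P]_3 := \sum_e bub e.1 e.2 (cP 2%:R^-1 * r e).
have trS : S^T = S.
  by rewrite linear_sum; apply: eq_bigr => e _ /=; rewrite bub_tr.
have zS : Tr0 v S.
  by apply: (big_ind (Tr0 v)); [apply: Tr0_0 | apply: Tr0D | move=> e _; apply: Tr0_bub].
have low : inPmx n.+3 (S - xx q).
  rewrite eq /xx scaler_suml -sumrB => i j; rewrite summxE; apply: inPm_sum => e _.
  exact: bub_xx.
have sigS : inSigma l k S.
  rewrite -[S](subrK (xx q)); apply: inSigmaD.
    apply: inSigma_low => //; first by rewrite linearB /= trS xx_tr.
    by move=> i j; apply: inPmW (low i j); lia.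
  by apply: inSigma_xx; apply: inPmW dq.
(* [p - div div S] is [- div div (S - q x x^T)], and the matrix has degree only [n.+3], so the
   degree of [p] drops by one. *)
have [||s [zs ss es]] := IH (p - divdiv S) (ltnW dk).
- rewrite -[p]divdiv_xx_einv -/q -divdivN -divdivD -[xx q - S]opprB divdivN.
  by apply: inPmN; apply: inPm_divdiv.
- by move=> q' dq'; rewrite mulrBl intKB hp // divdiv_orthogonal // subrr.
exists (s + S); split; [exact: Tr0D | exact: inSigmaD |].
by rewrite divdivD es subrK.
Qed.

End Surjectivity.

(** * The complex and its exactness *)

Unset Implicit Arguments.

Theorem theorem5p12 (R : rcfType) (v : 'I_4 -> 'rV[R]_3)
    (en : 'I_2 -> 'I_4 -> 'I_4 -> 'rV[R]_3) (k l : nat) :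
  tet_nondeg v -> edge_normals v en ->
  (3 <= k)%N -> (maxn (k - 1) 3 <= l)%N ->
  (* dev grad maps B_{l+2} into B_{l+1}(sym curl) and is injective *)
      (forall u, Bvec v l u -> Bsc v l (devgrad u)) /\
      (forall u, Bvec v l u -> devgrad u = 0 -> u = 0) /\
      (* sym curl maps B_{l+1}(sym curl) into Sigma-ring *)
      (forall t, Bsc v l t -> Sigma0 v en l k (symcurl t)) /\
      (* exactness at B_{l+1}(sym curl) *)
      (forall t, Bsc v l t ->
         symcurl t = 0 <-> exists2 u, Bvec v l u & t = devgrad u) /\
      (* div div maps Sigma-ring into P_{k-2} cap P_1^perp *)
      (forall s, Sigma0 v en l k s -> PkP1perp v k (divdiv s)) /\
      (* exactness at Sigma-ring:  sym curl B = Sigma-ring cap ker(div div) *)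
      (forall s, (Sigma0 v en l k s /\ divdiv s = 0) <->
         exists2 t, Bsc v l t & s = symcurl t) /\
    (* surjectivity of div div *)
      (forall p, PkP1perp v k p -> exists2 s, Sigma0 v en l k s & divdiv s = p).
Proof.
move=> nondeg hen k3 kl.
have [kl1 l3] : (k - 1 <= l)%N /\ (3 <= l)%N by move: kl; rewrite geq_max => /andP.
have symcurl_Sigma0 t : Bsc v l t -> Sigma0 v en l k (symcurl t).
  move=> /(bscP nondeg) [dt ct]; apply: Tr0_Sigma0 => //; last exact: TrC_Tr0.
  apply/inSigmaP; exists t, 0; split=> //; first exact: inPm0.
  by rewrite /xx scale0r addr0.
split; first exact: bvec_devgrad.
split; first exact: bvec_inj.
split=> //; split.
  move=> t bt; split; first exact: bsc_potential.
  by move=> [u _ ->]; apply: symcurl_devgrad.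
split.
  move=> s hs; have zs := Sigma0_Tr0 nondeg hen k3 kl hs; case: hs => hs _ _ _ _.
  split; last by move=> q; apply: divdiv_orthogonal => //; apply: sigma_tr hs.
  have [t [q [_ dq ->]]] := inSigmaP hs.
  by rewrite divdivD divdiv_symcurl add0r; apply: inPm_divdiv_xx.
split.
  move=> s; split=> [[hs ds]|[t bt ->]]; last by split; [apply: symcurl_Sigma0 | apply: divdiv_symcurl].
  have zs := Sigma0_Tr0 nondeg hen k3 kl hs; case: hs => hs _ _ _ _.
  have [t [q [dt _ es]]] := inSigmaP hs.
  (* div div kills the sym curl summand and is injective on [q x x^T]. *)
  have q0 : q = 0 by apply: divdiv_xx_eq0; rewrite -ds es divdivD divdiv_symcurl add0r.
  have {q0}es : s = symcurl t by rewrite es q0 /xx scale0r addr0.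
  have [|t' bt' et'] := Tr0_symcurl_Bsc nondeg l3 dt; first by rewrite -es.
  by exists t' => //; rewrite et'.
move=> p [dp hp]; have [s [zs ss es]] := divdiv_surj nondeg k3 kl1 dp hp.
by exists s => //; apply: Tr0_Sigma0.
Qed.
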